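(* Let $\sigma\in L_2[0,1]$ be complex-valued, let $d>0$ and \[ \Omega_d(\sigma):=\{\mu\in P_d:\ |\mu|>2be^{2d}\},\qquad b=\|\sigma\|_{L_2}^2\Big(1+\|\sigma\|_{L_1}+e^{\|\sigma\|_{L_1}}\|\sigma\|_{L_2}^2\Big)^2 . \] If $\mu\in\Omega_d(\sigma)$ and $y=y(x,\mu)$ is the solution of \[ (y^{[1]})'(x)-\sigma(x)y^{[1]}(x)+\sigma^2(x)y(x)+\mu^2y(x)=0,\quad x\in[0,1], \] with the initial conditions $y(0)=c_1$, $y^{[1]}(0)=c_2$ ($c_1,c_2\in\mathbb{C}$), then \[ \begin{pmatrix}y\\(i\mu)^{-1}y^{[1]}\end{pmatrix}=W(x,\mu)\vec c_0(\mu)+W_0(x,\mu)\vec c_0(\mu),\qquad \vec c_0(\mu)=\frac12\begin{pmatrix}c_1+\frac{c_2}{i\mu}\\ c_1-\frac{c_2}{i\mu}\end{pmatrix}, \] where \begin{align*} W(x,\mu)&=\begin{bmatrix}e^{i\mu x}&e^{-i\mu x}\\ e^{i\mu x}&-e^{-i\mu x}\end{bmatrix} +\begin{bmatrix}d_1(x,\mu)+d_2(x,-\mu)&d_2(x,\mu)+d_1(x,-\mu)\\ d_1(x,\mu)-d_2(x,-\mu)&d_2(x,\mu)-d_1(x,-\mu)\end{bmatrix}\\ &\quad+\frac{i}{2\mu}\int_0^x\sigma^2(t)\begin{bmatrix}e^{i\mu x}-e^{-i\mu x}e^{2i\mu t}&e^{i\mu x}e^{-2i\mu t}-e^{-i\mu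 x}\\ e^{i\mu x}+e^{-i\mu x}e^{2i\mu t}&e^{i\mu x}e^{-2i\mu t}+e^{-i\mu x}\end{bmatrix}dt\\ &\quad+\frac{i}{2\mu}\begin{bmatrix}q(x,-\mu)&q(x,\mu)\\-q(x,-\mu)&q(x,\mu)\end{bmatrix}\int_0^x\sigma^2(t)\begin{bmatrix}1&e^{-2i\mu t}\\-e^{2i\mu t}&-1\end{bmatrix}dt, \end{align*} \[ q(x,\mu)=-\int_0^xe^{i\mu(x-2t)}\sigma(t)\,dt,\qquad d_1(x,\mu)=\int_0^xe^{i\mu(x-2t)}\tilde\sigma(x,t)\,dt, \] \[ d_2(x,\mu)=q(x,\mu)-\int_0^xe^{i\mu(x-2t)}N_\sigma(x,t)\,dt. \] Moreover, for $\mu\in\Omega_d(\sigma)$, \[ \|W_0(x,\mu)\|_{M(C[0,1])}\le C\rho(\mu), \] where the constant $C>0$ depends only on $d$ and $\|\sigma\|_{L_2}$.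
   Context: $P_d:=\{\mu\in\mathbb{C}:|\mathrm{Im}\,\mu|\le d\}$; $L_p=L_p[0,1]$. For $y$ absolutely continuous on $[0,1]$, the quasi-derivative is $y^{[1]}(x):=y'(x)+\sigma(x)y(x)$; a solution $y$ is a function such that both $y$ and $y^{[1]}$ are absolutely continuous on $[0,1]$ and the equation holds a.e. (This is the regularized form of $y''+qy+\mu^2y=0$ with $q=\sigma'$ in the sense of distributions.) $M(C[0,1])$ is the space of $2\times2$ matrices with entries in $C[0,1]$ (functions of $x$), with norm equal to the sum of the sup-norms of the four entries. For $0\le t\le x\le1$, \[ \tilde\sigma(x,t)=\int_0^{x-t}\sigma(t+\xi)\sigma(\xi)\,d\xi,\qquad N_\sigma(x,t)=\int_0^{x-t}\sigma(t+\xi)\tilde\sigma(t+\xi,\xi)\,d\xi . \] The function $\rho$ is \[ \rho(\mu)=\gamma^2(\mu)+\gamma_1(\mu)+|\mu|^{-1}k_{\sigma^2}(\mu)+|\mu|^{-2}, \] where \[ \gamma(\mu)=2\Big(\Big\|\int_0^xe^{-2i\mu t}\sigma(t)dt\Big\|_{L_2}+\Big\|\int_0^xe^{2i\mu t}\sigma(t)dt\Big\|_{L_2}\Big) \] ($L_2$-norms in $x\in[0,1]$), \[ \gamma_0(x,\mu)=2\Big(\Big|\int_0^xe^{-2i\mu t}\sigma(t)dt\Big|+\Big|\int_0^xe^{2i\mu t}\sigma(t)dt\Big|\Big), \] \[ \gamma_1(\mu)=2\int_0^1|\sigma(s)|\gamma_0^2(s,\mu)\,ds,\qquad k_{\sigma^2}(\mu)=\int_0^1|\sigma(t)|^2\gamma_0(t,\mu)\,dt.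 \] *)

(* Defs.v *)
From HB Require Import structures.
From mathcomp Require Import all_boot all_order all_algebra.
From mathcomp Require Import complex.
From mathcomp Require Import all_classical all_reals all_analysis.

Set Implicit Arguments.
Unset Strict Implicit.
Unset Printing Implicit Defensive.

Import Order.TTheory GRing.Theory Num.Theory.
Import numFieldNormedType.Exports.

Local Open Scope classical_set_scope.
Local Open Scope ring_scope.

(* The modulus as an element of R; the library's `|z| lives in R[i]. *)
Definition cmod {R : realType} (z : R[i]) : R := ComplexField.Normc.normc z.

Definition iu {R : realType} : R[i] := (0 +i* 1)%C.

Definition cexp {R : realType} (z : R[i]) : R[i] :=
  ((expR (complex.Re z) * cos (complex.Im z))
     +i* (expR (complex.Re z) * sin (complex.Im z)))%C.

Definition cint {R : realType} (f : R -> R[i]) (x : R) : R[i] :=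
  ((\int[lebesgue_measure]_(t in `[0, x]) complex.Re (f t))
     +i* (\int[lebesgue_measure]_(t in `[0, x]) complex.Im (f t)))%C.

Definition mxcint {R : realType} (F : R -> 'M[R[i]]_2) (x : R) : 'M[R[i]]_2 :=
  \matrix_(i, j) cint (fun t => F t i j) x.

Definition Lpnorm {R : realType} (p : R) (f : R -> R[i]) : \bar R :=
  Lnorm lebesgue_measure p%:E
    ((fun x => (cmod (f x))%:E) \_ `[0, 1] : R -> \bar R).

Definition L1norm {R : realType} (f : R -> R[i]) : R := fine (Lpnorm 1 f).
Definition L2norm {R : realType} (f : R -> R[i]) : R := fine (Lpnorm 2 f).

Definition in_L2 {R : realType} (f : R -> R[i]) : Prop :=
  [/\ measurable_fun `[(0 : R), 1] (fun x => complex.Re (f x)),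
      measurable_fun `[(0 : R), 1] (fun x => complex.Im (f x)) &
      (Lpnorm 2 f < +oo)%E].

Definition abs_continuous01 {R : realType} (f : R -> R[i]) : Prop :=
  forall e : R, 0 < e -> exists2 del : R, 0 < del &
    forall (n : nat) (u v : 'I_n -> R),
      (forall i, 0 <= u i <= v i /\ v i <= 1) ->
      trivIset setT (fun i => `]u i, v i[%classic) ->
      \sum_i (v i - u i) < del ->
      \sum_i cmod (f (v i) - f (u i)) < e.

Definition is_cderive {R : realType} (f : R -> R[i]) (x : R) (df : R[i]) :=
  is_derive x 1 (fun t => complex.Re (f t)) (complex.Re df) /\
  is_derive x 1 (fun t => complex.Im (f t)) (complex.Im df).

(* y1 is the quasi-derivative y^[1] = y' + sigma y.  It is only determined
   almost everywhere by y, hence it is carried along as a second function;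
   absolute continuity of y1 then selects the continuous representative. *)
Definition is_quasi_derivative {R : realType} (sigma y y1 : R -> R[i]) : Prop :=
  {ae lebesgue_measure, forall x : R, 0 < x < 1 ->
     exists2 dy, is_cderive y x dy & y1 x = dy + sigma x * y x}.

Definition is_solution {R : realType} (sigma : R -> R[i]) (mu : R[i])
    (y y1 : R -> R[i]) : Prop :=
  [/\ abs_continuous01 y, abs_continuous01 y1,
      is_quasi_derivative sigma y y1 &
      {ae lebesgue_measure, forall x : R, 0 < x < 1 ->
         exists2 dy1, is_cderive y1 x dy1 &
           dy1 - sigma x * y1 x + sigma x ^+ 2 * y x + mu ^+ 2 * y x = 0}].

Definition mx2 {T : Type} (a b c d : T) : 'M[T]_2 :=
  \matrix_(i < 2, j < 2)
    if i == ord0 then (if j == ord0 then a else b)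
    else (if j == ord0 then c else d).

Definition cv2 {T : Type} (a b : T) : 'cV[T]_2 :=
  \col_(i < 2) if i == ord0 then a else b.

Definition cont01 {R : realType} (f : R -> R[i]) : Prop :=
  {within `[(0 : R), 1], continuous (fun x => complex.Re (f x))} /\
  {within `[(0 : R), 1], continuous (fun x => complex.Im (f x))}.

Definition in_MC01 {R : realType} (A : R -> 'M[R[i]]_2) : Prop :=
  forall i j, cont01 (fun x => A x i j).

(* The suprema are genuine for the continuous entries of in_MC01. *)
Definition MC01norm {R : realType} (A : R -> 'M[R[i]]_2) : R :=
  \sum_i \sum_j sup [set cmod (A x i j) | x in `[(0 : R), 1]].

Definition strip {R : realType} (d : R) : set R[i] :=
  [set mu | `|complex.Im mu| <= d].

Definition bconst {R : realType} (sigma : R -> R[i]) : R :=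
  L2norm sigma ^+ 2 *
  (1 + L1norm sigma + expR (L1norm sigma) * L2norm sigma ^+ 2) ^+ 2.

Definition Omega {R : realType} (d : R) (sigma : R -> R[i]) : set R[i] :=
  [set mu | strip d mu /\ 2 * bconst sigma * expR (2 * d) < cmod mu].

Definition stilde {R : realType} (sigma : R -> R[i]) (x t : R) : R[i] :=
  cint (fun xi => sigma (t + xi) * sigma xi) (x - t).

Definition Nsigma {R : realType} (sigma : R -> R[i]) (x t : R) : R[i] :=
  cint (fun xi => sigma (t + xi) * stilde sigma (t + xi) xi) (x - t).

Definition expint {R : realType} (sigma : R -> R[i]) (mu : R[i]) (x : R) : R[i] :=
  cint (fun t => cexp (2 * iu * mu * t%:C%C) * sigma t) x.

Definition gamma {R : realType} (sigma : R -> R[i]) (mu : R[i]) : R :=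
  2 * (L2norm (expint sigma (- mu)) + L2norm (expint sigma mu)).

Definition gamma0 {R : realType} (sigma : R -> R[i]) (x : R) (mu : R[i]) : R :=
  2 * (cmod (expint sigma (- mu) x) + cmod (expint sigma mu x)).

Definition gamma1 {R : realType} (sigma : R -> R[i]) (mu : R[i]) : R :=
  2 * \int[lebesgue_measure]_(s in `[0, 1])
        (cmod (sigma s) * gamma0 sigma s mu ^+ 2).

Definition ksigma2 {R : realType} (sigma : R -> R[i]) (mu : R[i]) : R :=
  \int[lebesgue_measure]_(t in `[0, 1])
    (cmod (sigma t) ^+ 2 * gamma0 sigma t mu).

Definition rho {R : realType} (sigma : R -> R[i]) (mu : R[i]) : R :=
  gamma sigma mu ^+ 2 + gamma1 sigma mu + (cmod mu)^-1 * ksigma2 sigma mu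
  + (cmod mu) ^- 2.

Definition qf {R : realType} (sigma : R -> R[i]) (x : R) (mu : R[i]) : R[i] :=
  - cint (fun t => cexp (iu * mu * (x - 2 * t)%:C%C) * sigma t) x.

Definition d1 {R : realType} (sigma : R -> R[i]) (x : R) (mu : R[i]) : R[i] :=
  cint (fun t => cexp (iu * mu * (x - 2 * t)%:C%C) * stilde sigma x t) x.

Definition d2 {R : realType} (sigma : R -> R[i]) (x : R) (mu : R[i]) : R[i] :=
  qf sigma x mu
  - cint (fun t => cexp (iu * mu * (x - 2 * t)%:C%C) * Nsigma sigma x t) x.

Definition W {R : realType} (sigma : R -> R[i]) (x : R) (mu : R[i]) :
    'M[R[i]]_2 :=
  let ep := cexp (iu * mu * x%:C%C) in
  let em := cexp (- (iu * mu * x%:C%C)) in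
  let Ep t := cexp (2 * iu * mu * t%:C%C) in
  let Em t := cexp (- (2 * iu * mu * t%:C%C)) in
  mx2 ep em
      ep (- em)
  + mx2 (d1 sigma x mu + d2 sigma x (- mu)) (d2 sigma x mu + d1 sigma x (- mu))
        (d1 sigma x mu - d2 sigma x (- mu)) (d2 sigma x mu - d1 sigma x (- mu))
  + (iu / (2 * mu)) *: mxcint (fun t => sigma t ^+ 2 *:
      mx2 (ep - em * Ep t) (ep * Em t - em)
          (ep + em * Ep t) (ep * Em t + em)) x
  + (iu / (2 * mu)) *:
      (mx2 (qf sigma x (- mu)) (qf sigma x mu)
           (- qf sigma x (- mu)) (qf sigma x mu)
       *m mxcint (fun t => sigma t ^+ 2 *:
            mx2 1 (Em t)
                (- Ep t) (-1)) x).

Definition c0vec {R : realType} (c1 c2 mu : R[i]) : 'cV[R[i]]_2 :=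
  2^-1 *: cv2 (c1 + c2 / (iu * mu)) (c1 - c2 / (iu * mu)).

(* Main.v *)
Require Import Defs.
From HB Require Import structures.
From mathcomp Require Import all_boot all_order all_algebra.
From mathcomp Require Import complex.
From mathcomp Require Import all_classical all_reals all_analysis.
From mathcomp Require Import measurable_realfun.
From mathcomp Require Import ring lra.

Set Implicit Arguments.
Unset Strict Implicit.
Unset Printing Implicit Defensive.

Import Order.TTheory GRing.Theory Num.Theory.
Import numFieldNormedType.Exports.
Local Open Scope classical_set_scope.
Local Open Scope ring_scope.

(** Let v be the vector of the components of (y, y1 / (i mu)) in the basis that
    diagonalizes the free equation, and w the vector obtained from v by factoring
    out the free evolution.  Then w' = (A + B) w, where A is off-diagonal with
    entries - sigma(t) exp (-+ 2 i mu t) and B is quadratic in sigma and of size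
    1 / |mu|.  Since sigma is only square-integrable, this holds almost everywhere;
    the fundamental theorem of calculus for absolutely continuous functions
    ([abs_continuous_FTC]) turns it into an integral equation
    ([solution_Volterra]), whose solution is unique ([volterra_unique]).

    Write a, a2, a3 for the first three iterated integrals of A, and p for the
    integral of B.  The matrix W is the frame of the free equation times
    1 + a + a2 + a3 + p + a p ([W_factor]).  The functions [stilde] and [Nsigma]
    arise from the substitution t = tau + xi in a2 and a3 ([cint_shear]).
    This truncated series satisfies the integral equation up to the defect
    [forcing], a sum of integrals of A a3, a B, A a p, B a, B a2, B a3, B p and
    B a p.  Every entry of a is an oscillatory integral, so |a| <= [gamma0].
    Hence
    - integrals with one factor a and one factor A are O(gamma), by the
      Cauchy-Schwarz inequality; this bounds a2;
    - integration by parts gives a3 = a a2 - (integral of a A a), so that the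
      integral of A a3 is O(gamma ^ 2 + gamma1);
    - integrals with one a and one B are O(ksigma2 / |mu|), those of B p are
      O(1 / |mu| ^ 2), and the remaining ones are O(gamma / |mu|).
    Altogether the defect is O(rho) ([forcing_le], [defect_arith]).

    The remainder is the frame times the solution of the Volterra equation whose
    inhomogeneity is the defect.  Picard iteration gives this solution together
    with its bound by the defect times the exponential of the integral of
    |A| + |B| ([volterra_exists]).  On Omega the contribution of B to that
    integral is at most 1, so that the constants depend on d and on the L2 norm
    of sigma only. *)

(** * The modulus and the exponential of complex numbers *)

Section ComplexNumbers.
Context {R : realType}.
Implicit Types z w : R[i].

Lemma cmodM z w : cmod (z * w) = cmod z * cmod w.
Proof. exact: ComplexField.Normc.normcM. Qed.

Lemma cmod0 : cmod (0 : R[i]) = 0.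
Proof. exact: ComplexField.Normc.normc0. Qed.

Lemma cmod1 : cmod (1 : R[i]) = 1.
Proof. exact: ComplexField.Normc.normc1. Qed.

Lemma cmodV z : cmod z^-1 = (cmod z)^-1.
Proof. exact: ComplexField.Normc.normcV. Qed.

Lemma cmod_ge0 z : 0 <= cmod z.
Proof. by case: z => a b; exact: sqrtr_ge0. Qed.

Lemma cmodE z : cmod z = Num.sqrt (complex.Re z ^+ 2 + complex.Im z ^+ 2).
Proof. by case: z. Qed.

Lemma cmodD z w : cmod (z + w) <= cmod z + cmod w.
Proof.
have := ler_normD z w.
by rewrite /Num.norm/= /ltc -rmorphD lecR.
Qed.

Lemma cmodN z : cmod (- z) = cmod z.
Proof. by case: z => a b; rewrite /cmod/= !sqrrN. Qed.

Lemma cmod_eq0 z : cmod z = 0 -> z = 0.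
Proof. exact: ComplexField.Normc.eq0_normc. Qed.

Lemma cmod_real (r : R) : cmod r%:C%C = `|r|.
Proof. by rewrite /cmod/= expr0n/= addr0 sqrtr_sqr. Qed.

Lemma cmod_iu : cmod (iu : R[i]) = 1.
Proof. by rewrite /cmod/= expr0n/= expr1n add0r sqrtr1. Qed.

Lemma Re_le_cmod z : `|complex.Re z| <= cmod z.
Proof.
by rewrite cmodE -sqrtr_sqr ler_wsqrtr// lerDl sqr_ge0.
Qed.

Lemma Im_le_cmod z : `|complex.Im z| <= cmod z.
Proof.
by rewrite cmodE -sqrtr_sqr ler_wsqrtr// lerDr sqr_ge0.
Qed.

Lemma cmod_le_ReIm z : cmod z <= `|complex.Re z| + `|complex.Im z|.
Proof.
rewrite cmodE -[leRHS]ger0_norm ?addr_ge0// -[leRHS]sqrtr_sqr.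
rewrite ler_wsqrtr// sqrrD !real_normK ?num_real// -addrA [X in _ <= _ + X]addrC.
by rewrite lerD2l lerDl mulrn_wge0// mulr_ge0.
Qed.

Lemma cReM z w : complex.Re (z * w) =
  complex.Re z * complex.Re w - complex.Im z * complex.Im w.
Proof. by case: z => ? ?; case: w. Qed.

Lemma cImM z w : complex.Im (z * w) =
  complex.Re z * complex.Im w + complex.Im z * complex.Re w.
Proof. by case: z => ? ?; case: w. Qed.

Lemma cReD z w : complex.Re (z + w) = complex.Re z + complex.Re w.
Proof. by case: z => ? ?; case: w. Qed.

Lemma cImD z w : complex.Im (z + w) = complex.Im z + complex.Im w.
Proof. by case: z => ? ?; case: w. Qed.

Lemma cReN z : complex.Re (- z) = - complex.Re z.
Proof. by case: z. Qed.

Lemma cImN z : complex.Im (- z) = - complex.Im z.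
Proof. by case: z. Qed.

Lemma complex_ext z w :
  complex.Re z = complex.Re w -> complex.Im z = complex.Im w -> z = w.
Proof. by case: z => a b; case: w => c d /= -> ->. Qed.

Lemma cmod_conjc z : cmod (conjc z) = cmod z.
Proof. by case: z => a b; rewrite /cmod/= sqrrN. Qed.

Lemma mul_conjc z : conjc z * z = (cmod z ^+ 2)%:C%C.
Proof.
rewrite cmodE sqr_sqrtr ?addr_ge0 ?sqr_ge0//.
by case: z => a b; apply: complex_ext; rewrite ?cReM ?cImM/=; ring.
Qed.

Lemma iu_neq0 : (iu : R[i]) != 0.
Proof. by rewrite eq_complex/= oner_eq0 andbF. Qed.

Lemma sqr_iu : (iu : R[i]) ^+ 2 = -1.
Proof. by rewrite expr2; apply: complex_ext; rewrite ?cReM ?cImM ?cReN ?cImN/=; ring. Qed.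

Lemma cexpD z w : cexp (z + w) = cexp z * cexp w.
Proof.
apply: complex_ext; rewrite /cexp ?cReM ?cImM/= cReD cImD expRD ?cosD ?sinD; ring.
Qed.

Lemma cexp0 : cexp (0 : R[i]) = 1.
Proof. by rewrite /cexp/= expR0 cos0 sin0 mulr1 mulr0. Qed.

Lemma cmod_cexp z : cmod (cexp z) = expR (complex.Re z).
Proof.
rewrite /cexp /cmod/= !exprMn -mulrDr cos2Dsin2 mulr1 sqrtr_sqr.
by rewrite gtr0_norm ?expR_gt0.
Qed.

End ComplexNumbers.

(** * Integration of complex functions on the unit interval *)

Section ComplexIntegral.
Context {R : realType}.
Local Notation mu := (@lebesgue_measure R).
Implicit Types (f g h : R -> R[i]) (x : R) (c : R[i]).

(** Measurability on [0, 1] of the real and imaginary parts. *)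
Definition cmeasurable f : Prop :=
  measurable_fun `[(0 : R), 1] (fun x => complex.Re (f x)) /\
  measurable_fun `[(0 : R), 1] (fun x => complex.Im (f x)).

(** Integrability on [0, 1]. *)
Definition cintegrable f : Prop :=
  mu.-integrable `[(0 : R), 1] (fun x => (complex.Re (f x))%:E) /\
  mu.-integrable `[(0 : R), 1] (fun x => (complex.Im (f x))%:E).

(** Bounded measurable functions on [0, 1]: the multipliers of [cintegrable]. *)
Definition cbounded f : Prop := cmeasurable f /\
  exists M : R, forall x, 0 <= x <= 1 -> cmod (f x) <= M.

Lemma in01P x : `[(0 : R), 1]%classic x <-> 0 <= x <= 1.
Proof. by rewrite /= in_itv/=. Qed.

Lemma sub_0x_01 x : x <= 1 -> `[0, x]%classic `<=` `[(0 : R), 1]%classic.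
Proof. by move=> x1 t; rewrite /= !in_itv/= => /andP[-> /le_trans]; exact. Qed.

Lemma integrable_0x (r : R -> \bar R) x : x <= 1 ->
  mu.-integrable `[(0 : R), 1] r -> mu.-integrable `[0, x] r.
Proof. by move=> x1; apply: integrableS => //; exact: sub_0x_01. Qed.

Lemma cintegrable_meas f : cintegrable f -> cmeasurable f.
Proof. by case=> /measurable_int/measurable_EFinP ? /measurable_int/measurable_EFinP. Qed.

Lemma cmeasurable_cmod f : cmeasurable f ->
  measurable_fun `[(0 : R), 1] (fun x => cmod (f x)).
Proof.
move=> [mR mI].
rewrite (_ : (fun x => _) = Num.sqrt \o
   (fun x => complex.Re (f x) ^+ 2 + complex.Im (f x) ^+ 2)); last first.
  by apply/funext => x; rewrite cmodE.
apply: measurableT_comp.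
  by apply: continuous_measurable_fun; exact: sqrt_continuous.
by apply: measurable_funD; exact: measurable_funX.
Qed.

Lemma cmeasurableM f g : cmeasurable f -> cmeasurable g ->
  cmeasurable (fun x => f x * g x).
Proof.
move=> [fR fI] [gR gI]; split.
- apply: eq_measurable_fun (measurable_funB (measurable_funM fR gR)
    (measurable_funM fI gI)) => x _; by rewrite cReM.
- apply: eq_measurable_fun (measurable_funD (measurable_funM fR gI)
    (measurable_funM fI gR)) => x _; by rewrite cImM.
Qed.

Lemma cmeasurableD f g : cmeasurable f -> cmeasurable g ->
  cmeasurable (fun x => f x + g x).
Proof.
move=> [fR fI] [gR gI]; split.
- by apply: eq_measurable_fun (measurable_funD fR gR) => x _; rewrite cReD.
- by apply: eq_measurable_fun (measurable_funD fI gI) => x _; rewrite cImD.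
Qed.

Lemma cmeasurable_cst c : cmeasurable (fun=> c).
Proof. by split; exact: measurable_cst. Qed.

Lemma cintegrable_cmod f : cintegrable f ->
  mu.-integrable `[(0 : R), 1] (fun x => (cmod (f x))%:E).
Proof.
move=> fi; have [mR mI] := cintegrable_meas fi.
move: fi => [/integrable_norm iR /integrable_norm iI].
apply: le_integrable (integrableD _ iR iI) => //.
  by apply/measurable_EFinP; apply: cmeasurable_cmod.
move=> x _ /=; rewrite lee_fin ger0_norm ?cmod_ge0//.
by rewrite ger0_norm ?addr_ge0//; exact: cmod_le_ReIm.
Qed.

Lemma le_cintegrable f (r : R -> R) : cmeasurable f ->
  mu.-integrable `[(0 : R), 1] (fun x => (r x)%:E) ->
  (forall x, 0 <= x <= 1 -> cmod (f x) <= r x) -> cintegrable f.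
Proof.
move=> [mR mI] ir fr; split.
- apply: le_integrable ir => //; first exact/measurable_EFinP.
  move=> x /in01P x01; rewrite lee_fin (le_trans (Re_le_cmod _))//.
  by rewrite (le_trans (fr _ x01))// ler_norm.
- apply: le_integrable ir => //; first exact/measurable_EFinP.
  move=> x /in01P x01; rewrite lee_fin (le_trans (Im_le_cmod _))//.
  by rewrite (le_trans (fr _ x01))// ler_norm.
Qed.

Lemma integrable01_cst (k : R) : mu.-integrable `[(0 : R), 1] (fun=> k%:E).
Proof.
apply/integrableP; split; first exact: measurable_cst.
by rewrite integral_cst//= lebesgue_measure_itv/= lte01 EFinN sube0 mule1 ltry.
Qed.

Lemma Rintegral01_cst (k : R) : \int[mu]_(x in `[0, 1]) k = k.
Proof.
by rewrite /Rintegral integral_cst//= lebesgue_measure_itv/= lte01 EFinN sube0 mule1.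
Qed.

Lemma cbounded_integrable f : cbounded f -> cintegrable f.
Proof.
by move=> [mf [M fM]]; apply: le_cintegrable fM => //; exact: integrable01_cst.
Qed.

(** The product needs one bounded factor, which is listed second. *)
Lemma cintegrableM f g : cintegrable f -> cbounded g ->
  cintegrable (fun x => f x * g x).
Proof.
move=> fi [mg [M gM]].
apply: (@le_cintegrable _ (fun x => M * cmod (f x))).
- by apply: cmeasurableM => //; exact: cintegrable_meas.
- exact: (integrableZl _ M (cintegrable_cmod fi)).
- by move=> x x01; rewrite cmodM mulrC ler_wpM2r ?cmod_ge0 ?gM.
Qed.

Lemma cintegrableD f g : cintegrable f -> cintegrable g ->
  cintegrable (fun x => f x + g x).
Proof.
move=> [fR fI] [gR gI]; split.
- by apply: eq_integrable (integrableD _ fR gR) => // x _; rewrite cReD.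
- by apply: eq_integrable (integrableD _ fI gI) => // x _; rewrite cImD.
Qed.

Lemma cboundedM f g : cbounded f -> cbounded g -> cbounded (fun x => f x * g x).
Proof.
move=> [mf [M fM]] [mg [N gN]]; split; first exact: cmeasurableM.
by exists (M * N) => x x01; rewrite cmodM ler_pM ?cmod_ge0 ?fM ?gN.
Qed.

Lemma cboundedD f g : cbounded f -> cbounded g -> cbounded (fun x => f x + g x).
Proof.
move=> [mf [M fM]] [mg [N gN]]; split; first exact: cmeasurableD.
by exists (M + N) => x x01; rewrite (le_trans (cmodD _ _))// lerD ?fM ?gN.
Qed.

Lemma cbounded_cst c : cbounded (fun=> c).
Proof. by split; [exact: cmeasurable_cst|exists (cmod c)]. Qed.

Lemma cboundedN f : cbounded f -> cbounded (fun x => - f x).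
Proof.
move=> bf; rewrite (_ : (fun x => _) = fun x => -1 * f x).
  by apply: cboundedM => //; exact: cbounded_cst.
by apply/funext => x; rewrite mulN1r.
Qed.

Lemma cboundedB f g : cbounded f -> cbounded g -> cbounded (fun x => f x - g x).
Proof.
by move=> bf bg; apply: cboundedD => //; exact: cboundedN.
Qed.

Lemma cintegrableZl c f : cintegrable f -> cintegrable (fun x => c * f x).
Proof.
move=> fi; rewrite (_ : (fun x => _) = (fun x => f x * c)).
  by apply: cintegrableM => //; exact: cbounded_cst.
by apply/funext => x; rewrite mulrC.
Qed.

Lemma cintegrableN f : cintegrable f -> cintegrable (fun x => - f x).
Proof.
move=> /(cintegrableZl (-1)); congr cintegrable.
by apply/funext => x; rewrite mulN1r.
Qed.

Lemma cintegrableB f g : cintegrable f -> cintegrable g ->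
  cintegrable (fun x => f x - g x).
Proof. by move=> fi gi; apply: cintegrableD => //; exact: cintegrableN. Qed.

Lemma cintegrable_sum n (F : 'I_n -> R -> R[i]) :
  (forall i, cintegrable (F i)) -> cintegrable (fun x => \sum_i F i x).
Proof.
elim: n F => [|n IH] F Fi.
  rewrite (_ : (fun x => _) = fun=> 0).
    by apply: cbounded_integrable; exact: cbounded_cst.
  by apply/funext => x; rewrite big_ord0.
rewrite (_ : (fun x => _) = fun x => F ord0 x + \sum_(i < n) F (lift ord0 i) x).
  by apply: cintegrableD => //; exact: IH.
by apply/funext => x; rewrite big_ord_recl.
Qed.

Lemma cbounded_sum n (F : 'I_n -> R -> R[i]) :
  (forall i, cbounded (F i)) -> cbounded (fun x => \sum_i F i x).
Proof.
elim: n F => [|n IH] F Fi.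
  rewrite (_ : (fun x => _) = fun=> 0); first exact: cbounded_cst.
  by apply/funext => x; rewrite big_ord0.
rewrite (_ : (fun x => _) = fun x => F ord0 x + \sum_(i < n) F (lift ord0 i) x).
  by apply: cboundedD => //; exact: IH.
by apply/funext => x; rewrite big_ord_recl.
Qed.

Lemma eq_cint f g x : (forall t, 0 <= t <= x -> f t = g t) ->
  cint f x = cint g x.
Proof.
move=> fg; rewrite /cint; congr (_ +i* _)%C; apply: eq_Rintegral => t;
  by rewrite inE/= in_itv/= => /fg ->.
Qed.

Lemma cint0 f : cint f 0 = 0.
Proof. by rewrite /cint set_itv1 !Rintegral_set1. Qed.

Lemma cintD f g x : x <= 1 -> cintegrable f -> cintegrable g ->
  cint (fun t => f t + g t) x = cint f x + cint g x.
Proof.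
move=> x1 [fR fI] [gR gI]; apply: complex_ext; rewrite ?cReD ?cImD/=.
- rewrite -RintegralD//; [|exact: integrable_0x..].
  by apply: eq_Rintegral => t _; rewrite cReD.
- rewrite -RintegralD//; [|exact: integrable_0x..].
  by apply: eq_Rintegral => t _; rewrite cImD.
Qed.

Lemma cintZl c f x : x <= 1 -> cintegrable f ->
  cint (fun t => c * f t) x = c * cint f x.
Proof.
move=> x1 [fR fI].
have iR := integrable_0x x1 fR; have iI := integrable_0x x1 fI.
have mZ (k : R) (r : R -> R) : mu.-integrable `[0, x] (fun x => (r x)%:E) ->
    mu.-integrable `[0, x] (fun x => (k * r x)%:E).
  by move=> ri; exact: (integrableZl _ k ri).
apply: complex_ext; rewrite ?cReM ?cImM/=.
- rewrite -!RintegralZl// -RintegralB//; [|exact: mZ..].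
  by apply: eq_Rintegral => t _; rewrite cReM.
- rewrite -!RintegralZl// -RintegralD//; [|exact: mZ..].
  by apply: eq_Rintegral => t _; rewrite cImM.
Qed.

Lemma cintZr c f x : x <= 1 -> cintegrable f ->
  cint (fun t => f t * c) x = cint f x * c.
Proof.
by move=> x1 fi; rewrite mulrC -cintZl//; apply: eq_cint => t _; rewrite mulrC.
Qed.

Lemma cintN f x : x <= 1 -> cintegrable f ->
  cint (fun t => - f t) x = - cint f x.
Proof.
move=> x1 fi; rewrite -mulN1r -cintZl//.
by apply: eq_cint => t _; rewrite mulN1r.
Qed.

Lemma cint_sum n (F : 'I_n -> R -> R[i]) x : x <= 1 ->
  (forall i, cintegrable (F i)) ->
  cint (fun t => \sum_i F i t) x = \sum_i cint (F i) x.
Proof.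
move=> x1; elim: n F => [|n IH] F Fi.
  rewrite big_ord0 (@eq_cint _ (fun t => 0 * 0)); last first.
    by move=> t _; rewrite big_ord0 mulr0.
  by rewrite cintZl ?mul0r//; apply: cbounded_integrable; exact: cbounded_cst.
rewrite big_ord_recl -IH// -cintD//; last exact: cintegrable_sum.
by apply: eq_cint => t _; rewrite big_ord_recl.
Qed.

Lemma cint_real (r : R -> R) x : cint (fun t => (r t)%:C%C) x =
  (\int[mu]_(t in `[0, x]) r t)%:C%C.
Proof. by rewrite /cint/= Rintegral_cst// mul0r. Qed.

(** Multiplying the integral by the conjugate of its phase makes it real, so
    that only the real part of the rotated integrand matters. *)
Lemma cmod_cint_le f (r : R -> R) x : x <= 1 -> cintegrable f ->
  mu.-integrable `[(0 : R), 1] (fun t => (r t)%:E) ->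
  (forall t, 0 <= t <= x -> cmod (f t) <= r t) ->
  cmod (cint f x) <= \int[mu]_(t in `[0, x]) r t.
Proof.
move=> x1 fi ri fr.
have [z0|z0] := eqVneq (cint f x) 0.
  rewrite z0 cmod0; apply: Rintegral_ge0 => t; rewrite /= in_itv/= => /fr.
  exact/le_trans/cmod_ge0.
pose z := cint f x; pose u : R[i] := (conjc z) / (cmod z)%:C%C.
have zn0 : cmod z != 0 by apply: contra z0 => /eqP/cmod_eq0/eqP.
have uz : u * z = (cmod z)%:C%C.
  rewrite /u mulrAC mul_conjc expr2 rmorphM/= mulfK//.
  by rewrite eq_complex/= eqxx andbT.
have cu : cmod u = 1.
  rewrite /u cmodM cmodV cmod_real ger0_norm ?cmod_ge0//.
  by rewrite cmod_conjc divff.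
have : cint (fun t => u * f t) x = (cmod z)%:C%C by rewrite cintZl.
move=> /(congr1 (@complex.Re R)) /= <-.
have [ufR ufI] := cintegrableZl u fi.
apply: le_Rintegral => //; [exact: integrable_0x..|].
move=> t; rewrite /= in_itv/= => /fr; apply: le_trans.
rewrite (le_trans (ler_norm _))// (le_trans (Re_le_cmod _))// cmodM cu mul1r//.
Qed.

Lemma Rintegral_0x_le (r : R -> R) x : 0 <= x <= 1 ->
  mu.-integrable `[(0 : R), 1] (fun t => (r t)%:E) ->
  (forall t, 0 <= t <= 1 -> 0 <= r t) ->
  \int[mu]_(t in `[0, x]) r t <= \int[mu]_(t in `[0, 1]) r t.
Proof.
move=> /andP[x0 x1] ri r0; rewrite fine_le//.
- by apply: integrable_fin_num => //; exact: integrable_0x.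
- exact: integrable_fin_num.
apply: ge0_subset_integral => //.
- by case/integrableP : ri.
- exact: sub_0x_01.
Qed.

Lemma cont01_cint f : cintegrable f -> cont01 (cint f).
Proof.
move=> [fR fI]; split.
- exact: (parameterized_integral_continuous ler01 fR).
- exact: (parameterized_integral_continuous ler01 fI).
Qed.

Lemma cont01_cbounded f : cont01 f -> cbounded f.
Proof.
move=> [cR cI]; split.
  by split; apply: subspace_continuous_measurable_fun.
have bd (r : R -> R) : {within `[(0 : R), 1], continuous r} ->
    exists M : R, forall x, 0 <= x <= 1 -> `|r x| <= M.
  move=> cr.
  have cnr : {within `[(0 : R), 1], continuous (Num.norm \o r)}.
    by apply: within_continuous_comp => // ? _; exact: norm_continuous.
  have [] := EVT_max ler01 cnr.
  by move=> c _ rc; exists `|r c| => x x01; apply: rc; rewrite in_itv.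
have [M HM] := bd _ cR; have [N HN] := bd _ cI.
exists (M + N) => x x01; rewrite (le_trans (cmod_le_ReIm _))//.
by rewrite lerD ?HM ?HN.
Qed.

Lemma cbounded_cint f : cintegrable f -> cbounded (cint f).
Proof. by move=> fi; apply: cont01_cbounded; exact: cont01_cint. Qed.

Lemma cont01M f g : cont01 f -> cont01 g -> cont01 (fun x => f x * g x).
Proof.
move=> [fR fI] [gR gI]; split.
- rewrite (_ : (fun x => complex.Re _) = fun x => complex.Re (f x) * complex.Re (g x)
    - complex.Im (f x) * complex.Im (g x)); last by apply/funext => x; rewrite cReM.
  move=> x; apply: cvgB; apply: cvgM.
  + exact: fR. + exact: gR. + exact: fI. + exact: gI.
- rewrite (_ : (fun x => complex.Im _) = fun x => complex.Re (f x) * complex.Im (g x)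
    + complex.Im (f x) * complex.Re (g x)); last by apply/funext => x; rewrite cImM.
  move=> x; apply: cvgD; apply: cvgM.
  + exact: fR. + exact: gI. + exact: fI. + exact: gR.
Qed.

Lemma cont01D f g : cont01 f -> cont01 g -> cont01 (fun x => f x + g x).
Proof.
move=> [fR fI] [gR gI]; split.
- rewrite (_ : (fun x => complex.Re _) = fun x => complex.Re (f x) +
    complex.Re (g x)); last by apply/funext => x; rewrite cReD.
  by move=> x; apply: cvgD; [exact: fR|exact: gR].
- rewrite (_ : (fun x => complex.Im _) = fun x => complex.Im (f x) +
    complex.Im (g x)); last by apply/funext => x; rewrite cImD.
  by move=> x; apply: cvgD; [exact: fI|exact: gI].
Qed.

Lemma cont01_cst c : cont01 (fun=> c).
Proof. by split; move=> x; exact: cvg_cst. Qed.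

End ComplexIntegral.

(** * Integration on the whole line: Fubini and translations *)

Section WholeLine.
Context {R : realType}.
Local Notation mu := (@lebesgue_measure R).
Local Notation RR := (measurableTypeR R).

(** Measurability of a complex function on an arbitrary measurable type. *)
Definition cmeasT d (T : measurableType d) (f : T -> R[i]) : Prop :=
  measurable_fun [set: T] (fun p => complex.Re (f p)) /\
  measurable_fun [set: T] (fun p => complex.Im (f p)).

Section CmeasT.
Context d (T : measurableType d).
Implicit Types f g : T -> R[i].

Lemma cmeasTM f g : cmeasT f -> cmeasT g -> cmeasT (fun x => f x * g x).
Proof.
move=> [fR fI] [gR gI]; split.
- apply: eq_measurable_fun (measurable_funB (measurable_funM fR gR)
    (measurable_funM fI gI)) => x _; by rewrite cReM.
- apply: eq_measurable_fun (measurable_funD (measurable_funM fR gI)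
    (measurable_funM fI gR)) => x _; by rewrite cImM.
Qed.

Lemma cmeasT_if (b : T -> bool) f : measurable_fun [set: T] b -> cmeasT f ->
  cmeasT (fun x => if b x then f x else 0).
Proof.
move=> mb [fR fI]; split.
- apply: eq_measurable_fun (measurable_fun_ifT mb fR (measurable_cst (0 : R))).
  by move=> x _; case: ifP.
- apply: eq_measurable_fun (measurable_fun_ifT mb fI (measurable_cst (0 : R))).
  by move=> x _; case: ifP.
Qed.

Lemma cmeasT_cexp (z : R[i]) (r : T -> R) : measurable_fun [set: T] r ->
  cmeasT (fun x => cexp (z * (r x)%:C%C)).
Proof.
move=> mr.
have mR : measurable_fun [set: T] (fun x => complex.Re (z * (r x)%:C%C)).
  apply: eq_measurable_fun (measurable_funM (measurable_cst (complex.Re z)) mr).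
  by move=> x _; rewrite cReM/= mulr0 subr0.
have mI : measurable_fun [set: T] (fun x => complex.Im (z * (r x)%:C%C)).
  apply: eq_measurable_fun (measurable_funM (measurable_cst (complex.Im z)) mr).
  by move=> x _; rewrite cImM/= mulr0 add0r.
have me : measurable_fun [set: T] (fun x => expR (complex.Re (z * (r x)%:C%C))).
  by apply: measurableT_comp.
split; apply: measurable_funM => //; apply: measurableT_comp => //;
  apply: continuous_measurable_fun; [exact: continuous_cos|exact: continuous_sin].
Qed.

End CmeasT.

Lemma cmeasT_comp d1 d2 (T1 : measurableType d1) (T2 : measurableType d2)
    (f : T2 -> R[i]) (phi : T1 -> T2) :
  measurable_fun [set: T1] phi -> cmeasT f -> cmeasT (fun x => f (phi x)).
Proof.
move=> mphi [fR fI]; split.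
- exact: (measurableT_comp fR mphi).
- exact: (measurableT_comp fI mphi).
Qed.

(** The integral over the whole line.  Integrals over [0, x] are expressed
    through it by cutting off the integrand, so that the variable bounds of
    iterated integrals become part of the integrand. *)
Definition cintT (f : R -> R[i]) : R[i] :=
  ((\int[mu]_t complex.Re (f t)) +i* (\int[mu]_t complex.Im (f t)))%C.

Lemma eq_cintT (f g : R -> R[i]) : f =1 g -> cintT f = cintT g.
Proof. by move=> /funext ->. Qed.

Lemma cintT0 : cintT (fun=> 0) = 0.
Proof. by rewrite /cintT/= Rintegral_cst// mul0r. Qed.

Lemma cint_cintT (f : R -> R[i]) x :
  cint f x = cintT (fun t => if 0 <= t <= x then f t else 0).
Proof.
rewrite /cint /cintT; congr (_ +i* _)%C; rewrite Rintegral_mkcond.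
- by apply: eq_Rintegral => t _; rewrite patchE mem_setE in_itv/=; case: ifP.
- by apply: eq_Rintegral => t _; rewrite patchE mem_setE in_itv/=; case: ifP.
Qed.

(** A parameter-dependent integral is a measurable function of the parameter,
    whether or not the integrals converge. *)
Lemma cmeasT_cintT d (T : measurableType d) (F : T * RR -> R[i]) :
  cmeasT F -> cmeasT (fun p => cintT (fun t => F (p, t))).
Proof.
have aux (r : T * RR -> R) : measurable_fun setT r ->
    measurable_fun setT (fun p => \int[mu]_t r (p, t)).
  move=> mr; have mEr : measurable_fun setT (EFin \o r) by exact/measurable_EFinP.
  apply: measurableT_comp => //.
  apply: (@eq_measurable_fun _ _ _ _ _ (fun p : T =>
    ((fubini_F mu (EFin \o r)^\+ p) - (fubini_F mu (EFin \o r)^\- p))%E)).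
    move=> p _; rewrite [RHS]integralE /fubini_F.
    by congr (_ - _)%E; apply: eq_integral => t _; rewrite ?funeposE ?funenegE.
  apply: emeasurable_funB.
  - by apply: measurable_fun_fubini_tonelli_F => //; exact: measurable_funepos.
  - by apply: measurable_fun_fubini_tonelli_F => //; exact: measurable_funeneg.
by move=> [mR mI]; split; [exact: (aux _ mR)|exact: (aux _ mI)].
Qed.

(** Fubini under domination by an integrable function of two variables. *)
Lemma cFubini (H : RR * RR -> R[i]) (G : RR * RR -> R) : cmeasT H ->
  (mu \x mu)%E.-integrable setT (fun p => (G p)%:E) ->
  (forall p, cmod (H p) <= G p) ->
  cintT (fun t => cintT (fun s => H (t, s))) =
  cintT (fun s => cintT (fun t => H (t, s))).
Proof.
move=> [mR mI] iG HG.
have aux (r : RR * RR -> R) : measurable_fun setT r ->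
    (forall p, `|r p| <= G p) ->
    \int[mu]_t \int[mu]_s r (t, s) = \int[mu]_s \int[mu]_t r (t, s).
  move=> mr rG.
  have mEr : measurable_fun setT (EFin \o r) by exact/measurable_EFinP.
  have ir : (mu \x mu)%E.-integrable setT (EFin \o r).
    apply: le_integrable iG => // p _; rewrite lee_fin.
    exact: le_trans (rG _) (ler_norm _).
  rewrite /Rintegral; congr fine.
  transitivity (\int[mu]_t \int[mu]_s (r (t, s))%:E)%E.
    apply: ae_eq_integral => //.
    - apply/measurable_EFinP/measurableT_comp => //.
      exact: (measurable_fubini_F ir).
    - exact: (measurable_fubini_F ir).
    - have := ae_integrable1 ir; apply: filterS => t it _.
      by rewrite fineK//; exact: integrable_fin_num.
  rewrite (Fubini ir); apply: ae_eq_integral => //.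
  - exact: (measurable_fubini_G ir).
  - apply/measurable_EFinP/measurableT_comp => //.
    exact: (measurable_fubini_G ir).
  - have := ae_integrable2 ir; apply: filterS => t it _.
    by rewrite fineK//; exact: integrable_fin_num.
rewrite /cintT/=; congr (_ +i* _)%C.
- by apply: (aux _ mR) => p; rewrite (le_trans (Re_le_cmod _)).
- by apply: (aux _ mI) => p; rewrite (le_trans (Im_le_cmod _)).
Qed.

(** Translation invariance of the Lebesgue measure. *)
Lemma lebesgue_measureD (c : R) (A : set R) : measurable A ->
  pushforward mu ((fun x => x + c) : _ -> RR) A = mu A.
Proof.
move=> mA; have mc : measurable_fun setT ((fun x => x + c) : RR -> RR).
  by apply: measurable_funD.
pose phi : {mfun RR >-> RR} := HB.pack ((fun x => x + c) : RR -> RR)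
  (isMeasurableFun.Build _ _ _ _ _ mc).
apply/esym; apply: (@lebesgue_measure_unique _ (pushforward mu phi)) => //.
move=> _ [[a b]] _ <-; transitivity (mu `]a - c, b - c]%classic); last first.
  congr (mu _); apply/seteqP; split=> t; by rewrite /= !in_itv/= ltrBlDr lerBrDr.
rewrite !lebesgue_measure_itv/= !lte_fin ltrD2r; case: ifP => // _.
by rewrite -!EFinD; congr (_%:E); ring.
Qed.

Lemma ge0_integral_shift (f : R -> \bar R) (c : R) : measurable_fun setT f ->
  (forall t, (0 <= f t)%E) -> (\int[mu]_t f (t + c)%R = \int[mu]_t f t)%E.
Proof.
move=> mf f0; have mc : measurable_fun setT ((fun x => x + c) : RR -> RR).
  by apply: measurable_funD.
have := @ge0_integral_pushforward _ _ RR RR R _ mc mu setT f measurableT mf.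
rewrite preimage_setT => <-//.
by apply: eq_measure_integral => A mA _; exact: lebesgue_measureD.
Qed.

Lemma cintT_shift (f : R -> R[i]) (c : R) : cmeasT (f : RR -> R[i]) ->
  cintT (fun t => f (t + c)) = cintT f.
Proof.
have aux (r : R -> R) : measurable_fun setT r ->
    \int[mu]_t r (t + c) = \int[mu]_t r t.
  move=> mr; have mEr : measurable_fun setT (EFin \o r) by exact/measurable_EFinP.
  rewrite /Rintegral; congr fine; rewrite integralE [RHS]integralE.
  congr (_ - _)%E.
  - rewrite -[RHS](ge0_integral_shift c)//; last exact: measurable_funepos.
    by apply: eq_integral => t _; rewrite !funeposE.
  - rewrite -[RHS](ge0_integral_shift c)//; last exact: measurable_funeneg.
    by apply: eq_integral => t _; rewrite !funenegE.
move=> [mR mI]; rewrite /cintT; congr (_ +i* _)%C.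
- exact: (aux _ mR).
- exact: (aux _ mI).
Qed.

Lemma integrable_prod_mul (u v : R -> R) :
  mu.-integrable setT (EFin \o u) -> mu.-integrable setT (EFin \o v) ->
  (mu \x mu)%E.-integrable setT (fun p => (u p.1 * v p.2)%:E).
Proof.
move=> /integrableP[/measurable_EFinP mU iu] /integrableP[/measurable_EFinP mV iv].
have mF : measurable_fun setT (fun p : RR * RR => (u p.1 * v p.2)%:E).
  apply/measurable_EFinP; apply: measurable_funM.
    by apply: (measurableT_comp mU); exact: measurable_fst.
  by apply: (measurableT_comp mV); exact: measurable_snd.
apply: (proj2 (@integrable12ltyP _ _ RR RR R mu mu _ mF)).
have mnU : measurable_fun setT (fun x : RR => `|(u x)%:E|%E).
  by apply: measurableT_comp => //; exact/measurable_EFinP.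
have mnV : measurable_fun setT (fun x : RR => `|(v x)%:E|%E).
  by apply: measurableT_comp => //; exact/measurable_EFinP.
rewrite (_ : (\int[mu]_x _)%E = (\int[mu]_x `|(u x)%:E| *
    \int[mu]_x `|(v x)%:E|)%E).
  by rewrite lte_mul_pinfty ?integral_ge0// ge0_fin_numE ?integral_ge0.
have fv : (\int[mu]_x `|(v x)%:E|)%E \is a fin_num.
  by rewrite ge0_fin_numE ?integral_ge0.
rewrite -[X in (_ * X)%E](fineK fv) -ge0_integralZr//; last first.
  by rewrite lee_fin fine_ge0// integral_ge0.
apply: eq_integral => x _; rewrite fineK// -ge0_integralZl//.
by apply: eq_integral => y _; rewrite EFinM abseM.
Qed.

Lemma integrable_prod_shear (u v : R -> R) :
  mu.-integrable setT (EFin \o u) -> mu.-integrable setT (EFin \o v) ->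
  (mu \x mu)%E.-integrable setT (fun p => (u (p.1 + p.2)%R * v p.2)%:E).
Proof.
move=> /integrableP[/measurable_EFinP mU iu] /integrableP[/measurable_EFinP mV iv].
have mF : measurable_fun setT (fun p : RR * RR => (u (p.1 + p.2)%R * v p.2)%:E).
  apply/measurable_EFinP; apply: measurable_funM.
    apply: (measurableT_comp mU); apply: measurable_funD.
      exact: measurable_fst.
    exact: measurable_snd.
  by apply: (measurableT_comp mV); exact: measurable_snd.
apply: (proj2 (@integrable21ltyP _ _ RR RR R mu mu _ mF)).
have mnU : measurable_fun setT (fun x : RR => `|(u x)%:E|%E).
  by apply: measurableT_comp => //; exact/measurable_EFinP.
have mnV : measurable_fun setT (fun x : RR => `|(v x)%:E|%E).
  by apply: measurableT_comp => //; exact/measurable_EFinP.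
rewrite (_ : (\int[mu]_x _)%E = (\int[mu]_x `|(v x)%:E| *
    \int[mu]_x `|(u x)%:E|)%E).
  by rewrite lte_mul_pinfty ?integral_ge0// ge0_fin_numE ?integral_ge0.
have fu : (\int[mu]_x `|(u x)%:E|)%E \is a fin_num.
  by rewrite ge0_fin_numE ?integral_ge0.
rewrite -[X in (_ * X)%E](fineK fu) -ge0_integralZr//; last first.
  by rewrite lee_fin fine_ge0// integral_ge0.
apply: eq_integral => y _; rewrite fineK//.
rewrite -[X in (_ * X)%E](@ge0_integral_shift _ y mnU)// -ge0_integralZl//.
  by apply: eq_integral => x _; rewrite EFinM abseM muleC.
by apply: (measurableT_comp mnU); apply: measurable_funD.
Qed.

End WholeLine.

(** * Integrals over a triangle *)

Section TriangleIntegrals.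
Context {R : realType}.
Local Notation mu := (@lebesgue_measure R).
Local Notation RR := (measurableTypeR R).
Implicit Types (f g : R -> R[i]).

(** The extension of a function on [0, 1] by zero. *)
Definition cext f (t : R) : R[i] := if 0 <= t <= 1 then f t else 0.

Lemma cextE f t : 0 <= t <= 1 -> cext f t = f t.
Proof. by rewrite /cext => ->. Qed.

Lemma cmeasT_cext f : cmeasurable f -> cmeasT (cext f : RR -> R[i]).
Proof.
move=> [mR mI]; split.
- have /measurable_restrictT mr := mR.
  apply: eq_measurable_fun (mr _) => // t _.
  by rewrite patchE mem_setE in_itv/= /cext; case: ifP.
- have /measurable_restrictT mi := mI.
  apply: eq_measurable_fun (mi _) => // t _.
  by rewrite patchE mem_setE in_itv/= /cext; case: ifP.
Qed.

Lemma integrable_cext f : cintegrable f ->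
  mu.-integrable setT (EFin \o (fun t => cmod (cext f t))).
Proof.
move=> fi.
have m01 : measurable (`[(0 : R), 1]%classic : set RR) by exact: measurable_itv.
have /(integrable_mkcond _ m01) := cintegrable_cmod fi.
apply: eq_integrable => // t _.
by rewrite patchE mem_setE in_itv/= /cext; case: ifP => // _; rewrite cmod0.
Qed.

(** The integral over [t, x]. *)
Lemma cint_tail f (t x : R) : 0 <= t <= x -> x <= 1 -> cintegrable f ->
  cint f x - cint f t = cintT (fun s => if t <= s <= x then f s else 0).
Proof.
move=> /andP[t0 tx] x1 [fR fI].
have aux (r : R -> R) : mu.-integrable `[(0 : R), 1] (fun t => (r t)%:E) ->
    \int[mu]_(s in `[0, x]) r s - \int[mu]_(s in `[0, t]) r s =
    \int[mu]_s (r \_ `[t, x]) s.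
  move=> ri; have rix := integrable_0x x1 ri.
  rewrite -Rintegral_mkcond (Rintegral_itvB rix) ?bnd_simp//.
  apply: Rintegral_itv_obnd_cbnd; apply: integrableS rix => //.
  by apply: subset_itvr; rewrite bnd_simp.
apply: complex_ext; rewrite ?cReD ?cImD ?cReN ?cImN /=.
- rewrite aux//; apply: eq_Rintegral => s _.
  by rewrite patchE mem_setE in_itv/=; case: ifP.
- rewrite aux//; apply: eq_Rintegral => s _.
  by rewrite patchE mem_setE in_itv/=; case: ifP.
Qed.

(** Both sides integrate f(t) g(s) over the triangle t <= s <= x. *)
Lemma cint_swap f g x : 0 <= x <= 1 -> cintegrable f -> cintegrable g ->
  cint (fun s => cint f s * g s) x =
  cint (fun t => f t * (cint g x - cint g t)) x.
Proof.
move=> /andP[x0 x1] fi gi.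
pose H (p : R * R) : R[i] :=
  if [&& 0 <= p.1, p.1 <= p.2 & p.2 <= x] then cext f p.1 * cext g p.2 else 0.
have m1 : measurable_fun setT (fun p : RR * RR => p.1 : RR) by exact: measurable_fst.
have m2 : measurable_fun setT (fun p : RR * RR => p.2 : RR) by exact: measurable_snd.
have mH : cmeasT (H : RR * RR -> R[i]).
  apply: cmeasT_if.
    apply: measurable_and; first exact: measurable_fun_ler.
    by apply: measurable_and; exact: measurable_fun_ler.
  apply: cmeasTM.
  - exact: (cmeasT_comp m1 (cmeasT_cext (cintegrable_meas fi))).
  - exact: (cmeasT_comp m2 (cmeasT_cext (cintegrable_meas gi))).
have iG := integrable_prod_mul (integrable_cext fi) (integrable_cext gi).
have HG p : cmod (H p) <= cmod (cext f p.1) * cmod (cext g p.2).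
  by rewrite /H; case: ifP => _; rewrite ?cmodM// cmod0 mulr_ge0 ?cmod_ge0.
have e := cFubini mH iG HG.
rewrite [LHS]cint_cintT [RHS]cint_cintT; transitivity (cintT (fun s => cintT (fun t => H (t, s)))).
  apply: eq_cintT => s; case: ifPn => [/andP[s0 sx]|].
    have s1 := le_trans sx x1.
    rewrite -(cintZr _ s1 fi) cint_cintT; apply: eq_cintT => t.
    rewrite /H/= sx andbT; case: ifP => [/andP[t0 ts]|//].
    have t01 : 0 <= t <= 1 by rewrite t0 (le_trans ts).
    by rewrite (cextE f t01) (cextE g (t:=s)) ?s0.
  rewrite negb_and -!ltNge => sx; rewrite -[LHS]cintT0; apply: eq_cintT => t.
  rewrite /H/=; case: ifP => [/and3P[t0 ts sx']|//]; move: sx.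
  by rewrite ltNge (le_trans t0 ts)/= ltNge sx'.
rewrite -e; apply: eq_cintT => t; case: ifPn => [/andP[t0 tx]|].
  have t1 := le_trans tx x1.
  rewrite mulrBr -(cintZl _ x1 gi) -(cintZl _ t1 gi).
  have t0x : 0 <= t <= x by rewrite t0.
  rewrite (cint_tail t0x x1 (cintegrableZl (f t) gi)).
  apply: eq_cintT => s; rewrite /H/= t0/=; case: ifP => [/andP[ts sx]|//].
  have s01 : 0 <= s <= 1 by rewrite (le_trans t0 ts) (le_trans sx x1).
  by rewrite (cextE g s01) (cextE f (t:=t)) ?t0.
rewrite negb_and -!ltNge => sx; rewrite -[RHS]cintT0; apply: eq_cintT => s.
rewrite /H/=; case: ifP => [/and3P[t0 ts sx']|//]; move: sx.
by rewrite ltNge t0/= ltNge (le_trans ts).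
Qed.

Lemma cint_byparts f g x : 0 <= x <= 1 -> cintegrable f -> cintegrable g ->
  cint f x * cint g x =
  cint (fun t => f t * cint g t) x + cint (fun t => cint f t * g t) x.
Proof.
move=> x01 fi gi; have /andP[x0 x1] := x01; rewrite (cint_swap x01 fi gi) -(cintZr _ x1 fi).
have fgi : cintegrable (fun t => f t * cint g t).
  by apply: cintegrableM => //; exact: cbounded_cint.
have fci : cintegrable (fun t => f t * cint g x).
  by apply: cintegrableM => //; exact: cbounded_cst.
have fdi : cintegrable (fun t => f t * (cint g x - cint g t)).
  apply: cintegrableM fi _; apply: cboundedB; first exact: cbounded_cst.
  exact: cbounded_cint.
rewrite -(cintD x1 fgi fdi).
by apply: eq_cint => t _; rewrite mulrBr addrC subrK.
Qed.

(** The change of variables [t = tau + xi] on the triangle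
    [0 <= xi <= t <= x]. *)
Lemma cint_shear (K : R -> R -> R[i]) (u v : R -> R) x : 0 <= x <= 1 ->
  cmeasT ((fun p : R * R => K p.1 p.2) : RR * RR -> R[i]) ->
  mu.-integrable setT (EFin \o u) -> mu.-integrable setT (EFin \o v) ->
  (forall t, 0 <= u t) -> (forall t, 0 <= v t) ->
  (forall t xi, 0 <= xi <= t -> t <= x -> cmod (K t xi) <= u t * v xi) ->
  cint (fun tau => cint (fun xi => K (tau + xi) xi) (x - tau)) x =
  cint (fun t => cint (K t) t) x.
Proof.
move=> /andP[x0 x1] mK iu iv u0 v0 Kuv.
pose H (p : R * R) : R[i] :=
  if [&& 0 <= p.2, p.2 <= p.1 & p.1 <= x] then K p.1 p.2 else 0.
have m1 : measurable_fun setT (fun p : RR * RR => p.1 : RR) by exact: measurable_fst.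
have m2 : measurable_fun setT (fun p : RR * RR => p.2 : RR) by exact: measurable_snd.
have mH : cmeasT (H : RR * RR -> R[i]).
  apply: cmeasT_if => //.
  apply: measurable_and; first exact: measurable_fun_ler.
  by apply: measurable_and; exact: measurable_fun_ler.
have HG p : cmod (H p) <= u p.1 * v p.2.
  rewrite /H; case: ifP => [/and3P[p0 pp px]|_]; last by rewrite cmod0 mulr_ge0.
  by apply: Kuv => //; rewrite p0.
have msh : measurable_fun setT (fun p : RR * RR => (p.1 + p.2, p.2) : RR * RR).
  by apply: measurable_fun_pair => //; exact: measurable_funD.
have e1 := cFubini mH (integrable_prod_mul iu iv) HG.
have e2 := cFubini (cmeasT_comp msh mH) (integrable_prod_shear iu iv)
  (fun p => HG (p.1 + p.2, p.2)).
rewrite [LHS]cint_cintT [RHS]cint_cintT; transitivity (cintT (fun t => cintT (fun s => H (t + s, s)))).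
  apply: eq_cintT => t; case: ifPn => [/andP[t0 tx]|].
    rewrite cint_cintT; apply: eq_cintT => s.
    by rewrite /H/= lerDr t0/= lerBrDl.
  rewrite negb_and -!ltNge => tx; rewrite -[LHS]cintT0; apply: eq_cintT => s.
  rewrite /H/=; case: ifP => [/and3P[s0 + tsx]|//]; rewrite lerDr => t0.
  have tx' : t <= x by apply: le_trans tsx; rewrite lerDl.
  by move: tx; rewrite ltNge t0/= ltNge tx'.
rewrite /= in e2; rewrite e2.
transitivity (cintT (fun s => cintT (fun t => H (t, s)))).
  apply: eq_cintT => s; apply: (@cintT_shift _ (fun t => H (t, s))).
  apply: (@cmeasT_comp _ _ _ RR (RR * RR)%type H (fun t => (t, s))) => //.
rewrite -e1; apply: eq_cintT => t; case: ifPn => [/andP[t0 tx]|].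
  by rewrite cint_cintT; apply: eq_cintT => s; rewrite /H/= tx andbT.
rewrite negb_and -!ltNge => tx; rewrite -[RHS]cintT0; apply: eq_cintT => s.
rewrite /H/=; case: ifP => [/and3P[s0 st tx']|//].
by move: tx; rewrite ltNge (le_trans s0 st)/= ltNge tx'.
Qed.

End TriangleIntegrals.

(** * The fundamental theorem of calculus for absolutely continuous functions *)

Section FundamentalTheorem.
Context {R : realType}.
Local Notation mu := (@lebesgue_measure R).
Local Notation RR := (measurableTypeR R).

(** Absolute continuity on [0, 1] of a real function. *)
Definition rabs_continuous01 (f : R -> R) : Prop :=
  forall e : R, 0 < e -> exists2 del : R, 0 < del &
    forall (n : nat) (u v : 'I_n -> R),
      (forall i, 0 <= u i <= v i /\ v i <= 1) ->
      trivIset setT (fun i => `]u i, v i[%classic) ->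
      \sum_i (v i - u i) < del ->
      \sum_i `|f (v i) - f (u i)| < e.

Section Chain.
Variables (f h : R -> R) (lam kap : R -> R) (e : R).

(** There is a finite family of disjoint intervals in [0, x], of total length at
    most [lam x], such that the increment of [h] over [0, x] is at most [e * x]
    plus the increments of [f] over these intervals plus [kap x]. *)
Definition chain (x : R) : Prop := exists (n : nat) (u v : 'I_n -> R),
  [/\ forall i, 0 <= u i <= v i /\ v i <= x,
      trivIset setT (fun i => `]u i, v i[%classic),
      \sum_i (v i - u i) <= lam x &
      `|h x - h 0| <= e * x + \sum_i `|f (v i) - f (u i)| + kap x].

Lemma chain0 : 0 <= lam 0 -> 0 <= kap 0 -> chain 0.
Proof.
move=> l0 k0; exists 0%N, (fun=> 0), (fun=> 0); split.
- by case.
- by move=> [].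
- by rewrite big_ord0.
- by rewrite big_ord0 subrr normr0 mulr0 !add0r.
Qed.

(** A step on which [h] has slope at most [e] adds no interval. *)
Lemma chain_good x y : x <= y -> lam x <= lam y -> kap x <= kap y ->
  `|h y - h x| <= e * (y - x) -> chain x -> chain y.
Proof.
move=> xy ll kk hxy [n [u [v [uv tuv sl hx]]]]; exists n, u, v; split => //.
- by move=> i; have [-> /le_trans ->] := uv i.
- exact: le_trans ll.
- rewrite (_ : h y - h 0 = (h y - h x) + (h x - h 0)); last by ring.
  rewrite (le_trans (ler_normD _ _))// (le_trans (lerD hxy hx))//.
  by rewrite mulrBr !addrA subrK lerD2l.
Qed.

(** A step on which only [f] and [kap] control [h] becomes a new interval. *)
Lemma chain_bad x y : 0 <= x -> x <= y -> 0 <= e -> lam y - lam x = y - x ->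
  `|h y - h x| <= `|f y - f x| + (kap y - kap x) -> chain x -> chain y.
Proof.
move=> x0 xy e0 ll hxy [n [u [v [uv tuv sl hx]]]].
exists n.+1, (fun i => oapp u x (unlift ord0 i)),
  (fun i => oapp v y (unlift ord0 i)); split.
- move=> i; case: unliftP => [j|] _ /=; last by rewrite x0 xy.
  by have [-> /le_trans ->] := uv j.
- move=> i j _ _; case: (unliftP ord0 i) => [i'|] ->; case: (unliftP ord0 j) => [j'|] ->;
    rewrite ?liftK ?unlift_none/= => -[t []]; rewrite /= !in_itv/=.
  + move=> /andP[ui vi] /andP[uj vj]; congr lift; apply: tuv => //.
    by exists t; split; rewrite /= in_itv/= ?ui ?uj.
  + move=> /andP[_ tv] /andP[xt _]; have [_ vx] := uv i'.
    by have := lt_trans xt (lt_le_trans tv vx); rewrite ltxx.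
  + move=> /andP[xt _] /andP[_ tv]; have [_ vx] := uv j'.
    by have := lt_trans xt (lt_le_trans tv vx); rewrite ltxx.
  + by [].
- rewrite big_ord_recl unlift_none/=.
  under eq_bigr do rewrite liftK/=.
  by rewrite -ll (le_trans (lerD (lexx _) sl))// subrK.
- rewrite big_ord_recl unlift_none/=.
  under eq_bigr do rewrite liftK/=.
  rewrite (_ : h y - h 0 = (h y - h x) + (h x - h 0)); last by ring.
  rewrite (le_trans (ler_normD _ _))// (le_trans (lerD hxy hx))//.
  have : e * x <= e * y by rewrite ler_wpM2l.
  by set S := \sum_(i < n) _; lra.
Qed.

End Chain.

(** Real induction along [0, b]. *)
Lemma real_induction (P : R -> Prop) (b : R) : 0 <= b -> P 0 ->
  (forall s, 0 <= s <= b -> exists2 del, 0 < del &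
     forall x y, 0 <= x -> s - del < x -> x <= s -> s <= y -> y < s + del ->
       y <= b -> x <= y -> P x -> P y) -> P b.
Proof.
move=> b0 P0 step.
pose S := [set x | 0 <= x <= b /\ P x].
have S0 : S 0 by split; rewrite ?lexx.
have ubS : ubound S b by move=> x [/andP[]].
have hsS : has_sup S by split; [exists 0|exists b].
pose s := sup S.
have s0 : 0 <= s by apply: sup_upper_bound.
have sb : s <= b by apply: ge_sup => //; exists 0.
have s0b : 0 <= s <= b by rewrite s0.
have [del del0 hdel] := step s s0b.
have [x [/andP[x0 xb] Px] xs] := sup_adherent del0 hsS.
have xs' : x <= s by apply: sup_upper_bound => //; split; rewrite ?x0.
pose y := Num.min b (s + del / 2).
have yb : y <= b by rewrite ge_min lexx.
have sy : s <= y by rewrite le_min sb/= lerDl divr_ge0// ltW.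
have Py : P y.
  apply: (hdel x) => //; last exact: le_trans sy.
  by rewrite gt_min ltrD2l ltr_pdivrMr// mulr_natr mulr2n ltrDl del0 orbT.
have ys : y <= s by apply: sup_upper_bound => //; split; rewrite ?yb ?(le_trans s0).
have : b <= s + del / 2 by rewrite leNgt; apply/negP => /ltW sdb;
  move: ys; rewrite /y (min_idPr sdb); lra.
by move=> /min_idPl e; rewrite -e.
Qed.

(** A zero derivative gives an arbitrarily small slope near the point. *)
Lemma is_derive0_slope (h : R -> R) (x e : R) : is_derive x 1 h 0 -> 0 < e ->
  exists2 del, 0 < del & forall y, `|y - x| < del -> `|h y - h x| <= e * `|y - x|.
Proof.
move=> [dh vh] e0.
have : (t^-1 *: (h (t *: 1 + x) - h x)) @[t --> 0^'] --> (0 : R).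
  by rewrite -[X in _ --> X]vh; exact: dh.
move=> /cvgrPdist_le /(_ e e0); rewrite near_withinE => /nbhs_ballP[del /= del0 H].
exists del => // y yx; have [->|ynx] := eqVneq y x.
  by rewrite !subrr normr0 mulr0.
have n0 : y - x != 0 by rewrite subr_eq0.
have := H (y - x); rewrite /ball/= sub0r normrN => /(_ yx n0).
rewrite sub0r normrN [_ *: 1]mulr1 subrK normrM normfV.
by rewrite mulrC ler_pdivrMr ?normr_gt0.
Qed.

(** The fundamental theorem of calculus for absolutely continuous functions.
    The exceptional null set is enclosed in an open set of small measure; real
    induction then exhausts the interval by steps on which [f] minus the integral
    of [g] has small slope and steps contained in that open set. *)
Theorem abs_continuous_FTC (f g : R -> R) (b : R) : rabs_continuous01 f ->
  mu.-integrable `[(0 : R), 1] (fun x => (g x)%:E) ->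
  {ae mu, forall x : R, 0 < x < 1 -> is_derive x 1 f (g x)} ->
  0 <= b <= 1 -> f b = f 0 + \int[mu]_(t in `[0, b]) g t.
Proof.
move=> acf ig df /andP[b0 b1].
pose G : R -> R := g \_ `[(0 : R), 1].
have iG : mu.-integrable setT (EFin \o G).
  have m01 : measurable (`[(0 : R), 1]%classic : set RR) by exact: measurable_itv.
  have /(integrable_mkcond _ m01) := ig.
  apply: eq_integrable => // t _.
  by rewrite /G/= !patchE; case: ifP.
have iGS (A : set RR) : measurable A -> mu.-integrable A (EFin \o G).
  by move=> mA; apply: integrableS iG.
pose F x := \int[mu]_(t in `[0, x]) G t.
have -> : \int[mu]_(t in `[0, b]) g t = F b.
  apply: eq_Rintegral => t; rewrite inE/= in_itv/= => /andP[t0 tb].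
  by rewrite /G patchE mem_setE in_itv/= t0 (le_trans tb).
have dF : {ae mu, forall x : R, 0 < x < 1 -> is_derive x 1 F (g x)}.
  have m01 : measurable (`[(0 : R), 1]%classic : set RR) by exact: measurable_itv.
  have locG := integrable_locally m01 ig.
  have := lebesgue_differentiation locG.
  apply: filterS; first exact: (ae_filter_ringOfSetsType mu).
  move=> x Gx /andP[x0 x1].
  have [dFx Fx] := @FTC1_lebesgue_pt R G (BLeft 0) x 1 x1 (iGS _ (measurable_itv _))
    x0 Gx.
  apply: DeriveDef; first exact: dFx.
  by rewrite -derive1E Fx /G patchE mem_setE in_itv/= !ltW.
pose h x := f x - F x.
have [N [mN N0 subN]] : {ae mu, forall x : R, 0 < x < 1 -> is_derive x 1 h 0}.
  move: df dF; apply: filterS2; first exact: (ae_filter_ringOfSetsType mu).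
  move=> x dfx dFx x01.
  by have := is_deriveB (dfx x01) (dFx x01); rewrite subrr.
suff : forall e, 0 < e -> `|h b - h 0| <= e * 3.
  move=> he; have h0 : h b = h 0.
    apply/eqP; rewrite -subr_eq0 -normr_le0; apply/ler_addgt0Pr => e e0.
    by rewrite add0r (le_trans (he (e / 3) _)) ?divr_gt0// divfK.
  have F0 : F 0 = 0 by rewrite /F set_itv1 Rintegral_set1.
  by move: h0; rewrite /h F0 subr0 => <-; rewrite subrK.
move=> e e0.
have [del del0 acd] := acf e e0.
have [del' [del'0 intd]] := integral_normr_continuous iG e0.
(* The end points carry no two-sided derivative and join the null set. *)
pose N' := N `|` [set 0; 1].
have ms (c : R) : measurable ([set c] : set RR) by exact: measurable_set1.
have m01 : measurable ([set 0; 1] : set RR) by exact: measurableU.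
have mN' : measurable (N' : set RR) by exact: measurableU.
have N'0 : mu N' = 0%E.
  rewrite (measureU0 mN m01) ?N0// (measureU0 (ms 0) (ms 1)).
    exact: lebesgue_measure_set1.
  exact: lebesgue_measure_set1.
(* An open set of measure below [del] and [del'] makes both the increments of f
   over the intervals of the chain and the integral of |G| over it small. *)
pose dd := Num.min del del'.
have dd0 : 0 < dd by rewrite lt_min del0.
have [U [oU N'U mU]] := @lebesgue_regularity_outer R N' dd mN'
  (eq_ind_r (fun z => (z < +oo)%E) (ltry 0) N'0) dd0.
have mUU : measurable (U : set RR) by exact: open_measurable.
have muU : (mu U < dd%:E)%E.
  have -> : U = (U `\` N') `|` N' by rewrite setDKU.
  by rewrite measureU0//; exact: measurableD.
have muU' D : measurable (D : set RR) -> (mu (U `&` D) < dd%:E)%E.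
  by move=> mD; apply: le_lt_trans muU; apply: le_measure; rewrite ?inE//;
    exact: measurableI.
have iU : mu.-integrable setT (EFin \o (\1_U : R -> R)).
  apply/integrableP; split; first exact/measurable_EFinP.
  rewrite (_ : (\int[mu]_x _)%E = mu U) ?(lt_trans muU) ?ltry//.
  transitivity (\int[mu]_(x in [set: RR]) (\1_U x)%:E)%E.
    by apply: eq_integral => t _; rewrite /= ger0_norm.
  by rewrite integral_indic// setIT.
have mG : measurable_fun setT G by case/integrableP : iG => /measurable_EFinP.
have iGU : mu.-integrable setT (EFin \o (fun t => `|G t| * \1_U t)).
  apply: le_integrable iG => //.
    apply/measurable_EFinP; apply: measurable_funM => //.
    exact: measurableT_comp.
  move=> t _ /=; rewrite lee_fin normrM normr_id indicE.
  by case: (t \in U); rewrite ?normr1 ?normr0 ?mulr1 ?mulr0.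
have J (r : R -> R) x y : mu.-integrable setT (EFin \o r) -> 0 <= x -> x <= y ->
    \int[mu]_(t in `[0, y]) r t - \int[mu]_(t in `[0, x]) r t =
    \int[mu]_(t in `]x, y]) r t.
  move=> ir x0 xy; rewrite (@Rintegral_itvB _ r (BLeft 0) (BRight y) x)//.
  exact: (integrableS _ _ _ ir).
pose lam x := \int[mu]_(t in `[0, x]) (\1_U t : R).
pose kap x := \int[mu]_(t in `[0, x]) (`|G t| * \1_U t).
have P0 : chain f h lam kap e 0.
  by apply: chain0; apply: Rintegral_ge0 => // t _; rewrite mulr_ge0.
have lam_ge x y : 0 <= x -> x <= y -> lam x <= lam y.
  by move=> x0 xy; rewrite -subr_ge0 J// Rintegral_ge0.
have kap_ge x y : 0 <= x -> x <= y -> kap x <= kap y.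
  move=> x0 xy; rewrite -subr_ge0 (J (fun t => `|G t| * \1_U t))//.
  by apply: Rintegral_ge0 => t _; rewrite mulr_ge0.
have Pb : chain f h lam kap e b.
  apply: real_induction b0 P0 _ => s /andP[s0 sb].
  (* Inside U the step is an interval of the chain; outside, [h] has derivative
     zero at s. *)
  have [Us|nUs] := pselect (U s).
    have [del1 /= del10 Bs] := (nbhs_ballP _ _).1 (open_nbhs_nbhs (conj oU Us)).
    exists del1 => // x y x0 sx xs sy ys yb xy; apply: chain_bad => //.
    - exact: ltW.
    - rewrite J// (@eq_Rintegral _ _ _ _ _ (cst 1)); last first.
        move=> t; rewrite inE/= in_itv/= => /andP[xt ty].
        rewrite indicE mem_set//; apply: Bs; rewrite /ball/= ltr_distl.
        by apply/andP; split; lra.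
      rewrite Rintegral_cst// mul1r.
      have e1 : mu `]x, y]%classic = (y - x)%:E.
        transitivity (if (x < y)%R then y%:E - x%:E else 0)%E.
          exact: (lebesgue_measure_itv `]x, y]).
        by move: xy; rewrite le_eqVlt => /predU1P[->|->//]; rewrite ltxx subrr.
      by transitivity (fine (y - x)%:E); [congr fine|].
    - rewrite (_ : h y - h x = (f y - f x) - (F y - F x)); last by rewrite /h; ring.
      rewrite (le_trans (ler_normB _ _))// lerD2l.
      rewrite (J (fun t => `|G t| * \1_U t))// J//.
      rewrite (le_trans (le_normr_Rintegral _ _))//; first exact: iGS.
      apply: le_Rintegral => //.
      + by apply: integrable_norm; exact: iGS.
      + exact: (integrableS _ _ _ iGU).
      + move=> t; rewrite /= in_itv/= => /andP[xt ty].
        rewrite indicE mem_set ?mulr1//; apply: Bs; rewrite /ball/= ltr_distl.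
        by apply/andP; split; lra.
  have nN : ~ N' s by move=> /N'U.
  have s01 : 0 < s < 1.
    apply/andP; split; rewrite lt_neqAle.
    - rewrite s0 andbT; apply/eqP => s0'; apply: nN; right; left; exact/esym.
    - rewrite (le_trans sb b1) andbT; apply/eqP => s1; apply: nN; right; right.
      exact: s1.
  have dh : is_derive s 1 h 0.
    apply: contrapT => ndh; apply: nN; left; apply: subN => /(_ s01).
    exact: ndh.
  have [del1 del10 hs] := is_derive0_slope dh e0.
  exists del1 => // x y x0 sx xs sy ys yb xy.
  apply: chain_good => //; [exact: lam_ge|exact: kap_ge|].
  rewrite (_ : h y - h x = (h y - h s) - (h x - h s)); last by ring.
  rewrite (le_trans (ler_normB _ _))//.
  have hy : `|h y - h s| <= e * (y - s).
    by rewrite -[y - s]ger0_norm ?subr_ge0// hs// ger0_norm ?subr_ge0//; lra.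
  have hx : `|h x - h s| <= e * (s - x).
    by have := hs x; rewrite (distrC x) ger0_norm ?subr_ge0//; apply; lra.
  by rewrite (le_trans (lerD hy hx))// -mulrDr ler_pM2l//; lra.
have [n [u [v [uv tuv sl hx]]]] := Pb.
have lamb : lam b < del.
  rewrite /lam /Rintegral integral_indic//.
  have h1 := muU' _ (measurable_itv `[0, b]).
  rewrite -lte_fin fineK; last by rewrite ge0_fin_numE// (lt_trans h1) ?ltry.
  by rewrite (lt_le_trans h1)// lee_fin ge_min lexx.
have kapb : kap b < e.
  rewrite (_ : kap b = \int[mu]_(t in `[0, b] `&` U) `|G t|).
    apply: intd; first exact: measurableI.
    rewrite setIC (lt_le_trans (muU' _ (measurable_itv `[0, b])))//.
    by rewrite lee_fin ge_min lexx orbT.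
  rewrite Rintegral_mkcondr; apply: eq_Rintegral => t _.
  by rewrite patchE indicE; case: ifP => tU; rewrite ?tU ?mulr1 ?mulr0.
have S : \sum_i `|f (v i) - f (u i)| < e.
  apply: acd => //; last exact: le_lt_trans lamb.
  by move=> i; have [-> /le_trans ->] := uv i.
have eb : e * b <= e by rewrite -[leRHS]mulr1 ler_pM2l.
rewrite (le_trans hx)// (_ : e * 3 = e + e + e); last by ring.
apply: lerD; last exact: ltW.
by apply: lerD; last exact: ltW.
Qed.

End FundamentalTheorem.

(** * Matrix Volterra equations with integrable kernels *)

(** A series dominated by that of the exponential converges, with the same tail
    estimate. *)
Lemma series_exp_tail {R : realType} (a : nat -> R) (Phi m : R) n :
  (forall k, `|a k| <= Phi * exp_coeff m k) ->
  series a @ \oo --> limn (series a) /\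
  `|limn (series a) - series a n| <= Phi * (expR m - series (exp_coeff m) n).
Proof.
move=> ale; pose e k := Phi * exp_coeff m k.
have ce : cvgn (series e).
  by apply: is_cvg_seriesZ; exact: is_cvg_series_exp_coeff.
have le : limn (series e) = Phi * expR m.
  by rewrite lim_seriesZ//; exact: is_cvg_series_exp_coeff.
have se k : series e k = Phi * series (exp_coeff m) k.
  by rewrite /series/= mulr_sumr.
have ca : cvgn (series a).
  apply: normed_cvg; apply: (series_le_cvg _ _ ale ce) => // k.
  exact: le_trans (normr_ge0 _) (ale k).
split; first exact: ca.
have aux (s : nat -> R) : cvgn (series s) -> (forall k, `|s k| <= e k) ->
    limn (series s) - series s n <= Phi * (expR m - series (exp_coeff m) n).
  move=> cs sle; rewrite mulrBr -le -se.
  have ces : cvgn (series e - series s) by exact: is_cvgB.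
  suff : series e n - series s n <= limn (series e) - limn (series s) by lra.
  rewrite -limB//; apply: (nondecreasing_cvgn_le _ ces).
  apply/nondecreasing_seqP => k; rewrite !fctE /series/= !big_nat_recr//=.
  by rewrite opprD addrACA lerDl subr_ge0 (le_trans (ler_norm _)).
rewrite ler_norml; apply/andP; split; last exact: aux.
have cNa : series (fun k => - a k) = - series a.
  by apply/funext => k; rewrite /series/= fctE sumrN.
have cN : cvgn (series (fun k => - a k)) by rewrite cNa; exact: is_cvgN.
have lN : limn (series (fun k => - a k)) = - limn (series a) by rewrite cNa limN.
have aN k : `|- a k| <= e k by rewrite normrN; exact: ale.
have := aux _ cN aN.
by rewrite lN (_ : series _ n = - series a n) ?cNa//; lra.
Qed.

Section MatrixVolterra.
Context {R : realType}.
Local Notation mu := (@lebesgue_measure R).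
Local Notation M2 := 'M[R[i]]_2.
Implicit Types (A B : M2) (F G K D : R -> M2) (x : R).

(** The sum of the moduli of the entries: a submultiplicative norm. *)
Definition nm A : R := \sum_i \sum_j cmod (A i j).

Lemma nm_ge0 A : 0 <= nm A.
Proof. by apply: sumr_ge0 => i _; apply: sumr_ge0 => j _; exact: cmod_ge0. Qed.

Lemma cmod_le_nm A i j : cmod (A i j) <= nm A.
Proof.
rewrite /nm (bigD1 i)//= (bigD1 j)//= -addrA lerDl addr_ge0//.
  by apply: sumr_ge0 => k _; exact: cmod_ge0.
by apply: sumr_ge0 => k _; apply: sumr_ge0 => l _; exact: cmod_ge0.
Qed.

Lemma nmD A B : nm (A + B) <= nm A + nm B.
Proof.
rewrite /nm -big_split/=; apply: ler_sum => i _.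
rewrite -big_split/=; apply: ler_sum => j _; rewrite mxE; exact: cmodD.
Qed.

Lemma nmN A : nm (- A) = nm A.
Proof.
by rewrite /nm; apply: eq_bigr => i _; apply: eq_bigr => j _; rewrite mxE cmodN.
Qed.

Lemma nmB A B : nm (A - B) <= nm A + nm B.
Proof. by rewrite -(nmN B); exact: nmD. Qed.

Lemma nm_le0 A : nm A <= 0 -> A = 0.
Proof.
move=> A0; apply/matrixP => i j; rewrite [RHS]mxE; apply: cmod_eq0.
by apply/eqP; rewrite eq_le cmod_ge0 (le_trans (cmod_le_nm _ _ _)).
Qed.

Lemma nmM A B : nm (A *m B) <= nm A * nm B.
Proof.
rewrite /nm mulr_suml; apply: ler_sum => i _.
rewrite (@le_trans _ _ (\sum_j \sum_k cmod (A i k) * cmod (B k j)))//.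
  apply: ler_sum => j _; rewrite mxE !big_ord_recl !big_ord0 !addr0 -!cmodM.
  exact: cmodD.
rewrite exchange_big/= mulr_suml; apply: ler_sum => k _.
rewrite -mulr_sumr ler_wpM2l ?cmod_ge0// [leRHS](bigD1 k)//= lerDl.
by apply: sumr_ge0 => l _; apply: sumr_ge0 => j _; exact: cmod_ge0.
Qed.

Lemma nmZ (c : R[i]) A : nm (c *: A) = cmod c * nm A.
Proof.
rewrite /nm mulr_sumr; apply: eq_bigr => i _; rewrite mulr_sumr.
by apply: eq_bigr => j _; rewrite mxE cmodM.
Qed.

(** Entrywise integrability and boundedness of a matrix function. *)
Definition mintegrable F := forall i j, cintegrable (fun x => F x i j).
Definition mbounded F := forall i j, cbounded (fun x => F x i j).

Lemma mintegrableD F G : mintegrable F -> mintegrable G ->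
  mintegrable (fun x => F x + G x).
Proof.
move=> iF iG i j; rewrite (_ : (fun x => _) = fun x => F x i j + G x i j).
  exact: cintegrableD.
by apply/funext => x; rewrite mxE.
Qed.

Lemma mintegrableN F : mintegrable F -> mintegrable (fun x => - F x).
Proof.
move=> iF i j; rewrite (_ : (fun x => _) = fun x => - F x i j).
  exact: cintegrableN.
by apply/funext => x; rewrite mxE.
Qed.

Lemma mintegrableM F G : mintegrable F -> mbounded G ->
  mintegrable (fun x => F x *m G x).
Proof.
move=> iF bG i j; rewrite (_ : (fun x => _) = fun x => \sum_k F x i k * G x k j).
  by apply: cintegrable_sum => k; exact: cintegrableM.
by apply/funext => x; rewrite mxE.
Qed.

Lemma mintegrableMl F G : mbounded F -> mintegrable G ->
  mintegrable (fun x => F x *m G x).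
Proof.
move=> bF iG i j; rewrite (_ : (fun x => _) = fun x => \sum_k G x k j * F x i k).
  by apply: cintegrable_sum => k; exact: cintegrableM.
by apply/funext => x; rewrite mxE; apply: eq_bigr => k _; rewrite mulrC.
Qed.

Lemma mboundedD F G : mbounded F -> mbounded G -> mbounded (fun x => F x + G x).
Proof.
move=> bF bG i j; rewrite (_ : (fun x => _) = fun x => F x i j + G x i j).
  exact: cboundedD.
by apply/funext => x; rewrite mxE.
Qed.

Lemma mboundedN F : mbounded F -> mbounded (fun x => - F x).
Proof.
move=> bF i j; rewrite (_ : (fun x => _) = fun x => 0 - F x i j).
  by apply: cboundedB => //; exact: cbounded_cst.
by apply/funext => x; rewrite mxE sub0r.
Qed.

Lemma mboundedB F G : mbounded F -> mbounded G -> mbounded (fun x => F x - G x).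
Proof. by move=> bF bG; apply: mboundedD => //; exact: mboundedN. Qed.

Lemma mboundedM F G : mbounded F -> mbounded G -> mbounded (fun x => F x *m G x).
Proof.
move=> bF bG i j; rewrite (_ : (fun x => _) = fun x => \sum_k F x i k * G x k j).
  by apply: cbounded_sum => k; exact: cboundedM.
by apply/funext => x; rewrite mxE.
Qed.

Lemma mbounded_cst A : mbounded (fun=> A).
Proof. by move=> i j; exact: cbounded_cst. Qed.

Lemma mxcintE F x i j : mxcint F x i j = cint (fun t => F t i j) x.
Proof. by rewrite mxE. Qed.

Lemma mbounded_mxcint F : mintegrable F -> mbounded (mxcint F).
Proof.
move=> iF i j; rewrite (_ : (fun x => _) = cint (fun t => F t i j)).
  exact: cbounded_cint.
by apply/funext => x; rewrite mxcintE.
Qed.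

Lemma eq_mxcint F G x : (forall t, 0 <= t <= x -> F t = G t) ->
  mxcint F x = mxcint G x.
Proof.
by move=> FG; apply/matrixP => i j; rewrite !mxcintE; apply: eq_cint => t /FG ->.
Qed.

Lemma mxcintD F G x : x <= 1 -> mintegrable F -> mintegrable G ->
  mxcint (fun t => F t + G t) x = mxcint F x + mxcint G x.
Proof.
move=> x1 iF iG; apply/matrixP => i j; rewrite [RHS]mxE !mxcintE -(cintD x1 (iF i j) (iG i j)).
by apply: eq_cint => t _; rewrite mxE.
Qed.

Lemma mxcintN F x : x <= 1 -> mintegrable F ->
  mxcint (fun t => - F t) x = - mxcint F x.
Proof.
move=> x1 iF; apply/matrixP => i j; rewrite [RHS]mxE !mxcintE -(cintN x1 (iF i j)).
by apply: eq_cint => t _; rewrite mxE.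
Qed.

Lemma mxcintB F G x : x <= 1 -> mintegrable F -> mintegrable G ->
  mxcint (fun t => F t - G t) x = mxcint F x - mxcint G x.
Proof.
by move=> x1 iF iG; rewrite (mxcintD x1 iF (mintegrableN iG)) (mxcintN x1 iG).
Qed.

Lemma mxcintMr F A x : x <= 1 -> mintegrable F ->
  mxcint (fun t => F t *m A) x = mxcint F x *m A.
Proof.
move=> x1 iF; apply/matrixP => i j; rewrite [RHS]mxE mxcintE.
have iFA k : cintegrable (fun t => F t i k * A k j).
  by apply: cintegrableM => //; exact: cbounded_cst.
transitivity (cint (fun t => \sum_k F t i k * A k j) x).
  by apply: eq_cint => t _; rewrite mxE.
rewrite (cint_sum x1 iFA); apply: eq_bigr => k _.
by rewrite mxcintE -(cintZr _ x1 (iF i k)).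
Qed.

Lemma mxcintMl A F x : x <= 1 -> mintegrable F ->
  mxcint (fun t => A *m F t) x = A *m mxcint F x.
Proof.
move=> x1 iF; apply/matrixP => i j; rewrite [RHS]mxE mxcintE.
have iAF k : cintegrable (fun t => A i k * F t k j) by exact: cintegrableZl.
transitivity (cint (fun t => \sum_k A i k * F t k j) x).
  by apply: eq_cint => t _; rewrite mxE.
rewrite (cint_sum x1 iAF); apply: eq_bigr => k _.
by rewrite mxcintE -(cintZl _ x1 (iF k j)).
Qed.

Lemma mxcintZ c F x : x <= 1 -> mintegrable F ->
  mxcint (fun t => c *: F t) x = c *: mxcint F x.
Proof.
move=> x1 iF; apply/matrixP => i j; rewrite [RHS]mxE !mxcintE -(cintZl c x1 (iF i j)).
by apply: eq_cint => t _; rewrite mxE.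
Qed.

Lemma mintegrableZ c F : mintegrable F -> mintegrable (fun t => c *: F t).
Proof.
move=> iF i j; rewrite (_ : (fun x => _) = fun x => c * F x i j).
  exact: cintegrableZl.
by apply/funext => x; rewrite mxE.
Qed.

Lemma mxcint_byparts F G x : 0 <= x <= 1 -> mintegrable F -> mintegrable G ->
  mxcint F x *m mxcint G x =
  mxcint (fun t => F t *m mxcint G t) x + mxcint (fun t => mxcint F t *m G t) x.
Proof.
move=> x01 iF iG; have /andP[x0 x1] := x01.
apply/matrixP => i j; rewrite !mxE.
have i1 k : cintegrable (fun t => F t i k * cint (fun s => G s k j) t).
  by apply: cintegrableM => //; exact: cbounded_cint.
have i2 k : cintegrable (fun t => cint (fun s => F s i k) t * G t k j).
  rewrite (_ : (fun t => _) = fun t => G t k j * cint (fun s => F s i k) t).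
    by apply: cintegrableM => //; exact: cbounded_cint.
  by apply/funext => t; rewrite mulrC.
transitivity (\sum_k (cint (fun t => F t i k * cint (fun s => G s k j) t) x +
   cint (fun t => cint (fun s => F s i k) t * G t k j) x)).
  by apply: eq_bigr => k _; rewrite -(cint_byparts x01 (iF i k) (iG k j)) !mxE.
rewrite big_split/= -(cint_sum x1 i1) -(cint_sum x1 i2).
by congr (_ + _); apply: eq_cint => t _; rewrite mxE; apply: eq_bigr => k _;
  rewrite mxcintE.
Qed.

Lemma nm_mxcint_le F (r : R -> R) x : 0 <= x <= 1 -> mintegrable F ->
  mu.-integrable `[(0 : R), 1] (fun t => (r t)%:E) ->
  (forall t, 0 <= t <= x -> nm (F t) <= r t) ->
  nm (mxcint F x) <= \int[mu]_(t in `[0, x]) r t.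
Proof.
move=> /andP[x0 x1] iF ir Fr.
have ic i j := cintegrable_cmod (iF i j).
have icx i j := integrable_0x x1 (ic i j).
have irow i : mu.-integrable `[0, x] (EFin \o (fun t => cmod (F t i ord0) + cmod (F t i ord_max))).
  by apply: (integrableD _ (icx i _) (icx i _)).
have m0x : measurable (`[0, x]%classic : set (measurableTypeR R)) by exact: measurable_itv.
have i2 := integrableD m0x (irow ord0) (irow ord_max).
apply: (@le_trans _ _ (\int[mu]_(t in `[0, x]) (
   (cmod (F t ord0 ord0) + cmod (F t ord0 ord_max)) +
   (cmod (F t ord_max ord0) + cmod (F t ord_max ord_max))))).
  rewrite (RintegralD m0x (irow ord0) (irow ord_max)).
  rewrite (RintegralD m0x (icx ord0 ord0) (icx ord0 ord_max)).
  rewrite (RintegralD m0x (icx ord_max ord0) (icx ord_max ord_max)).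
  have L i j : cmod (mxcint F x i j) <= \int[mu]_(t in `[0, x]) cmod (F t i j).
    by rewrite mxcintE; apply: cmod_cint_le.
  rewrite /nm !big_ord_recl !big_ord0 !addr0.
  rewrite (_ : lift ord0 ord0 = ord_max); last exact/val_inj.
  by rewrite !lerD.
apply: (le_Rintegral m0x i2 (integrable_0x x1 ir)).
move=> t; rewrite /= in_itv/= => /Fr; apply: le_trans.
rewrite /nm !big_ord_recl !big_ord0 !addr0.
by rewrite (_ : lift ord0 ord0 = ord_max)//; exact/val_inj.
Qed.

Section Kernel.
Variables (K : R -> M2) (m : R -> R).
Hypothesis iK : mintegrable K.
Hypothesis im : mu.-integrable `[(0 : R), 1] (fun t => (m t)%:E).
Hypothesis Km : forall t, 0 <= t <= 1 -> nm (K t) <= m t.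

Let m0 t : 0 <= t <= 1 -> 0 <= m t.
Proof. by move=> /Km; exact/le_trans/nm_ge0. Qed.

Let IM x := \int[mu]_(t in `[0, x]) m t.

Let cm (t : R) : R[i] := (m t)%:C%C.

Let icm : cintegrable cm.
Proof.
split => //; rewrite (_ : (fun x => _) = fun=> 0%E).
  exact: integrable0.
by apply/funext.
Qed.

Let IM_ge0 x : 0 <= x <= 1 -> 0 <= IM x.
Proof.
move=> /andP[x0 x1]; apply: Rintegral_ge0 => t; rewrite /= in_itv/= => /andP[t0 tx].
by rewrite m0// t0 (le_trans tx).
Qed.

Let IM_le x : 0 <= x <= 1 -> IM x <= IM 1.
Proof. by move=> x01; exact: Rintegral_0x_le. Qed.

Let cmIM : cint cm = fun x => (IM x)%:C%C.
Proof. by apply/funext => x; exact: cint_real. Qed.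

Let bX n : cbounded (fun t => cint cm t ^+ n).
Proof.
elim: n => [|n IH]; first exact: cbounded_cst.
rewrite (_ : (fun t => _) = fun t => cint cm t * cint cm t ^+ n).
  by apply: cboundedM => //; exact: cbounded_cint.
by apply/funext => t; rewrite exprS.
Qed.

Let cpower n x : 0 <= x <= 1 ->
  cint cm x ^+ n.+1 = n.+1%:R * cint (fun t => cm t * cint cm t ^+ n) x.
Proof.
have iX k : cintegrable (fun t => cm t * cint cm t ^+ k) by exact: cintegrableM.
elim: n x => [|n IH] x x01; have /andP[x0 x1] := x01.
  by rewrite expr1 mul1r; apply: eq_cint => t _; rewrite expr0 mulr1.
rewrite exprS IH// mulrCA (cint_byparts x01 icm (iX n)) mulrDr.
rewrite -(@cintZl _ n.+1%:R (fun t => cm t * cint (fun s => cm s * cint cm s ^+ n) t) _ x1); last first.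
  by apply: cintegrableM => //; exact: cbounded_cint.
rewrite (@eq_cint _ _ (fun t => cm t * cint cm t ^+ n.+1)); last first.
  move=> t /andP[t0 tx]; have t01 : 0 <= t <= 1 by rewrite t0 (le_trans tx).
  by rewrite (IH _ t01) [RHS]mulrCA.
rewrite (@eq_cint _ (fun t => cint cm t * (cm t * cint cm t ^+ n)) (fun t => cm t * cint cm t ^+ n.+1)); last first.
  by move=> t _; rewrite exprS mulrCA.
by rewrite [in RHS]mulrS mulrDl mul1r.
Qed.

(** With IM the primitive of m, m * IM ^ n is the derivative of
    IM ^ (n + 1) / (n + 1). *)
Lemma Rintegral_power n x : 0 <= x <= 1 ->
  n.+1%:R * \int[mu]_(t in `[0, x]) (m t * IM t ^+ n) = IM x ^+ n.+1.
Proof.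
move=> x01; have := cpower n x01; rewrite cmIM.
rewrite (@eq_cint _ _ (fun t => (m t * IM t ^+ n)%:C%C)); last first.
  by move=> t _; rewrite rmorphM rmorphXn.
rewrite cint_real -(rmorphXn (real_complex R)) -(rmorph_nat (real_complex R)).
by rewrite -(rmorphM (real_complex R)) => -[].
Qed.

Lemma integrable_power n : mu.-integrable `[(0 : R), 1] (fun t => (m t * IM t ^+ n)%:E).
Proof.
have [+ _] := cintegrableM icm (bX n).
apply: eq_integrable => // t _.
by rewrite cmIM -(rmorphXn (real_complex R)) -(rmorphM (real_complex R)).
Qed.

(** One step of Picard iteration turns the n-th term of the exponential series
    of [IM] into the next one. *)
Lemma volterra_step D c n : mbounded D -> 0 <= c ->
  (forall t, 0 <= t <= 1 -> nm (D t) <= c * exp_coeff (IM t) n) ->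
  forall x, 0 <= x <= 1 ->
    nm (mxcint (fun t => K t *m D t) x) <= c * exp_coeff (IM x) n.+1.
Proof.
move=> bD c0 Dc x x01; have /andP[x0 x1] := x01.
pose r t := c / n`!%:R * (m t * IM t ^+ n).
have ir : mu.-integrable `[(0 : R), 1] (fun t => (r t)%:E).
  by apply: (integrableZl _ (c / n`!%:R) (integrable_power n)).
apply: (le_trans (nm_mxcint_le (r := r) x01 _ ir _)).
- exact: mintegrableM.
- move=> t /andP[t0 tx]; have t01 : 0 <= t <= 1 by rewrite t0 (le_trans tx).
  rewrite (le_trans (nmM _ _))// (le_trans (ler_pM (nm_ge0 _) (nm_ge0 _) (Km t01) (Dc _ t01)))//.
  by rewrite /r /exp_coeff/= le_eqVlt; apply/orP; left; apply/eqP; ring.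
- rewrite /r RintegralZl//; last exact: (integrable_0x x1 (integrable_power n)).
  rewrite /exp_coeff/= -(Rintegral_power n x01) factS natrM invfM.
  have n0 : (n.+1%:R : R) != 0 by rewrite pnatr_eq0.
  rewrite mulrACA divff// mul1r mulrAC -mulrA.
  by rewrite le_eqVlt; apply/orP; left; apply/eqP; ring.
Qed.

(** Iterating the equation bounds a solution by every term of the exponential
    series, and these tend to zero. *)
Lemma volterra_unique D : mbounded D ->
  (forall x, 0 <= x <= 1 -> D x = mxcint (fun t => K t *m D t) x) ->
  forall x, 0 <= x <= 1 -> D x = 0.
Proof.
move=> bD Deq x x01.
have [c [c0 Dc]] : exists c, 0 <= c /\ forall t, 0 <= t <= 1 -> nm (D t) <= c.
  have b i j : exists c, forall t, 0 <= t <= 1 -> cmod (D t i j) <= c.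
    by have [_] := bD i j.
  have [c00 H00] := b ord0 ord0; have [c01 H01] := b ord0 ord_max.
  have [c10 H10] := b ord_max ord0; have [c11 H11] := b ord_max ord_max.
  have H t : 0 <= t <= 1 -> nm (D t) <= c00 + c01 + (c10 + c11).
    move=> t01; rewrite /nm !big_ord_recl !big_ord0 !addr0.
    rewrite (_ : lift ord0 ord0 = ord_max); last exact/val_inj.
    by rewrite !lerD ?H00 ?H01 ?H10 ?H11.
  exists (c00 + c01 + (c10 + c11)); split => //.
  by rewrite (le_trans (nm_ge0 _) (H 0 _))// lexx ler01.
have it n : forall t, 0 <= t <= 1 -> nm (D t) <= c * exp_coeff (IM t) n.
  elim: n => [|n IH] t t01.
    by rewrite /exp_coeff/= expr0 fact0 divr1 mulr1 Dc.
  by rewrite Deq//; exact: volterra_step.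
apply: nm_le0.
have : c * exp_coeff (IM x) n @[n --> \oo] --> c * 0.
  by apply: cvgMr; exact: cvg_exp_coeff.
rewrite mulr0 => cv; apply: (cvgr_to_ge cv).
by apply: nearW => n; exact: it.
Qed.

(** Solvability of the Volterra equation by Picard iteration; the factor 8
    counts the real and imaginary parts of the entries of a 2 x 2 matrix. *)
Lemma volterra_exists F (Phi : R) : mbounded F ->
  (forall t, 0 <= t <= 1 -> nm (F t) <= Phi) ->
  exists Z : R -> M2, [/\ mbounded Z,
    forall x, 0 <= x <= 1 -> Z x = F x + mxcint (fun t => K t *m Z t) x &
    forall x, 0 <= x <= 1 -> nm (Z x) <= 8 * Phi * expR (IM 1)].
Proof.
move=> bF FPhi.
have i01 : 0 <= (1 : R) <= 1 by rewrite ler01 lexx.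
have Phi0 : 0 <= Phi := le_trans (nm_ge0 _) (FPhi _ i01).
pose r n := iter n (fun D x => mxcint (fun t => K t *m D t) x) F.
have br n : mbounded (r n).
  by case: n => [//|n]; apply: mbounded_mxcint; apply: mintegrableM => //;
    elim: n => [//|n IH]; apply: mbounded_mxcint; exact: mintegrableM.
have rle n : forall x, 0 <= x <= 1 -> nm (r n x) <= Phi * exp_coeff (IM x) n.
  elim: n => [|n IH] x x01.
    by rewrite /exp_coeff/= expr0 fact0 divr1 mulr1 FPhi.
  exact: volterra_step.
have rle1 n x : 0 <= x <= 1 -> nm (r n x) <= Phi * exp_coeff (IM 1) n.
  move=> x01; rewrite (le_trans (rle _ _ x01))// ler_wpM2l// /exp_coeff/=.
  by rewrite ler_pM2r ?invr_gt0 ?ltr0n ?fact_gt0// lerXn2r ?nnegrE ?IM_ge0 ?IM_le.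
pose S n x := \sum_(k < n) r k x.
have bS n : mbounded (S n).
  elim: n => [|n IH].
    rewrite (_ : S 0%N = fun=> 0); first exact: mbounded_cst.
    by apply/funext => x; rewrite /S big_ord0.
  rewrite (_ : S n.+1 = fun x => S n x + r n x); first exact: mboundedD.
  by apply/funext => x; rewrite /S big_ord_recr.
have SS n x : 0 <= x <= 1 -> S n.+1 x = F x + mxcint (fun t => K t *m S n t) x.
  move=> x01; have /andP[x0 x1] := x01.
  rewrite /S big_ord_recl; congr (_ + _).
  elim: n => [|n IH].
    rewrite big_ord0 (@eq_mxcint _ (fun t => K t *m 0)); last first.
      by move=> t _; rewrite big_ord0.
    by rewrite (mxcintMr 0 x1 iK) mulmx0.
  rewrite big_ord_recr/= IH -(mxcintD x1); first last.
  - exact: mintegrableM.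
  - by apply: mintegrableM => //; exact: bS.
  by apply: eq_mxcint => t _; rewrite -mulmxDr big_ord_recr.
pose Z x : M2 := \matrix_(i, j)
  (limn (series (fun k => complex.Re (r k x i j))) +i*
   limn (series (fun k => complex.Im (r k x i j))))%C.
pose tau n := expR (IM 1) - series (exp_coeff (IM 1)) n.
have SRe n x i j : complex.Re (S n x i j) = series (fun k => complex.Re (r k x i j)) n.
  rewrite /S /series/= big_mkord; elim: n => [|n IH]; first by rewrite !big_ord0 mxE.
  by rewrite !big_ord_recr/= mxE cReD IH.
have SIm n x i j : complex.Im (S n x i j) = series (fun k => complex.Im (r k x i j)) n.
  rewrite /S /series/= big_mkord; elim: n => [|n IH]; first by rewrite !big_ord0 mxE.
  by rewrite !big_ord_recr/= mxE cImD IH.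
have tRe n x i j : 0 <= x <= 1 -> series (fun k => complex.Re (r k x i j)) @ \oo -->
      complex.Re (Z x i j) /\
    `|complex.Re (Z x i j) - complex.Re (S n x i j)| <= Phi * tau n.
  move=> x01; rewrite mxE SRe/=; apply: series_exp_tail => k.
  by rewrite (le_trans (Re_le_cmod _))// (le_trans (cmod_le_nm _ _ _))// rle1.
have tIm n x i j : 0 <= x <= 1 -> series (fun k => complex.Im (r k x i j)) @ \oo -->
      complex.Im (Z x i j) /\
    `|complex.Im (Z x i j) - complex.Im (S n x i j)| <= Phi * tau n.
  move=> x01; rewrite mxE SIm/=; apply: series_exp_tail => k.
  by rewrite (le_trans (Im_le_cmod _))// (le_trans (cmod_le_nm _ _ _))// rle1.
have tZ n x : 0 <= x <= 1 -> nm (Z x - S n x) <= 8 * Phi * tau n.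
  move=> x01.
  have L i j : cmod ((Z x - S n x) i j) <= Phi * tau n + Phi * tau n.
    rewrite (le_trans (cmod_le_ReIm _))// !mxE lerD//.
    - have [_] := tRe n x i j x01; by rewrite !mxE cReD cReN.
    - have [_] := tIm n x i j x01; by rewrite !mxE cImD cImN.
  rewrite /nm !big_ord_recl !big_ord0 !addr0.
  rewrite (le_trans (lerD (lerD (L _ _) (L _ _)) (lerD (L _ _) (L _ _))))//.
  by rewrite le_eqVlt; apply/orP; left; apply/eqP; ring.
have S0 x : S 0%N x = 0 by rewrite /S big_ord0.
have Zle x : 0 <= x <= 1 -> nm (Z x) <= 8 * Phi * expR (IM 1).
  move=> x01; have := tZ 0%N x x01.
  by rewrite S0 subr0 /tau /series/= big_geq// subr0.
have bZ : mbounded Z.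
  move=> i j; split; last first.
    exists (8 * Phi * expR (IM 1)) => x x01.
    exact: (le_trans (cmod_le_nm _ _ _) (Zle _ x01)).
  split.
  - apply: (@measurable_fun_cvg _ _ _ _ (fun n x => complex.Re (S n x i j))).
      by move=> n; have [[]] := bS n i j.
    move=> x /in01P x01; have [+ _] := tRe 0%N x i j x01.
    rewrite (_ : series _ = fun n => complex.Re (S n x i j)) //.
    by apply/funext => n; rewrite SRe.
  - apply: (@measurable_fun_cvg _ _ _ _ (fun n x => complex.Im (S n x i j))).
      by move=> n; have [[]] := bS n i j.
    move=> x /in01P x01; have [+ _] := tIm 0%N x i j x01.
    rewrite (_ : series _ = fun n => complex.Im (S n x i j)) //.
    by apply/funext => n; rewrite SIm.
have tau0 : tau n @[n --> \oo] --> (0 : R).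
  rewrite -(subrr (expR (IM 1))); apply: cvgB; first exact: cvg_cst.
  exact: is_cvg_series_exp_coeff.
exists Z; split => // x x01; have /andP[x0 x1] := x01.
apply/eqP; rewrite -subr_eq0; apply/eqP; apply: nm_le0.
have bound n : nm (Z x - (F x + mxcint (fun t => K t *m Z t) x)) <=
    8 * Phi * tau n.+1 + IM x * (8 * Phi) * tau n.
  have iKZ : mintegrable (fun t => K t *m Z t) by exact: mintegrableM.
  have iKS : mintegrable (fun t => K t *m S n t) by exact: mintegrableM.
  rewrite (_ : Z x - _ = (Z x - S n.+1 x) - mxcint (fun t => K t *m (Z t - S n t)) x).
    rewrite (le_trans (nmB _ _))// lerD ?tZ//.
    have ik : mu.-integrable `[(0 : R), 1] (fun t => (m t * (8 * Phi * tau n))%:E).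
      by apply: (integrableZr _ (8 * Phi * tau n) im).
    rewrite (le_trans (nm_mxcint_le (r := fun t => m t * (8 * Phi * tau n)) x01 _ ik _))//.
    - by apply: mintegrableM => //; exact: mboundedB.
    - move=> t /andP[t0 tx]; have t01 : 0 <= t <= 1 by rewrite t0 (le_trans tx).
      by rewrite (le_trans (nmM _ _))// ler_pM ?nm_ge0 ?Km ?tZ.
    - by rewrite RintegralZr//; [rewrite mulrA|exact: integrable_0x].
  rewrite SS// (@eq_mxcint (fun t => K t *m (Z t - S n t))
    (fun t => K t *m Z t - K t *m S n t)); last by move=> t _; rewrite mulmxBr.
  by rewrite (mxcintB x1 iKZ iKS) !opprD opprK !addrA [RHS]addrAC subrK.
have cv : 8 * Phi * tau n.+1 + IM x * (8 * Phi) * tau n @[n --> \oo] -->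
    8 * Phi * 0 + IM x * (8 * Phi) * 0.
  by apply: cvgD; apply: cvgMr => //; rewrite cvg_shiftS.
rewrite !mulr0 addr0 in cv; apply: (cvgr_to_ge cv).
by apply: nearW => n; exact: bound.
Qed.

End Kernel.
End MatrixVolterra.

(** * Two by two matrices and oscillating phases *)

Section TwoByTwo.
Context {K : comPzRingType}.
Implicit Types a b c d : K.

Lemma mx2_ext (A B : 'M[K]_2) : A ord0 ord0 = B ord0 ord0 ->
  A ord0 ord_max = B ord0 ord_max -> A ord_max ord0 = B ord_max ord0 ->
  A ord_max ord_max = B ord_max ord_max -> A = B.
Proof.
move=> h00 h01 h10 h11; apply/matrixP => i j.
have ord2 (k : 'I_2) : k = ord0 \/ k = ord_max.
  by case: k => -[|[|//]] ?; [left|right]; exact/val_inj.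
by case: (ord2 i) => ->; case: (ord2 j) => ->.
Qed.

Lemma mx2M a b c d a' b' c' d' : mx2 a b c d *m mx2 a' b' c' d' =
  mx2 (a * a' + b * c') (a * b' + b * d') (c * a' + d * c') (c * b' + d * d').
Proof.
by apply: mx2_ext; rewrite !mxE !big_ord_recl big_ord0 addr0 !mxE.
Qed.

Lemma mx2D a b c d a' b' c' d' : mx2 a b c d + mx2 a' b' c' d' =
  mx2 (a + a') (b + b') (c + c') (d + d').
Proof. by apply: mx2_ext; rewrite !mxE. Qed.

Lemma mx2Z k a b c d : k *: mx2 a b c d = mx2 (k * a) (k * b) (k * c) (k * d).
Proof. by apply: mx2_ext; rewrite !mxE. Qed.

End TwoByTwo.

Section Phases.
Context {R : realType}.
Local Notation mu := (@lebesgue_measure R).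
Local Notation RR := (measurableTypeR R).
Implicit Types (nu : R[i]) (sigma : R -> R[i]).

Lemma mxcint_mx2 (a b c d : R -> R[i]) x :
  mxcint (fun t => mx2 (a t) (b t) (c t) (d t)) x =
  mx2 (cint a x) (cint b x) (cint c x) (cint d x).
Proof. by apply: mx2_ext; rewrite !mxE; apply: eq_cint => t _; rewrite mxE. Qed.

Lemma mbounded_mx2 (a b c d : R -> R[i]) : cbounded a -> cbounded b ->
  cbounded c -> cbounded d -> mbounded (fun t => mx2 (a t) (b t) (c t) (d t)).
Proof.
move=> ba bb bc bd i j.
rewrite (_ : (fun x => _) = fun t => if i == ord0 then (if j == ord0 then a t else b t)
  else (if j == ord0 then c t else d t)).
  by case: (i == ord0); case: (j == ord0).
by apply/funext => t; rewrite mxE.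
Qed.

Lemma mintegrable_mx2 (a b c d : R -> R[i]) : cintegrable a -> cintegrable b ->
  cintegrable c -> cintegrable d -> mintegrable (fun t => mx2 (a t) (b t) (c t) (d t)).
Proof.
move=> ba bb bc bd i j.
rewrite (_ : (fun x => _) = fun t => if i == ord0 then (if j == ord0 then a t else b t)
  else (if j == ord0 then c t else d t)).
  by case: (i == ord0); case: (j == ord0).
by apply/funext => t; rewrite mxE.
Qed.

Lemma mintegrable_scale (f : R -> R[i]) (F : R -> 'M[R[i]]_2) :
  cintegrable f -> mbounded F -> mintegrable (fun t => f t *: F t).
Proof.
move=> fi bF i j; rewrite (_ : (fun x => _) = fun t => f t * F t i j).
  by apply: cintegrableM.
by apply/funext => t; rewrite mxE.
Qed.

Lemma nm_mx2 (a b c d : R[i]) :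
  nm (mx2 a b c d) = cmod a + cmod b + (cmod c + cmod d).
Proof. by rewrite /nm !big_ord_recl !big_ord0 !addr0 !mxE. Qed.

(** The phase of frequency -2 nu. *)
Definition phase nu (t : R) : R[i] := cexp (- (2 * iu * nu * t%:C%C)).

Lemma phaseE nu t : phase nu t = cexp ((- (2 * iu * nu)) * t%:C%C).
Proof. by rewrite /phase mulNr. Qed.

Lemma phaseN nu t : phase (- nu) t = cexp (2 * iu * nu * t%:C%C).
Proof. by rewrite /phase mulrN mulNr opprK. Qed.

Lemma phaseD nu t u : phase nu (t + u) = phase nu t * phase nu u.
Proof. by rewrite !phaseE rmorphD/= mulrDr cexpD. Qed.

Lemma phaseNr nu t : phase nu (- t) = phase (- nu) t.
Proof. by rewrite phaseN phaseE rmorphN/= mulrN mulNr opprK. Qed.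

Lemma phaseB nu t u : phase nu (t - u) = phase nu t * phase (- nu) u.
Proof. by rewrite phaseD phaseNr. Qed.

Lemma cont01_cexp (z : R[i]) : cont01 (fun t : R => cexp (z * t%:C%C)).
Proof.
have cR : continuous (fun t : R => complex.Re (z * t%:C%C)).
  rewrite (_ : (fun t => _) = fun t => complex.Re z * t).
    by move=> t; apply: mulrl_continuous.
  by apply/funext => t; rewrite cReM/= mulr0 subr0.
have cI : continuous (fun t : R => complex.Im (z * t%:C%C)).
  rewrite (_ : (fun t => _) = fun t => complex.Im z * t).
    by move=> t; apply: mulrl_continuous.
  by apply/funext => t; rewrite cImM/= mulr0 add0r.
have ce : continuous (fun t : R => expR (complex.Re (z * t%:C%C))).
  by move=> t; apply: continuous_comp; [exact: cR|exact: continuous_expR].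
split; apply: continuous_subspaceT => t; apply: cvgM; try exact: ce.
- by apply: continuous_comp; [exact: cI|exact: continuous_cos].
- by apply: continuous_comp; [exact: cI|exact: continuous_sin].
Qed.

Lemma cbounded_phase nu : cbounded (phase nu).
Proof.
rewrite (_ : phase nu = fun t => cexp ((- (2 * iu * nu)) * t%:C%C)).
  exact/cont01_cbounded/cont01_cexp.
by apply/funext => t; exact: phaseE.
Qed.

Lemma cmod_phase nu (t : R) : cmod (phase nu t) = expR (2 * complex.Im nu * t).
Proof.
by rewrite /phase cmod_cexp; congr expR; case: nu => a b;
  rewrite cReN !cReM !cImM/=; ring.
Qed.

Lemma cmod_phase_le nu (t D : R) : `|complex.Im nu| <= D -> 0 <= t <= 1 ->
  cmod (phase nu t) <= expR (2 * D).
Proof.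
move=> nuD /andP[t0 t1]; rewrite cmod_phase ler_expR -mulrA ler_pM2l//.
rewrite (le_trans (ler_norm _))// normrM (ger0_norm t0).
by rewrite (le_trans _ nuD)// ler_piMr.
Qed.

End Phases.

(** * Square-integrable functions and their correlations *)

Section SquareIntegrable.
Context {R : realType}.
Local Notation mu := (@lebesgue_measure R).
Local Notation RR := (measurableTypeR R).
Implicit Types (f sigma : R -> R[i]).

(** The square of the L2 norm as an extended real. *)
Lemma Lpnorm2E f :
  (Lpnorm 2 f `^ 2 = \int[mu]_(x in `[0%R, 1%R]) (cmod (f x) ^+ 2)%:E)%E.
Proof.
rewrite /Lpnorm poweR_Lnorm// [RHS]integral_mkcond; apply: eq_integral => x _.
rewrite !patchE; case: ifP => _; last first.
  by rewrite abse0 poweR0r.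
by rewrite abse_EFin poweR_EFin ger0_norm ?cmod_ge0// powR_mulrn ?cmod_ge0.
Qed.

Lemma L2norm_ge0 f : 0 <= L2norm f.
Proof. by rewrite fine_ge0// Lnorm_ge0. Qed.

Lemma L2norm_sqr f :
  mu.-integrable `[(0 : R), 1] (fun x => (cmod (f x) ^+ 2)%:E) ->
  L2norm f ^+ 2 = \int[mu]_(x in `[0, 1]) (cmod (f x) ^+ 2).
Proof.
move=> fi; rewrite /Rintegral -Lpnorm2E /L2norm.
have m01 : measurable (`[(0 : R), 1]%classic : set RR) by exact: measurable_itv.
have fin := integrable_fin_num m01 fi.
have : (0 <= Lpnorm 2 f)%E by exact: Lnorm_ge0.
move: fin; rewrite -Lpnorm2E; case: (Lpnorm 2 f) => [r _|+ _|//].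
  by rewrite lee_fin => r0; rewrite poweR_EFin/= powR_mulrn.
by rewrite poweRyr.
Qed.

Lemma in_L2_meas sigma : in_L2 sigma -> cmeasurable sigma.
Proof. by case. Qed.

Lemma in_L2_sqr sigma : in_L2 sigma ->
  mu.-integrable `[(0 : R), 1] (fun x => (cmod (sigma x) ^+ 2)%:E).
Proof.
move=> sL; have ms := in_L2_meas sL; have [_ _ sfin] := sL.
apply/integrableP; split.
  by apply/measurable_EFinP; apply: measurable_funX; exact: cmeasurable_cmod.
rewrite (_ : (\int[mu]_(x in _) _)%E = (Lpnorm 2 sigma `^ 2)%E) ?poweR_lty//.
rewrite Lpnorm2E; apply: eq_integral => x _.
by rewrite gee0_abs// lee_fin sqr_ge0.
Qed.

Lemma in_L2_integrable sigma : in_L2 sigma -> cintegrable sigma.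
Proof.
move=> sL; apply: (le_cintegrable (in_L2_meas sL)
  (integrableD _ (integrable01_cst 1) (in_L2_sqr sL))) => // x _.
by have := sqr_ge0 (cmod (sigma x) - 1); have := cmod_ge0 (sigma x); nra.
Qed.

Lemma in_L2_integrable_sqr sigma : in_L2 sigma ->
  cintegrable (fun x => sigma x ^+ 2).
Proof.
move=> sL; apply: (le_cintegrable _ (in_L2_sqr sL)) => [|x _].
  by rewrite (_ : (fun x => _) = fun x => sigma x * sigma x);
   [apply: cmeasurableM; exact: in_L2_meas|apply/funext => x; rewrite expr2].
by rewrite expr2 cmodM.
Qed.

(** The L1 norm is controlled by the L2 norm through s <= s ^ 2 + 1. *)
Lemma cint_L1_le sigma : in_L2 sigma ->
  \int[mu]_(x in `[0, 1]) cmod (sigma x) <= L2norm sigma ^+ 2 + 1.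
Proof.
move=> sL; rewrite (L2norm_sqr (in_L2_sqr sL)).
have m01 : measurable (`[(0 : R), 1]%classic : set RR) by exact: measurable_itv.
have -> : \int[mu]_(x in `[0, 1]) (cmod (sigma x) ^+ 2) + 1 =
    \int[mu]_(x in `[0, 1]) (cmod (sigma x) ^+ 2 + 1).
  rewrite RintegralD//; last 2 first.
  - exact: in_L2_sqr.
  - exact: integrable01_cst.
  by rewrite Rintegral01_cst.
apply: le_Rintegral => //.
- exact: (cintegrable_cmod (in_L2_integrable sL)).
- by apply: (integrableD m01 (in_L2_sqr sL) (integrable01_cst 1)).
- move=> x _; have := sqr_ge0 (cmod (sigma x) - 1); have := cmod_ge0 (sigma x); nra.
Qed.

End SquareIntegrable.

Lemma cintegrable_phaseM {R : realType} (sigma : R -> R[i]) (nu : R[i]) : cintegrable sigma ->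
  cintegrable (fun t => phase nu t * sigma t).
Proof.
move=> si; rewrite (_ : (fun t => _) = fun t => sigma t * phase nu t).
  by apply: cintegrableM => //; exact: cbounded_phase.
by apply/funext => t; rewrite mulrC.
Qed.

Section Convolutions.
Context {R : realType}.
Local Notation mu := (@lebesgue_measure R).
Local Notation RR := (measurableTypeR R).
Variable sigma : R -> R[i].
Hypothesis sL : in_L2 sigma.

Let s := cext sigma.
Let ms : cmeasT (s : RR -> R[i]) := cmeasT_cext (in_L2_meas sL).
Let S2 := \int[mu]_t (cmod (s t) ^+ 2).

Let is2 : mu.-integrable setT (fun t => (cmod (s t) ^+ 2)%:E).
Proof.
have m01 : measurable (`[(0 : R), 1]%classic : set RR) by exact: measurable_itv.
have /(integrable_mkcond _ m01) := in_L2_sqr sL.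
apply: eq_integrable => // t _.
by rewrite patchE mem_setE in_itv/= /s /cext; case: ifP => // _;
  rewrite cmod0 expr0n.
Qed.

Let is1 : mu.-integrable setT (EFin \o (fun t => cmod (s t))).
Proof. exact: (integrable_cext (in_L2_integrable sL)). Qed.

Let S2_ge0 : 0 <= S2.
Proof. by apply: Rintegral_ge0 => t _; rewrite sqr_ge0. Qed.

Lemma integrable_shift (r : R -> R) (c : R) : mu.-integrable setT (EFin \o r) ->
  mu.-integrable setT (EFin \o (fun t => r (t + c))).
Proof.
move=> /integrableP[/measurable_EFinP mr ir].
have mc : measurable_fun setT ((fun x => x + c) : RR -> RR).
  by apply: measurable_funD.
apply/integrableP; split.
  by apply/measurable_EFinP; exact: (measurableT_comp mr mc).
rewrite (_ : (\int[mu]_x _)%E = (\int[mu]_x `|(r x)%:E|)%E)//.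
apply: (@ge0_integral_shift R (fun t => `|(r t)%:E|%E) c) => //.
by apply: measurableT_comp => //; exact/measurable_EFinP.
Qed.

(* A dominating function for the correlation integrand, from
   a b <= (a ^ 2 + b ^ 2) / 2; by translation invariance its integral does not
   depend on xi. *)
Let bound xi := fun eta => (cmod (s (eta + xi)) ^+ 2 + cmod (s eta) ^+ 2) / 2.

Let ibound xi : mu.-integrable setT (EFin \o bound xi).
Proof.
have := integrableD measurableT (integrable_shift xi is2) is2.
move=> /(integrableZr measurableT 2^-1).
by apply: eq_integrable.
Qed.

Let bound_int xi : \int[mu]_t bound xi t = S2.
Proof.
have i1 := integrable_shift xi is2.
rewrite /bound RintegralZr//; last by have := integrableD measurableT i1 is2.
rewrite RintegralD// [X in (X + _) / _](_ : _ = S2).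
  by rewrite -/S2; field.
rewrite /S2 /Rintegral; congr fine.
apply: (@ge0_integral_shift R (fun t => (cmod (s t) ^+ 2)%:E) xi).
  by case/integrableP : is2.
by move=> t; rewrite lee_fin sqr_ge0.
Qed.

Let m01 : measurable (`[(0 : R), 1]%classic : set RR).
Proof. exact: measurable_itv. Qed.

Let corr_le xi eta : cmod (s (xi + eta) * s eta) <= bound xi eta.
Proof.
rewrite cmodM /bound (addrC eta) ler_pdivlMr//.
have := sqr_ge0 (cmod (s (xi + eta)) - cmod (s eta)); nra.
Qed.

Let mshift (c : R) : cmeasT ((fun t => s (c + t)) : RR -> R[i]).
Proof.
apply: (@cmeasT_comp _ _ _ RR RR s (fun t => c + t)) => //.
by apply: measurable_funD.
Qed.

Let cmeasT01 (f : R -> R[i]) : cmeasT (f : RR -> R[i]) -> cmeasurable f.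
Proof. by move=> [mR mI]; split; exact: measurable_funTS. Qed.

Let icorr xi : cintegrable (fun eta => s (xi + eta) * s eta).
Proof.
apply: (@le_cintegrable _ _ (bound xi)).
- by apply: cmeasT01; apply: cmeasTM.
- exact: (integrableS measurableT m01 _ (ibound xi)).
- by move=> t _; exact: corr_le.
Qed.

Let cmod_corr xi y : y <= 1 ->
  cmod (cint (fun eta => s (xi + eta) * s eta) y) <= S2.
Proof.
move=> y1; rewrite -(bound_int xi).
have ib01 : mu.-integrable `[(0 : R), 1] (fun t => (bound xi t)%:E).
  exact: (integrableS measurableT m01 _ (ibound xi)).
apply: (le_trans (cmod_cint_le (r := bound xi) y1 (icorr xi) ib01 _)).
  by move=> t _; exact: corr_le.
have b0 t : 0 <= bound xi t by rewrite divr_ge0// addr_ge0// sqr_ge0.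
rewrite /Rintegral fine_le//.
- apply: integrable_fin_num => //; exact: (integrableS measurableT _ _ (ibound xi)).
- exact: (integrable_fin_num measurableT (ibound xi)).
- apply: ge0_subset_integral => //; first by case/integrableP : (ibound xi).
  by move=> t _; rewrite lee_fin b0.
Qed.

(* The correlation [stilde] of the extension of sigma by zero. *)
Let corr (t xi : R) : R[i] := cint (fun eta => s (xi + eta) * s eta) (t - xi).

Let mcorr : cmeasT ((fun p : R * R => corr p.1 p.2) : RR * RR -> R[i]).
Proof.
pose F (p : (R * R) * R) : R[i] :=
  if 0 <= p.2 <= p.1.1 - p.1.2 then s (p.1.2 + p.2) * s p.2 else 0.
have mF : cmeasT (F : (RR * RR) * RR -> R[i]).
  have m2 : measurable_fun setT (fun p : (RR * RR) * RR => p.2 : RR).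
    exact: measurable_snd.
  have m11 : measurable_fun setT (fun p : (RR * RR) * RR => p.1.1 : RR).
    by apply: (measurableT_comp measurable_fst); exact: measurable_fst.
  have m12 : measurable_fun setT (fun p : (RR * RR) * RR => p.1.2 : RR).
    by apply: (measurableT_comp measurable_snd); exact: measurable_fst.
  apply: cmeasT_if.
    apply: measurable_and; first exact: measurable_fun_ler.
    by apply: measurable_fun_ler => //; exact: measurable_funB.
  apply: cmeasTM.
    by apply: (@cmeasT_comp _ _ _ ((RR * RR) * RR)%type RR s
      (fun p => p.1.2 + p.2)) => //; exact: measurable_funD.
  by apply: (@cmeasT_comp _ _ _ ((RR * RR) * RR)%type RR s (fun p => p.2)).
have := @cmeasT_cintT R _ (RR * RR)%type F mF.
congr cmeasT; apply/funext => p; rewrite /corr cint_cintT.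
by apply: eq_cintT => t.
Qed.

Let stilde_corr t xi : 0 <= xi <= t -> t <= 1 -> stilde sigma t xi = corr t xi.
Proof.
move=> /andP[xi0 xit] t1; apply: eq_cint => eta /andP[eta0 etat].
rewrite /s !cextE ?eta0 ?addr_ge0//=.
- by rewrite (le_trans etat)// lerBlDr (le_trans t1)// lerDl.
- by rewrite (le_trans _ t1)//; move: etat; rewrite lerBrDl.
Qed.

Let mphase nu : cmeasT ((fun p : R * R => phase nu (p.1 - p.2)) : RR * RR -> R[i]).
Proof.
rewrite (_ : (fun p => _) = fun p : R * R => cexp ((- (2 * iu * nu)) * (p.1 - p.2)%:C%C)).
  apply: (@cmeasT_cexp R _ (RR * RR)%type _ (fun p => p.1 - p.2)).
  by apply: measurable_funB; [exact: measurable_fst|exact: measurable_snd].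
by apply/funext => p; exact: phaseE.
Qed.

(** The Fourier-type integral of [stilde] is an iterated integral with alternating
    phases: substitute t = tau + xi, the phase at t - xi splitting as a product.
    The constant c is kept inside because the left-hand integrand need not be
    known to be integrable in advance. *)
Lemma cint_stilde (c nu : R[i]) x : 0 <= x <= 1 ->
  cint (fun tau => c * phase nu tau * stilde sigma x tau) x =
  c * cint (fun t => phase nu t * sigma t *
    cint (fun xi => phase (- nu) xi * sigma xi) t) x.
Proof.
move=> x01; have /andP[x0 x1] := x01.
have ips := cintegrable_phaseM nu (in_L2_integrable sL).
have ipNs := cintegrable_phaseM (- nu) (in_L2_integrable sL).
pose E := cmod c * expR (2 * `|complex.Im nu|).
pose K (t xi : R) := c * phase nu (t - xi) * (s t * s xi).
have mK : cmeasT ((fun p : R * R => K p.1 p.2) : RR * RR -> R[i]).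
  apply: cmeasTM; [apply: cmeasTM => //; split; exact: measurable_cst|apply: cmeasTM].
  - by apply: (@cmeasT_comp _ _ _ (RR * RR)%type RR s (fun p => p.1)) => //;
      exact: measurable_fst.
  - by apply: (@cmeasT_comp _ _ _ (RR * RR)%type RR s (fun p => p.2)) => //;
      exact: measurable_snd.
have iu' : mu.-integrable setT (EFin \o (fun t => E * cmod (s t))).
  by apply: (integrableZl _ E is1).
transitivity (cint (fun tau => cint (fun xi => K (tau + xi) xi) (x - tau)) x).
  apply: eq_cint => tau /andP[tau0 taux].
  have xt1 : x - tau <= 1 by lra.
  rewrite (stilde_corr _ x1) ?tau0// /corr -(cintZl _ xt1 (icorr tau)).
  by apply: eq_cint => xi _; rewrite /K addrK.
rewrite (cint_shear x01 mK iu' is1).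
- rewrite -(cintZl _ x1); last by apply: cintegrableM => //; exact: cbounded_cint.
  apply: eq_cint => t /andP[t0 tx]; have t1 := le_trans tx x1.
  have t01 : 0 <= t <= 1 by rewrite t0.
  rewrite mulrA -(cintZl _ t1 ipNs); apply: eq_cint => xi /andP[xi0 xit].
  have xi01 : 0 <= xi <= 1 by rewrite xi0 (le_trans xit).
  by rewrite /K /s (cextE _ t01) (cextE _ xi01) phaseB; ring.
- by move=> t; rewrite !mulr_ge0 ?expR_ge0 ?cmod_ge0.
- by move=> t; exact: cmod_ge0.
- move=> t xi /andP[xi0 xit] tx; rewrite /K !cmodM mulrA ler_wpM2r ?cmod_ge0//.
  rewrite ler_wpM2r ?cmod_ge0// ler_wpM2l ?cmod_ge0//.
  by apply: cmod_phase_le => //; lra.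
Qed.

(** The same substitution, followed by the previous lemma on the inner integral. *)
Lemma cint_Nsigma (c nu : R[i]) x : 0 <= x <= 1 ->
  cint (fun tau => c * phase nu tau * Nsigma sigma x tau) x =
  c * cint (fun t => phase nu t * sigma t *
    cint (fun xi => phase (- nu) xi * sigma xi *
      cint (fun r => phase nu r * sigma r) xi) t) x.
Proof.
move=> x01; have /andP[x0 x1] := x01.
have ips := cintegrable_phaseM nu (in_L2_integrable sL).
have ipNs := cintegrable_phaseM (- nu) (in_L2_integrable sL).
pose E := cmod c * expR (2 * `|complex.Im nu|).
pose K (t xi : R) := c * phase nu (t - xi) * (s t * corr t xi).
have mK : cmeasT ((fun p : R * R => K p.1 p.2) : RR * RR -> R[i]).
  apply: cmeasTM; [apply: cmeasTM => //; split; exact: measurable_cst|].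
  apply: cmeasTM => //.
  by apply: (@cmeasT_comp _ _ _ (RR * RR)%type RR s (fun p => p.1)) => //;
    exact: measurable_fst.
have iu' : mu.-integrable setT (EFin \o (fun t => E * cmod (s t))).
  by apply: (integrableZl _ E is1).
pose v : R -> R := fun xi => S2 * (\1_(`[(0 : R), 1]%classic) xi).
have iv : mu.-integrable setT (EFin \o v).
  exact: (integrableZl measurableT S2 (@integrable_indic_itv R 0 1 true false)).
have corr_int t : 0 <= t <= 1 ->
    cintegrable (fun xi => s (t + xi) * corr (t + xi) xi).
  move=> /andP[t0 t1]; apply: (@le_cintegrable _ _ (fun xi => cmod (s (xi + t)) * S2)).
  - apply: cmeasT01; apply: cmeasTM => //.
    apply: (@cmeasT_comp _ _ _ RR (RR * RR)%type
      (fun p : R * R => corr p.1 p.2) (fun xi => (t + xi, xi))) => //.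
    by apply: measurable_fun_pair => //; apply: measurable_funD.
  - apply: (integrableS measurableT m01 (@subsetT _ _)).
    have := integrableZr measurableT S2 (integrable_shift t is1).
    by apply: eq_integrable.
  - move=> xi _; rewrite cmodM addrC ler_wpM2l ?cmod_ge0//.
    by rewrite /corr addrAC subrr add0r cmod_corr.
transitivity (cint (fun tau => cint (fun xi => K (tau + xi) xi) (x - tau)) x).
  apply: eq_cint => tau /andP[tau0 taux].
  have xt1 : x - tau <= 1 by lra.
  have tau01 : 0 <= tau <= 1 by lra.
  rewrite (_ : Nsigma sigma x tau =
      cint (fun xi => s (tau + xi) * corr (tau + xi) xi) (x - tau)); last first.
    apply: eq_cint => xi /andP[xi0 xix].
    rewrite stilde_corr; [|lra|lra].
    by rewrite /s cextE//; lra.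
  rewrite -(cintZl _ xt1 (corr_int _ tau01)).
  by apply: eq_cint => xi _; rewrite /K addrK.
rewrite (cint_shear x01 mK iu' iv).
- rewrite -(cintZl _ x1); last first.
    apply: cintegrableM => //; apply: cbounded_cint.
    by apply: cintegrableM => //; exact: cbounded_cint.
  apply: eq_cint => t /andP[t0 tx]; have t1 := le_trans tx x1.
  have t01 : 0 <= t <= 1 by rewrite t0.
  have ipc : cintegrable (fun xi => phase (- nu) xi * corr t xi).
    apply: (@le_cintegrable _ _ (fun=> expR (2 * `|complex.Im (- nu)|) * S2)).
    - apply: cmeasurableM; first by have [] := cbounded_phase (- nu).
      apply: cmeasT01; apply: (@cmeasT_comp _ _ _ RR (RR * RR)%type
        (fun p : R * R => corr p.1 p.2) (fun xi => (t, xi))) => //.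
      exact: measurable_fun_pair.
    - exact: integrable01_cst.
    - move=> xi xi01; rewrite cmodM ler_pM ?cmod_ge0//.
        exact: cmod_phase_le.
      by apply: cmod_corr; have /andP[] := xi01; lra.
  have e1 : cint (fun xi => phase (- nu) xi * corr t xi) t =
      cint (fun xi => phase (- nu) xi * sigma xi *
        cint (fun r => phase nu r * sigma r) xi) t.
    have := cint_stilde 1 (- nu) t01; rewrite mul1r opprK => <-.
    apply: eq_cint => xi /andP[xi0 xit].
    by rewrite mul1r stilde_corr// xi0.
  rewrite -e1 mulrA -(cintZl _ t1 ipc); apply: eq_cint => xi /andP[xi0 xit].
  by rewrite /K /s (cextE _ t01) phaseB; ring.
- by move=> t; rewrite !mulr_ge0 ?expR_ge0 ?cmod_ge0.
- by move=> t; rewrite mulr_ge0.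
- move=> t xi /andP[xi0 xit] tx; rewrite /K !cmodM mulrA.
  apply: ler_pM; rewrite ?mulr_ge0 ?cmod_ge0//.
    rewrite ler_wpM2r ?cmod_ge0// ler_wpM2l ?cmod_ge0//.
    by apply: cmod_phase_le => //; lra.
  rewrite /v indicE mem_set ?mulr1; last by rewrite /= in_itv/=; lra.
  by apply: cmod_corr; lra.
Qed.

End Convolutions.

(** * Truncation of the Neumann series *)

Section RemainderEstimate.
Context {R : realType}.
Local Notation leb := (@lebesgue_measure R).
Local Notation M2 := 'M[R[i]]_2.

(** Bound of an integral by an integral over the whole interval. *)
Lemma nm_mxcint_le01 (F : R -> M2) (r : R -> R) (c I x : R) : mintegrable F ->
  leb.-integrable `[(0 : R), 1] (fun t => (r t)%:E) ->
  (forall t, 0 <= t <= 1 -> 0 <= r t) -> 0 <= c ->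
  (forall t, 0 <= t <= 1 -> nm (F t) <= c * r t) ->
  \int[leb]_(t in `[0, 1]) r t <= I -> 0 <= x <= 1 ->
  nm (mxcint F x) <= c * I.
Proof.
move=> iF ir r0 c0 Fr rI x01; have /andP[x0 x1] := x01.
have icr : leb.-integrable `[(0 : R), 1] (fun t => (c * r t)%:E).
  by apply: (integrableZl _ c ir).
apply: (le_trans (nm_mxcint_le (r := fun t => c * r t) x01 iF icr _)).
  by move=> t /andP[t0 tx]; apply: Fr; rewrite t0 (le_trans tx).
rewrite RintegralZl//; last exact: (integrable_0x x1 ir).
by rewrite ler_wpM2l// (le_trans _ rI)// Rintegral_0x_le.
Qed.

Lemma nm_mxcint_le01D (F : R -> M2) (r1 r2 : R -> R) (c1 c2 I1 I2 x : R) :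
  mintegrable F ->
  leb.-integrable `[(0 : R), 1] (fun t => (r1 t)%:E) ->
  leb.-integrable `[(0 : R), 1] (fun t => (r2 t)%:E) ->
  (forall t, 0 <= t <= 1 -> 0 <= r1 t) -> (forall t, 0 <= t <= 1 -> 0 <= r2 t) ->
  0 <= c1 -> 0 <= c2 ->
  (forall t, 0 <= t <= 1 -> nm (F t) <= c1 * r1 t + c2 * r2 t) ->
  \int[leb]_(t in `[0, 1]) r1 t <= I1 -> \int[leb]_(t in `[0, 1]) r2 t <= I2 ->
  0 <= x <= 1 -> nm (mxcint F x) <= c1 * I1 + c2 * I2.
Proof.
move=> iF i1 i2 r10 r20 c10 c20 Fr h1 h2 x01.
have m01 : measurable (`[(0 : R), 1]%classic : set (measurableTypeR R)).
  exact: measurable_itv.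
have j1 : leb.-integrable `[(0 : R), 1] (fun t => (c1 * r1 t)%:E).
  exact: (integrableZl m01 c1 i1).
have j2 : leb.-integrable `[(0 : R), 1] (fun t => (c2 * r2 t)%:E).
  exact: (integrableZl m01 c2 i2).
rewrite -[leRHS]mul1r; apply: (@nm_mxcint_le01 _ (fun t => c1 * r1 t + c2 * r2 t)) => //.
- exact: (integrableD m01 j1 j2).
- by move=> t t01; rewrite addr_ge0// mulr_ge0 ?r10 ?r20.
- by move=> t t01; rewrite mul1r Fr.
- rewrite (RintegralD m01 j1 j2) (RintegralZl c1 m01 i1) (RintegralZl c2 m01 i2).
  by rewrite lerD// ler_wpM2l.
Qed.

Variables (A B : R -> M2) (s g : R -> R) (E del c S2 L G1 kap : R).
Hypotheses (iA : mintegrable A) (iB : mintegrable B).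
Hypotheses (E0 : 0 <= E) (del0 : 0 <= del) (c0 : 0 <= c).
Hypothesis A_le : forall t, 0 <= t <= 1 -> nm (A t) <= 2 * E * s t.
Hypothesis B_le : forall t, 0 <= t <= 1 -> nm (B t) <= 2 * E * del * s t ^+ 2.
Hypothesis s_ge0 : forall t, 0 <= t <= 1 -> 0 <= s t.
Hypothesis g_ge0 : forall t, 0 <= t <= 1 -> 0 <= g t.

(** The first three iterated integrals of A, and the first one of B. *)
Definition fst_int := mxcint A.
Definition snd_int := mxcint (fun t => A t *m fst_int t).
Definition trd_int := mxcint (fun t => A t *m snd_int t).
Definition per_int := mxcint B.

(** The truncated Neumann series, with the mixed second-order term replaced by
    the product of the two first-order ones. *)
Definition approx (t : R) : M2 := 1%:M + fst_int t + snd_int t + trd_int t +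
  per_int t + fst_int t *m per_int t.

(** The defect of [approx] in the integral equation. *)
Definition forcing (x : R) : M2 :=
  mxcint (fun t => A t *m trd_int t) x - mxcint (fun t => fst_int t *m B t) x +
  mxcint (fun t => A t *m (fst_int t *m per_int t)) x +
  mxcint (fun t => B t *m fst_int t) x + mxcint (fun t => B t *m snd_int t) x +
  mxcint (fun t => B t *m trd_int t) x + mxcint (fun t => B t *m per_int t) x +
  mxcint (fun t => B t *m (fst_int t *m per_int t)) x.

Let b1 : mbounded fst_int. Proof. exact: mbounded_mxcint. Qed.
Let b2 : mbounded snd_int.
Proof. by apply: mbounded_mxcint; exact: mintegrableM. Qed.
Let b3 : mbounded trd_int.
Proof. by apply: mbounded_mxcint; exact: mintegrableM. Qed.
Let bp : mbounded per_int. Proof. exact: mbounded_mxcint. Qed.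
Let b1p : mbounded (fun t => fst_int t *m per_int t).
Proof. exact: mboundedM. Qed.

Lemma mbounded_approx : mbounded approx.
Proof.
by do !apply: mboundedD => //; exact: mbounded_cst.
Qed.

Lemma mbounded_forcing : mbounded forcing.
Proof.
have bint F G : mintegrable F -> mbounded G -> mbounded (mxcint (fun t => F t *m G t)).
  by move=> iF bG; apply: mbounded_mxcint; exact: mintegrableM.
rewrite /forcing; do 6! [apply: mboundedD; last exact: bint].
by apply: mboundedB; [exact: bint|apply: mbounded_mxcint; exact: mintegrableMl].
Qed.

(** The mixed term of order one in A and in B is handled by integration by parts:
    the integral of A per_int is the product of the two first-order integrals
    minus the integral of fst_int B, which is part of the defect. *)
Lemma approx_eq x : 0 <= x <= 1 ->
  approx x + forcing x = 1%:M + mxcint (fun t => (A t + B t) *m approx t) x.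
Proof.
move=> x01; have /andP[x0 x1] := x01.
have iAM F : mbounded F -> mintegrable (fun t => A t *m F t) by exact: mintegrableM.
have iBM F : mbounded F -> mintegrable (fun t => B t *m F t) by exact: mintegrableM.
have b0 : mbounded (fun=> 1%:M : M2) by exact: mbounded_cst.
have expand (K : R -> M2) : mintegrable K ->
  mxcint (fun t => K t *m approx t) x =
  mxcint K x + mxcint (fun t => K t *m fst_int t) x +
  mxcint (fun t => K t *m snd_int t) x + mxcint (fun t => K t *m trd_int t) x +
  mxcint (fun t => K t *m per_int t) x +
  mxcint (fun t => K t *m (fst_int t *m per_int t)) x.
  move=> iK; have iKM F : mbounded F -> mintegrable (fun t => K t *m F t).
    exact: mintegrableM.
  have j1 := mintegrableD iK (iKM _ b1); have j2 := mintegrableD j1 (iKM _ b2).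
  have j3 := mintegrableD j2 (iKM _ b3); have j4 := mintegrableD j3 (iKM _ bp).
  rewrite -(mxcintD x1 iK (iKM _ b1)) -(mxcintD x1 j1 (iKM _ b2)).
  rewrite -(mxcintD x1 j2 (iKM _ b3)) -(mxcintD x1 j3 (iKM _ bp)).
  rewrite -(mxcintD x1 j4 (iKM _ b1p)); apply: eq_mxcint => t _.
  by rewrite /approx !mulmxDr mulmx1.
have -> : mxcint (fun t => (A t + B t) *m approx t) x =
    mxcint (fun t => A t *m approx t) x + mxcint (fun t => B t *m approx t) x.
  rewrite -(mxcintD x1 (iAM _ mbounded_approx) (iBM _ mbounded_approx)).
  by apply: eq_mxcint => t _; rewrite mulmxDl.
pose f1 := fst_int x; pose f2 := snd_int x; pose f3 := trd_int x; pose p := per_int x.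
pose a3 := mxcint (fun t => A t *m trd_int t) x.
pose ap := mxcint (fun t => A t *m per_int t) x.
pose fB := mxcint (fun t => fst_int t *m B t) x.
pose a1p := mxcint (fun t => A t *m (fst_int t *m per_int t)) x.
pose q1 := mxcint (fun t => B t *m fst_int t) x.
pose q2 := mxcint (fun t => B t *m snd_int t) x.
pose q3 := mxcint (fun t => B t *m trd_int t) x.
pose qp := mxcint (fun t => B t *m per_int t) x.
pose q1p := mxcint (fun t => B t *m (fst_int t *m per_int t)) x.
have eA : mxcint (fun t => A t *m approx t) x = f1 + f2 + f3 + a3 + ap + a1p.
  exact: (expand A iA).
have eB : mxcint (fun t => B t *m approx t) x = p + q1 + q2 + q3 + qp + q1p.
  exact: (expand B iB).
have bypart : f1 *m p = ap + fB by exact: mxcint_byparts.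
have eapp : approx x = 1%:M + f1 + f2 + f3 + p + f1 *m p := erefl.
have efor : forcing x = a3 - fB + a1p + q1 + q2 + q3 + qp + q1p := erefl.
rewrite eA eB eapp efor bypart.
clearbody f1 f2 f3 p a3 ap fB a1p q1 q2 q3 qp q1p.
by apply/matrixP => i j; rewrite !mxE; ring.
Qed.

Hypothesis a_le : forall t, 0 <= t <= 1 -> nm (fst_int t) <= g t.
Hypothesis is_ : leb.-integrable `[(0 : R), 1] (fun t => (s t)%:E).
Hypothesis is2 : leb.-integrable `[(0 : R), 1] (fun t => (s t ^+ 2)%:E).
Hypothesis isg : leb.-integrable `[(0 : R), 1] (fun t => (s t * g t)%:E).
Hypothesis isg2 : leb.-integrable `[(0 : R), 1] (fun t => (s t * g t ^+ 2)%:E).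
Hypothesis is2g : leb.-integrable `[(0 : R), 1] (fun t => (s t ^+ 2 * g t)%:E).
Hypothesis s_int : \int[leb]_(t in `[0, 1]) s t <= c.
Hypothesis s2_int : \int[leb]_(t in `[0, 1]) (s t ^+ 2) <= S2.
Hypothesis sg_int : \int[leb]_(t in `[0, 1]) (s t * g t) <= L.
Hypothesis sg2_int : \int[leb]_(t in `[0, 1]) (s t * g t ^+ 2) <= G1.
Hypothesis s2g_int : \int[leb]_(t in `[0, 1]) (s t ^+ 2 * g t) <= kap.

Let L0 : 0 <= L.
Proof.
apply: le_trans sg_int; apply: Rintegral_ge0 => t; rewrite /= in_itv/= => t01.
by rewrite mulr_ge0 ?s_ge0 ?g_ge0.
Qed.

Let G10 : 0 <= G1.
Proof.
apply: le_trans sg2_int; apply: Rintegral_ge0 => t; rewrite /= in_itv/= => t01.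
by rewrite mulr_ge0 ?s_ge0 ?sqr_ge0.
Qed.

Let S20 : 0 <= S2.
Proof. by apply: le_trans s2_int; apply: Rintegral_ge0 => t _; rewrite sqr_ge0. Qed.

Let b := 2 * E * del * S2.
Let al2 := 2 * E * L.

Let Ed0 : 0 <= 2 * E * del. Proof. by rewrite !mulr_ge0. Qed.
Let E20 : 0 <= 2 * E. Proof. by rewrite mulr_ge0. Qed.
Let b0 : 0 <= b. Proof. by rewrite mulr_ge0. Qed.
Let al20 : 0 <= al2. Proof. by rewrite mulr_ge0. Qed.
Let s2_ge0 t : 0 <= t <= 1 -> 0 <= s t ^+ 2. Proof. by rewrite sqr_ge0. Qed.
Let sg_ge0 t : 0 <= t <= 1 -> 0 <= s t * g t.
Proof. by move=> t01; rewrite mulr_ge0 ?s_ge0 ?g_ge0. Qed.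
Let s2g_ge0 t : 0 <= t <= 1 -> 0 <= s t ^+ 2 * g t.
Proof. by move=> t01; rewrite mulr_ge0 ?sqr_ge0 ?g_ge0. Qed.

Let nmM_le (P Q : M2) (p q : R) : nm P <= p -> nm Q <= q -> nm (P *m Q) <= p * q.
Proof.
by move=> Pp Qq; rewrite (le_trans (nmM _ _))// ler_pM// nm_ge0.
Qed.

Lemma per_le x : 0 <= x <= 1 -> nm (per_int x) <= b.
Proof. exact: (nm_mxcint_le01 iB is2 s2_ge0 Ed0 B_le s2_int). Qed.

Lemma snd_le x : 0 <= x <= 1 -> nm (snd_int x) <= al2.
Proof.
apply: (nm_mxcint_le01 (mintegrableM iA b1) isg sg_ge0 E20 _ sg_int) => t t01.
by rewrite mulrA nmM_le ?A_le ?a_le.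
Qed.

Lemma trd_le x : 0 <= x <= 1 -> nm (trd_int x) <= 2 * E * al2 * c.
Proof.
apply: (nm_mxcint_le01 (mintegrableM iA b2) is_ s_ge0 _ _ s_int) => [|t t01].
  by rewrite mulr_ge0.
by rewrite mulrAC nmM_le ?A_le ?snd_le.
Qed.

(** Integration by parts exhibits a factor [g] in the third-order term, up to an
    error controlled by the integral of [s * g ^+ 2]. *)
Lemma trd_le_g x : 0 <= x <= 1 -> nm (trd_int x) <= g x * al2 + 2 * E * G1.
Proof.
move=> x01.
have e : fst_int x *m snd_int x =
    trd_int x + mxcint (fun t => fst_int t *m (A t *m fst_int t)) x.
  by apply: mxcint_byparts => //; exact: mintegrableM.
have -> : trd_int x = fst_int x *m snd_int x -
    mxcint (fun t => fst_int t *m (A t *m fst_int t)) x by rewrite e addrK.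
rewrite (le_trans (nmB _ _))// lerD//; first by rewrite nmM_le ?a_le ?snd_le.
apply: (nm_mxcint_le01 _ isg2 _ E20 _ sg2_int x01) => [|t t01|t t01].
- by apply: mintegrableMl => //; exact: mintegrableM.
- by rewrite mulr_ge0 ?s_ge0 ?sqr_ge0.
- have -> : 2 * E * (s t * g t ^+ 2) = g t * (2 * E * s t * g t) by ring.
  by rewrite nmM_le ?a_le// nmM_le ?A_le ?a_le.
Qed.

Lemma forcing_le x : 0 <= x <= 1 -> nm (forcing x) <=
  (2 * E * al2 * L + 2 * E * (2 * E * G1) * c) + 2 * E * del * kap +
  2 * E * b * L + 2 * E * del * kap + 2 * E * del * al2 * S2 +
  2 * E * del * (2 * E * al2 * c) * S2 + 2 * E * del * b * S2 +
  2 * E * del * b * kap.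
Proof.
move=> x01.
have T1 : nm (mxcint (fun t => A t *m trd_int t) x) <=
    2 * E * al2 * L + 2 * E * (2 * E * G1) * c.
  apply: (nm_mxcint_le01D (mintegrableM iA b3) isg is_ sg_ge0 s_ge0 _ _ _
    sg_int s_int x01) => [||t t01]; rewrite ?mulr_ge0//.
  have -> : 2 * E * al2 * (s t * g t) + 2 * E * (2 * E * G1) * s t =
    2 * E * s t * (g t * al2 + 2 * E * G1) by ring.
  by rewrite nmM_le ?A_le ?trd_le_g.
have T2 : nm (mxcint (fun t => fst_int t *m B t) x) <= 2 * E * del * kap.
  apply: (nm_mxcint_le01 (mintegrableMl b1 iB) is2g s2g_ge0 Ed0 _ s2g_int x01).
  move=> t t01; have -> : 2 * E * del * (s t ^+ 2 * g t) =
    g t * (2 * E * del * s t ^+ 2) by ring.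
  by rewrite nmM_le ?a_le ?B_le.
have T3 : nm (mxcint (fun t => A t *m (fst_int t *m per_int t)) x) <= 2 * E * b * L.
  apply: (nm_mxcint_le01 (mintegrableM iA b1p) isg sg_ge0 _ _ sg_int x01).
    by rewrite mulr_ge0.
  move=> t t01; have -> : 2 * E * b * (s t * g t) =
    2 * E * s t * (g t * b) by ring.
  by rewrite nmM_le ?A_le// nmM_le ?a_le ?per_le.
have T4 : nm (mxcint (fun t => B t *m fst_int t) x) <= 2 * E * del * kap.
  apply: (nm_mxcint_le01 (mintegrableM iB b1) is2g s2g_ge0 Ed0 _ s2g_int x01).
  by move=> t t01; rewrite mulrA nmM_le ?a_le ?B_le.
have TB (P : R -> M2) p : mbounded P -> 0 <= p ->
    (forall t, 0 <= t <= 1 -> nm (P t) <= p) ->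
    nm (mxcint (fun t => B t *m P t) x) <= 2 * E * del * p * S2.
  move=> bP p0 Pp.
  apply: (nm_mxcint_le01 (mintegrableM iB bP) is2 s2_ge0 _ _ s2_int x01).
    by rewrite mulr_ge0.
  by move=> t t01; rewrite mulrAC nmM_le ?B_le ?Pp.
have T5 := TB _ _ b2 al20 snd_le.
have T6 : nm (mxcint (fun t => B t *m trd_int t) x) <=
    2 * E * del * (2 * E * al2 * c) * S2.
  by apply: (TB _ _ b3 _ trd_le); rewrite !mulr_ge0.
have T7 := TB _ _ bp b0 per_le.
have T8 : nm (mxcint (fun t => B t *m (fst_int t *m per_int t)) x) <=
    2 * E * del * b * kap.
  apply: (nm_mxcint_le01 (mintegrableM iB b1p) is2g s2g_ge0 _ _ s2g_int x01).
    by rewrite mulr_ge0.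
  move=> t t01; have -> : 2 * E * del * b * (s t ^+ 2 * g t) =
    2 * E * del * s t ^+ 2 * (g t * b) by ring.
  by rewrite nmM_le ?B_le// nmM_le ?a_le ?per_le.
have D (P Q : M2) p q : nm P <= p -> nm Q <= q -> nm (P + Q) <= p + q.
  by move=> Pp Qq; rewrite (le_trans (nmD _ _))// lerD.
have Bd (P Q : M2) p q : nm P <= p -> nm Q <= q -> nm (P - Q) <= p + q.
  by move=> Pp Qq; rewrite (le_trans (nmB _ _))// lerD.
exact: (D _ _ _ _ (D _ _ _ _ (D _ _ _ _ (D _ _ _ _ (D _ _ _ _ (D _ _ _ _
  (Bd _ _ _ _ T1 T2) T3) T4) T5) T6) T7) T8).
Qed.

End RemainderEstimate.

(** * Factorization of the explicit matrix W *)

Section Factorization.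
Context {R : realType}.
Local Notation M2 := 'M[R[i]]_2.
Implicit Types (sigma : R -> R[i]) (mu nu : R[i]).

(** The off-diagonal part, of first order in sigma, of the system satisfied in the
    variables where the free evolution has been factored out. *)
Definition dirac_mx sigma mu (t : R) : M2 :=
  mx2 0 (- (phase mu t * sigma t)) (- (phase (- mu) t * sigma t)) 0.

(** The part of that system that is quadratic in sigma and of size 1 / |mu|. *)
Definition pert_mx sigma mu (t : R) : M2 :=
  (iu / (2 * mu)) *: (sigma t ^+ 2 *: mx2 1 (phase mu t) (- phase (- mu) t) (-1)).

(** A fundamental matrix of the free equation for the vector formed by y and
    its quasi-derivative divided by i mu. *)
Definition frame mu (x : R) : M2 :=
  mx2 (cexp (iu * mu * x%:C%C)) (cexp (- (iu * mu * x%:C%C)))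
      (cexp (iu * mu * x%:C%C)) (- cexp (- (iu * mu * x%:C%C))).

(** The iterated integrals of sigma against phases of alternating sign. *)
Definition osc1 sigma nu := cint (fun t => phase nu t * sigma t).
Definition osc2 sigma nu := cint (fun t => phase nu t * sigma t * osc1 sigma (- nu) t).
Definition osc3 sigma nu := cint (fun t => phase nu t * sigma t * osc2 sigma (- nu) t).

Lemma cint_cst0 (x : R) : x <= 1 -> cint (fun=> 0 : R[i]) x = 0.
Proof.
move=> x1; have := cintZl 0 x1 (cbounded_integrable (cbounded_phase (0 : R[i]))).
by rewrite mul0r => e; rewrite -[RHS]e; apply: eq_cint => s _; rewrite mul0r.
Qed.

Lemma mxcint_diag (f g : R -> R[i]) x : x <= 1 ->
  mxcint (fun t => mx2 (f t) 0 0 (g t)) x = mx2 (cint f x) 0 0 (cint g x).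
Proof. by move=> x1; rewrite mxcint_mx2 (cint_cst0 x1). Qed.

Lemma mxcint_antidiag (f g : R -> R[i]) x : x <= 1 ->
  cintegrable f -> cintegrable g ->
  mxcint (fun t => mx2 0 (- f t) (- g t) 0) x =
  mx2 0 (- cint f x) (- cint g x) 0.
Proof.
by move=> x1 fi gi; rewrite mxcint_mx2 (cintN x1 fi) (cintN x1 gi) (cint_cst0 x1).
Qed.

Lemma cexp_split nu (x t : R) :
  cexp (iu * nu * (x - 2 * t)%:C%C) = cexp (iu * nu * x%:C%C) * phase nu t.
Proof.
rewrite /phase -cexpD; congr cexp.
by rewrite rmorphB rmorphM/= (rmorph_nat (real_complex R) 2); ring.
Qed.

Lemma qf_phase sigma nu x : in_L2 sigma -> 0 <= x <= 1 ->
  qf sigma x nu =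
  - (cexp (iu * nu * x%:C%C) * osc1 sigma nu x).
Proof.
move=> sL /andP[x0 x1]; rewrite /qf; congr (- _).
rewrite -(cintZl _ x1 (cintegrable_phaseM nu (in_L2_integrable sL))).
by apply: eq_cint => t _; rewrite cexp_split mulrA.
Qed.

Lemma d1_phase sigma nu x : in_L2 sigma -> 0 <= x <= 1 ->
  d1 sigma x nu = cexp (iu * nu * x%:C%C) * osc2 sigma nu x.
Proof.
move=> sL x01; rewrite -(cint_stilde sL _ nu x01).
by apply: eq_cint => t _; rewrite cexp_split.
Qed.

Lemma d2_phase sigma nu x : in_L2 sigma -> 0 <= x <= 1 ->
  d2 sigma x nu = - (cexp (iu * nu * x%:C%C) *
    (osc1 sigma nu x + osc3 sigma nu x)).
Proof.
move=> sL x01; rewrite /d2 (qf_phase nu sL x01) mulrDr opprD; congr (_ - _).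
rewrite /osc3 /osc2 opprK -(cint_Nsigma sL _ nu x01).
by apply: eq_cint => t _; rewrite cexp_split.
Qed.

(** W is the frame times the truncated Neumann series: [d1] comes from the second
    iterated integral of [dirac_mx], [d2] from the first and the third, and the
    two explicit terms in sigma ^ 2 from [per_int] and from its product with
    [fst_int]. *)
Lemma W_factor sigma mu x : in_L2 sigma -> 0 <= x <= 1 ->
  W sigma x mu = frame mu x *m approx (dirac_mx sigma mu) (pert_mx sigma mu) x.
Proof.
move=> sL x01; have /andP[x0 x1] := x01.
have si := in_L2_integrable sL.
have ip nu := cintegrable_phaseM nu si.
have io2 nu : cintegrable (fun t => phase nu t * sigma t * osc1 sigma (- nu) t).
  by apply: cintegrableM (ip nu) _; exact: cbounded_cint.
have io3 nu : cintegrable (fun t => phase nu t * sigma t * osc2 sigma (- nu) t).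
  by apply: cintegrableM (ip nu) _; exact: cbounded_cint.
have a1E t : 0 <= t <= 1 -> fst_int (dirac_mx sigma mu) t =
    mx2 0 (- osc1 sigma mu t) (- osc1 sigma (- mu) t) 0.
  by move=> /andP[t0 t1]; exact: (mxcint_antidiag t1 (ip mu) (ip (- mu))).
have a2E t : 0 <= t <= 1 -> snd_int (dirac_mx sigma mu) t =
    mx2 (osc2 sigma mu t) 0 0 (osc2 sigma (- mu) t).
  move=> /andP[t0 t1].
  transitivity (mxcint (fun t => mx2
      (phase mu t * sigma t * osc1 sigma (- mu) t) 0 0
      (phase (- mu) t * sigma t * osc1 sigma (- - mu) t)) t); last first.
    exact: (mxcint_diag _ _ t1).
  apply: eq_mxcint => s /andP[s0 st]; rewrite a1E ?s0 ?(le_trans st)// opprK.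
  by rewrite /dirac_mx mx2M; congr mx2; ring.
have a3E : trd_int (dirac_mx sigma mu) x =
    mx2 0 (- osc3 sigma mu x) (- osc3 sigma (- mu) x) 0.
  transitivity (mxcint (fun t => mx2 0
      (- (phase mu t * sigma t * osc2 sigma (- mu) t))
      (- (phase (- mu) t * sigma t * osc2 sigma (- - mu) t)) 0) x); last first.
    exact: (mxcint_antidiag x1 (io3 mu) (io3 (- mu))).
  apply: eq_mxcint => s /andP[s0 st]; rewrite a2E ?s0 ?(le_trans st)// opprK.
  by rewrite /dirac_mx mx2M; congr mx2; ring.
have ePN : cexp (iu * - mu * x%:C%C) = cexp (- (iu * mu * x%:C%C)).
  by congr cexp; ring.
pose c : R[i] := iu / (2 * mu).
pose J : M2 := mxcint (fun t => sigma t ^+ 2 *: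
  mx2 1 (phase mu t) (- phase (- mu) t) (-1)) x.
have iJ : mintegrable (fun t => sigma t ^+ 2 *:
  mx2 1 (phase mu t) (- phase (- mu) t) (-1)).
  have is2 := in_L2_integrable_sqr sL.
  have b4 : mbounded (fun t => mx2 1 (phase mu t) (- phase (- mu) t) (-1)).
    apply: mbounded_mx2.
    - exact: cbounded_cst.
    - exact: cbounded_phase.
    - exact: cboundedN (cbounded_phase _).
    - exact: cbounded_cst.
  exact: mintegrable_scale.
have p1E : per_int (pert_mx sigma mu) x = c *: J.
  by rewrite -(mxcintZ c x1 iJ).
have T3 : mxcint (fun t => sigma t ^+ 2 *:
    (frame mu x *m mx2 1 (phase mu t) (- phase (- mu) t) (-1))) x = frame mu x *m J.
  rewrite -(mxcintMl (frame mu x) x1 iJ).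
  by apply: eq_mxcint => t _; rewrite scalemxAr.
have T4 : mx2 (qf sigma x (- mu)) (qf sigma x mu)
              (- qf sigma x (- mu)) (qf sigma x mu) =
    frame mu x *m fst_int (dirac_mx sigma mu) x.
  rewrite a1E// (qf_phase _ sL x01) (qf_phase _ sL x01) ePN /frame mx2M.
  by congr mx2; ring.
have T2 : mx2 (d1 sigma x mu + d2 sigma x (- mu)) (d2 sigma x mu + d1 sigma x (- mu))
              (d1 sigma x mu - d2 sigma x (- mu)) (d2 sigma x mu - d1 sigma x (- mu)) =
    frame mu x *m fst_int (dirac_mx sigma mu) x + frame mu x *m snd_int (dirac_mx sigma mu) x +
    frame mu x *m trd_int (dirac_mx sigma mu) x.
  rewrite !(d1_phase _ sL x01) !(d2_phase _ sL x01) ePN a1E// a2E// a3E.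
  by rewrite /frame !mx2M !mx2D; congr mx2; ring.
have addE (U V U' V' : M2) : U = U' -> V = V' -> U + V = U' + V' by move=> -> ->.
have WE : W sigma x mu = frame mu x +
    mx2 (d1 sigma x mu + d2 sigma x (- mu)) (d2 sigma x mu + d1 sigma x (- mu))
        (d1 sigma x mu - d2 sigma x (- mu)) (d2 sigma x mu - d1 sigma x (- mu)) +
    c *: (frame mu x *m J) +
    c *: (mx2 (qf sigma x (- mu)) (qf sigma x mu)
              (- qf sigma x (- mu)) (qf sigma x mu) *m J).
  rewrite -T3; apply: (addE _ _ _ _); first apply: (addE _ _ _ _); first by [].
    apply: (f_equal (fun V : M2 => c *: V)); apply: eq_mxcint => t _.
    rewrite /frame mx2M phaseN; apply: (f_equal (fun V : M2 => sigma t ^+ 2 *: V)).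
    by rewrite !mulr1 !mulrN1 !mulrN !mulNr !opprK.
  apply: (f_equal (fun V : M2 => c *: (_ *m V))); apply: eq_mxcint => t _.
  by rewrite phaseN.
rewrite WE T4 T2 /approx p1E !mulmxDr mulmx1 -!scalemxAr mulmxA.
by rewrite !addrA.
Qed.

End Factorization.

(** * Solutions of the equation as solutions of a Volterra equation *)

Section Solutions.
Context {R : realType}.
Local Notation leb := (@lebesgue_measure R).
Implicit Types (f g p q sigma y : R -> R[i]) (mu : R[i]).

Lemma rabs_Re f : abs_continuous01 f ->
  rabs_continuous01 (fun x => complex.Re (f x)).
Proof.
move=> acf e e0; have [del del0 H] := acf e e0; exists del => // n u v uv tuv suv.
apply: le_lt_trans (H n u v uv tuv suv); apply: ler_sum => i _.
by rewrite -cReN -cReD Re_le_cmod.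
Qed.

Lemma rabs_Im f : abs_continuous01 f ->
  rabs_continuous01 (fun x => complex.Im (f x)).
Proof.
move=> acf e e0; have [del del0 H] := acf e e0; exists del => // n u v uv tuv suv.
apply: le_lt_trans (H n u v uv tuv suv); apply: ler_sum => i _.
by rewrite -cImN -cImD Im_le_cmod.
Qed.

Lemma rabs_continuous01_within (f : R -> R) : rabs_continuous01 f ->
  {within `[(0 : R), 1], continuous f}.
Proof.
move=> acf.
have unif e : 0 < e -> exists2 del, 0 < del & forall u v, 0 <= u -> u <= v -> v <= 1 ->
    v - u < del -> `|f v - f u| < e.
  move=> e0; have [del del0 H] := acf e e0; exists del => // u v u0 uv v1 d.
  have := H 1%N (fun=> u) (fun=> v); rewrite !big_ord1; apply => //.
  - by move=> _; rewrite u0 uv v1.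
  - by move=> i j _ _ _; rewrite !ord1.
apply/continuous_within_itvP => //; split.
- move=> x; rewrite in_itv/= => /andP[x0 x1]; apply/cvgrPdist_lt => e e0.
  have [del del0 H] := unif e e0; near=> t.
  have t0 : 0 < t by near: t; exact: lt_nbhsr.
  have t1 : t < 1 by near: t; exact: lt_nbhsl.
  have td : `|x - t| < del by near: t; apply: (@nbhsx_ballx _ R^o); exact: del0.
  have [xt|tx] := leP x t.
    by rewrite distrC H// ?ltW//; move: td; rewrite ler0_norm ?subr_le0//; lra.
  by rewrite H// ?ltW//; move: td; rewrite gtr0_norm ?subr_gt0//; lra.
- apply/cvgrPdist_lt => e e0; have [del del0 H] := unif e e0; near=> t.
  have t0 : 0 < t by near: t; exact: nbhs_right_gt.
  have t1 : t < Num.min 1 del by near: t; apply: nbhs_right_lt; rewrite lt_min ltr01.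
  move: t1; rewrite lt_min => /andP[t1 td].
  by rewrite distrC H// ?ltW// subr0.
- apply/cvgrPdist_lt => e e0; have [del del0 H] := unif e e0; near=> t.
  have t1 : t < 1 by near: t; exact: nbhs_left_lt.
  have t0 : Num.max 0 (1 - del) < t.
    by near: t; apply: nbhs_left_gt; rewrite gt_max ltr01 ltrBlDr ltrDl.
  move: t0; rewrite gt_max => /andP[t0 td].
  by rewrite H// ?ltW//; lra.
Unshelve. all: by end_near. Qed.

Lemma abs_continuous_bounded f : abs_continuous01 f -> cbounded f.
Proof.
move=> acf; apply: cont01_cbounded; split; apply: rabs_continuous01_within.
- exact: rabs_Re.
- exact: rabs_Im.
Qed.

(** The complex form of the fundamental theorem. *)
Lemma abs_continuous_cFTC f g x : abs_continuous01 f -> cintegrable g ->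
  {ae leb, forall t : R, 0 < t < 1 -> is_cderive f t (g t)} ->
  0 <= x <= 1 -> f x = f 0 + cint g x.
Proof.
move=> acf [gR gI] df x01; apply: complex_ext; rewrite ?cReD ?cImD /=.
- apply: (abs_continuous_FTC (rabs_Re acf) gR) => //.
  move: df; apply: filterS; first exact: (ae_filter_ringOfSetsType leb).
  by move=> t dt t01; have [] := dt t01.
- apply: (abs_continuous_FTC (rabs_Im acf) gI) => //.
  move: df; apply: filterS; first exact: (ae_filter_ringOfSetsType leb).
  by move=> t dt t01; have [] := dt t01.
Qed.

(** Leibniz rule in integrated form. *)
Lemma cint_prod P Q p q x : cintegrable p -> cintegrable q ->
  (forall t, 0 <= t <= 1 -> P t = P 0 + cint p t) ->
  (forall t, 0 <= t <= 1 -> Q t = Q 0 + cint q t) -> 0 <= x <= 1 ->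
  P x * Q x = P 0 * Q 0 + cint (fun t => p t * Q t + P t * q t) x.
Proof.
move=> ip iq Pp Qq x01; have /andP[x0 x1] := x01.
have i1 : cintegrable (fun t => p t * cint q t).
  by apply: cintegrableM ip _; exact: cbounded_cint.
have i2 : cintegrable (fun t => cint p t * q t).
  rewrite (_ : (fun t => _) = fun t => q t * cint p t).
    by apply: cintegrableM iq _; exact: cbounded_cint.
  by apply/funext => t; rewrite mulrC.
have -> : cint (fun t => p t * Q t + P t * q t) x =
    cint (fun t => (p t * cint q t + cint p t * q t) + (Q 0 * p t + P 0 * q t)) x.
  apply: eq_cint => t /andP[t0 tx]; have t01 : 0 <= t <= 1 by rewrite t0 (le_trans tx).
  by rewrite (Pp _ t01) (Qq _ t01); ring.
have j1 := cintegrableZl (Q 0) ip; have j2 := cintegrableZl (P 0) iq.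
rewrite (cintD x1 (cintegrableD i1 i2) (cintegrableD j1 j2)).
rewrite (cintD x1 i1 i2) (cintD x1 j1 j2) (cintZl _ x1 ip) (cintZl _ x1 iq).
rewrite -(cint_byparts x01 ip iq) (Pp _ x01) (Qq _ x01); ring.
Qed.

Lemma is_cderive_cexp (z : R[i]) (x : R) :
  is_cderive (fun t => cexp (z * t%:C%C)) x (z * cexp (z * x%:C%C)).
Proof.
case: z => a b.
have E (t : R) : cexp ((a +i* b)%C * t%:C%C) =
    ((expR (a * t) * cos (b * t)) +i* (expR (a * t) * sin (b * t)))%C.
  by rewrite /cexp/= !mulr0 subr0 add0r.
have dl (c : R) : is_derive x 1 (fun t : R => c * t) c.
  have := @is_deriveZ R R R id c x 1 1 (is_derive_id x 1).
  by rewrite /GRing.scale/= mulr1.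
have de : is_derive x 1 (fun t : R => expR (a * t)) (expR (a * x) * a).
  exact: (is_derive1_comp (is_derive_expR _) (dl a)).
have dc : is_derive x 1 (fun t : R => cos (b * t)) (- sin (b * x) * b).
  exact: (is_derive1_comp (is_derive_cos _) (dl b)).
have ds : is_derive x 1 (fun t : R => sin (b * t)) (cos (b * x) * b).
  exact: (is_derive1_comp (is_derive_sin _) (dl b)).
rewrite /is_cderive; split.
- have -> : (fun t : R => complex.Re (cexp ((a +i* b)%C * t%:C%C))) =
    (fun t => expR (a * t)) * (fun t => cos (b * t)).
    by apply/funext => t; rewrite E.
  apply: is_derive_eq (is_deriveM de dc) _.
  by rewrite E cReM/= /GRing.scale/=; ring.
- have -> : (fun t : R => complex.Im (cexp ((a +i* b)%C * t%:C%C))) =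
    (fun t => expR (a * t)) * (fun t => sin (b * t)).
    by apply/funext => t; rewrite E.
  apply: is_derive_eq (is_deriveM de ds) _.
  by rewrite E cImM/= /GRing.scale/=; ring.
Qed.

(** The exponential as a primitive of its derivative. *)
Lemma cexp_cint (z : R[i]) (x : R) : 0 <= x <= 1 ->
  cexp (z * x%:C%C) = 1 + cint (fun t => z * cexp (z * t%:C%C)) x.
Proof.
move=> /andP[]; rewrite le_eqVlt => /predU1P[<- _|x0 x1].
  by rewrite cint0 addr0 mulr0 cexp0.
have [cR cI] := cont01M (cont01_cst z) (cont01_cexp z).
have [eR eI] := cont01_cexp z.
have sub : `[0, x]%classic `<=` `[(0 : R), 1]%classic by exact: sub_0x_01.
have aux (F f : R -> R) : {within `[(0 : R), 1], continuous F} ->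
    {within `[(0 : R), 1], continuous f} ->
    (forall t : R, is_derive t 1 F (f t)) -> \int[leb]_(t in `[0, x]) f t = F x - F 0.
  move=> cF cf dF; rewrite /Rintegral (@continuous_FTC2 _ f F 0 x x0).
  - by rewrite -EFinB.
  - exact: (continuous_subspaceW sub).
  - have [_ l r] : derivable_oo_LRcontinuous F 0 x.
      have := (continuous_within_itvP F x0).1 (continuous_subspaceW sub cF).
      by case=> h l r; split => // t _; have [] := dF t.
    by split => // t _; have [] := dF t.
  - by move=> t _; rewrite derive1E; have [_ ->] := dF t.
rewrite -[1](_ : cexp (z * 0%:C%C) = 1); last by rewrite mulr0 cexp0.
apply: complex_ext; rewrite ?cReD ?cImD/=.
- by rewrite (aux _ _ eR cR (fun t => (is_cderive_cexp z t).1)) addrC subrK.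
- by rewrite (aux _ _ eI cI (fun t => (is_cderive_cexp z t).2)) addrC subrK.
Qed.

(** Once the frame is factored out, a solution satisfies a Volterra equation with
    integrable kernel.  The unknown vector is the first column of [Y], whose
    second column is zero. *)
Lemma solution_Volterra sigma mu y y1 : in_L2 sigma -> mu != 0 ->
  is_solution sigma mu y y1 ->
  exists Y : R -> 'M[R[i]]_2, [/\ mbounded Y,
    forall x, 0 <= x <= 1 -> Y x =
      mx2 (2^-1 * (y 0 + (iu * mu)^-1 * y1 0)) 0
          (2^-1 * (y 0 - (iu * mu)^-1 * y1 0)) 0 +
      mxcint (fun t => (dirac_mx sigma mu t + pert_mx sigma mu t) *m Y t) x &
    forall x, frame mu x *m Y x = mx2 (y x) 0 ((iu * mu)^-1 * y1 x) 0].
Proof.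
move=> sL mu0 [acy acy1 qd eq1].
have i2 : (2 : R[i]) != 0 by rewrite pnatr_eq0.
have by_ := abs_continuous_bounded acy; have by1 := abs_continuous_bounded acy1.
have si := in_L2_integrable sL; have s2i := in_L2_integrable_sqr sL.
pose k := (iu * mu)^-1; have kE : k * (iu * mu) = 1.
  by rewrite mulVf// mulf_neq0// iu_neq0.
(* The two identities on k = 1 / (i mu) used to bring the system in the form
   of [dirac_mx] and [pert_mx]. *)
have kmu2 : k * mu ^+ 2 + iu * mu = 0.
  have -> : iu * mu = - (k * (iu * mu)) * (iu ^+ 2 * (iu * mu)).
    by rewrite kE sqr_iu; ring.
  have -> : - (k * (iu * mu)) * (iu ^+ 2 * (iu * mu)) = - (k * mu ^+ 2) * (iu ^+ 2) ^+ 2.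
    by ring.
  by rewrite sqr_iu; ring.
have ck : iu / (2 * mu) = - (2^-1 * k).
  have iuV : (iu : R[i])^-1 = - iu.
    by apply: (mulfI iu_neq0); rewrite mulrN -expr2 sqr_iu opprK divff// iu_neq0.
  have -> : k = - iu / mu by rewrite /k invfM iuV.
  by rewrite invfM; ring.
pose dy t := y1 t - sigma t * y t.
pose dy1 t := sigma t * y1 t - sigma t ^+ 2 * y t - mu ^+ 2 * y t.
have idy : cintegrable dy.
  by apply: cintegrableB; [exact: cbounded_integrable|exact: cintegrableM].
have idy1 : cintegrable dy1.
  apply: cintegrableB; first by apply: cintegrableB; exact: cintegrableM.
  by apply: cintegrableZl; exact: cbounded_integrable.
have yE t : 0 <= t <= 1 -> y t = y 0 + cint dy t.
  apply: (abs_continuous_cFTC acy idy); move: qd.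
  apply: filterS; first exact: (ae_filter_ringOfSetsType leb).
  move=> u h u01; have [d du e] := h u01.
  by rewrite /dy e addrK.
have y1E t : 0 <= t <= 1 -> y1 t = y1 0 + cint dy1 t.
  apply: (abs_continuous_cFTC acy1 idy1); move: eq1.
  apply: filterS; first exact: (ae_filter_ringOfSetsType leb).
  move=> u h u01; have [d du e] := h u01.
  rewrite (_ : dy1 u = d)//; apply/eqP; rewrite eq_sym -subr_eq0.
  by apply/eqP; rewrite -[RHS]e /dy1; ring.
(* e = 1 and e = -1 give the two components in the basis diagonalizing the free
   system, and [w] factors out their free evolution. *)
pose v e t := 2^-1 * (y t + e * k * y1 t).
pose dv e t := 2^-1 * (dy t + e * k * dy1 t).
have idv e : cintegrable (dv e).
  by apply: cintegrableZl; apply: cintegrableD => //; exact: cintegrableZl.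
have vE e t : 0 <= t <= 1 -> v e t = v e 0 + cint (dv e) t.
  move=> t01; have /andP[t0 t1] := t01; rewrite /v /dv (cintZl _ t1); last first.
    by apply: cintegrableD => //; exact: cintegrableZl.
  rewrite (cintD t1 idy (cintegrableZl _ idy1)) (cintZl _ t1 idy1).
  by rewrite (yE _ t01) (y1E _ t01); ring.
pose p e t := cexp (- (e * (iu * mu)) * t%:C%C).
pose dp e t := - (e * (iu * mu)) * p e t.
have idp e : cintegrable (dp e).
  by apply: cintegrableZl; apply: cbounded_integrable; apply: cont01_cbounded;
     exact: cont01_cexp.
have pE e t : 0 <= t <= 1 -> p e t = p e 0 + cint (dp e) t.
  by move=> t01; rewrite /p cexp_cint// mulr0 cexp0.
pose w e t := p e t * v e t.
have p0 e : p e 0 = 1 by rewrite /p mulr0 cexp0.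
have wE e t : 0 <= t <= 1 -> w e t = v e 0 + cint (fun t => dp e t * v e t + p e t * dv e t) t.
  by move=> t01; rewrite /w (cint_prod (idp e) (idv e) (pE e) (vE e) t01) p0 mul1r.
exists (fun t => mx2 (w 1 t) 0 (w (-1) t) 0); split.
- have bw e : cbounded (w e).
    apply: cboundedM; first by apply: cont01_cbounded; exact: cont01_cexp.
    apply: cboundedM; first exact: cbounded_cst.
    by apply: cboundedD => //; apply: cboundedM => //; exact: cbounded_cst.
  by apply: mbounded_mx2 => //; exact: cbounded_cst.
- move=> x x01; have /andP[x0 x1] := x01.
  have half : 2^-1 + 2^-1 = 1 :> R[i] by rewrite -mulr2n -[_ *+ 2]mulr_natl divff.
  have ph1 t : phase mu t * p (-1) t = p 1 t.
    by rewrite phaseE /p -cexpD; congr cexp; ring.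
  have ph2 t : phase (- mu) t * p 1 t = p (-1) t.
    by rewrite phaseE /p -cexpD; congr cexp; ring.
  have A1 t : dp 1 t * v 1 t + p 1 t * dv 1 t =
      p 1 t * (- sigma t * v (-1) t - 2^-1 * k * sigma t ^+ 2 * y t).
    apply/eqP; rewrite -subr_eq0; apply/eqP.
    transitivity (p 1 t * (- (2^-1 * y1 t) * (k * (iu * mu) - 1) -
        2^-1 * y t * (k * mu ^+ 2 + iu * mu))); last by rewrite kE kmu2 subrr; ring.
    by rewrite /dp /v /dv /dy /dy1; ring.
  have A2 t : dp (-1) t * v (-1) t + p (-1) t * dv (-1) t =
      p (-1) t * (- sigma t * v 1 t + 2^-1 * k * sigma t ^+ 2 * y t).
    apply/eqP; rewrite -subr_eq0; apply/eqP.
    transitivity (p (-1) t * (- (2^-1 * y1 t) * (k * (iu * mu) - 1) +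
        2^-1 * y t * (k * mu ^+ 2 + iu * mu))); last by rewrite kE kmu2 subrr; ring.
    by rewrite /dp /v /dv /dy /dy1; ring.
  have yv t : y t = v 1 t + v (-1) t.
    transitivity ((2^-1 + 2^-1) * y t); first by rewrite half mul1r.
    by rewrite /v; ring.
  transitivity (mx2 (v 1 0) 0 (v (-1) 0) 0 +
    mxcint (fun t => mx2 (dp 1 t * v 1 t + p 1 t * dv 1 t) 0
                         (dp (-1) t * v (-1) t + p (-1) t * dv (-1) t) 0) x).
    by rewrite mxcint_mx2 (cint_cst0 x1) mx2D addr0 (wE _ _ x01) (wE _ _ x01).
  congr (_ + _).
    by rewrite /v mul1r mulN1r mulNr.
  apply: eq_mxcint => t _; rewrite A1 A2 /dirac_mx /pert_mx ck !mx2Z mx2D mx2M.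
  congr mx2; rewrite ?mulr0 ?addr0 ?add0r//.
  + rewrite /w yv; transitivity (- (2^-1 * k) * sigma t ^+ 2 * (p 1 t * v 1 t) +
      (- sigma t - 2^-1 * k * sigma t ^+ 2) * (phase mu t * p (-1) t) * v (-1) t).
      by rewrite ph1; ring.
    by ring.
  + rewrite /w yv; transitivity (2^-1 * k * sigma t ^+ 2 * (p (-1) t * v (-1) t) +
      (- sigma t + 2^-1 * k * sigma t ^+ 2) * (phase (- mu) t * p 1 t) * v 1 t).
      by rewrite ph2; ring.
    by ring.
- move=> x; rewrite /frame mx2M.
  have half : 2^-1 + 2^-1 = 1 :> R[i] by rewrite -mulr2n -[_ *+ 2]mulr_natl divff.
  have e1 : cexp (iu * mu * x%:C%C) * p 1 x = 1.
    by rewrite /p -cexpD -[RHS]cexp0; congr cexp; ring.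
  have e2 : cexp (- (iu * mu * x%:C%C)) * p (-1) x = 1.
    by rewrite /p -cexpD -[RHS]cexp0; congr cexp; ring.
  rewrite !mulr0 !addr0 /w mulNr !mulrA e1 e2 !mul1r.
  congr mx2.
  + transitivity ((2^-1 + 2^-1) * y x); last by rewrite half mul1r.
    by rewrite /v; ring.
  + rewrite -/k; transitivity ((2^-1 + 2^-1) * (k * y1 x)); last by rewrite half mul1r.
    by rewrite /v; ring.
Qed.

End Solutions.

(** * Size of the oscillatory integrals *)

Section SizeEstimates.
Context {R : realType}.
Local Notation leb := (@lebesgue_measure R).
Implicit Types (sigma : R -> R[i]) (mu : R[i]).

Let m01 : measurable (`[(0 : R), 1]%classic : set (measurableTypeR R)).
Proof. exact: measurable_itv. Qed.

(** An integrable function times a bounded measurable one. *)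
Lemma integrable01M (r h : R -> R) (M : R) :
  leb.-integrable `[(0 : R), 1] (fun t => (r t)%:E) ->
  measurable_fun `[(0 : R), 1] h -> (forall t, 0 <= t <= 1 -> 0 <= h t <= M) ->
  leb.-integrable `[(0 : R), 1] (fun t => (r t * h t)%:E).
Proof.
move=> ir mh hM.
have mr : measurable_fun `[(0 : R), 1] r.
  by apply/measurable_EFinP; exact: (measurable_int _ ir).
have iMr := integrableZl m01 M ir.
apply: (le_integrable m01 _ _ iMr).
  by apply/measurable_EFinP; exact: measurable_funM.
move=> t /in01P t01; rewrite lee_fin !normrM mulrC ler_wpM2r//.
by have /andP[h0 hMt] := hM _ t01; rewrite ger0_norm// (le_trans hMt)// ler_norm.
Qed.

Lemma expint_osc sigma mu t : expint sigma mu t = osc1 sigma (- mu) t.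
Proof. by apply: eq_cint => u _; rewrite phaseN. Qed.

Lemma cbounded_expint sigma mu : in_L2 sigma -> cbounded (expint sigma mu).
Proof.
move=> sL; rewrite (_ : expint sigma mu = osc1 sigma (- mu)).
  exact: (cbounded_cint (cintegrable_phaseM (- mu) (in_L2_integrable sL))).
by apply/funext => t; exact: expint_osc.
Qed.

Lemma gamma0_ge0 sigma mu t : 0 <= gamma0 sigma t mu.
Proof. by rewrite mulr_ge0// addr_ge0// cmod_ge0. Qed.

Lemma gamma0_bounded sigma mu : in_L2 sigma ->
  exists M, forall t, 0 <= t <= 1 -> 0 <= gamma0 sigma t mu <= M.
Proof.
move=> sL; have [_ [M1 H1]] := cbounded_expint (- mu) sL.
have [_ [M2 H2]] := cbounded_expint mu sL.
exists (2 * (M1 + M2)) => t t01.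
rewrite gamma0_ge0 /=; apply: ler_wpM2l => //.
by apply: lerD; [exact: H1|exact: H2].
Qed.

Lemma measurable_gamma0 sigma mu : in_L2 sigma ->
  measurable_fun `[(0 : R), 1] (fun t => gamma0 sigma t mu).
Proof.
move=> sL; apply: measurable_funM => //; apply: measurable_funD.
  by apply: cmeasurable_cmod; case: (cbounded_expint (- mu) sL).
by apply: cmeasurable_cmod; case: (cbounded_expint mu sL).
Qed.

Lemma integrable_gamma0M sigma mu (r : R -> R) : in_L2 sigma ->
  leb.-integrable `[(0 : R), 1] (fun t => (r t)%:E) ->
  leb.-integrable `[(0 : R), 1] (fun t => (r t * gamma0 sigma t mu)%:E).
Proof.
move=> sL ir; have [M HM] := gamma0_bounded mu sL.
exact: integrable01M ir (measurable_gamma0 mu sL) HM.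
Qed.

Lemma integrable_gamma0_sqr sigma mu : in_L2 sigma ->
  leb.-integrable `[(0 : R), 1] (fun t => (gamma0 sigma t mu ^+ 2)%:E).
Proof.
move=> sL; have := integrable_gamma0M mu sL (integrable_gamma0M mu sL (integrable01_cst 1)).
by apply: eq_integrable => // t _; rewrite mul1r expr2.
Qed.

Lemma gamma_ge0 sigma mu : 0 <= gamma sigma mu.
Proof. by rewrite mulr_ge0// addr_ge0// L2norm_ge0. Qed.

Lemma gamma0_sqr_int sigma mu : in_L2 sigma ->
  \int[leb]_(t in `[0, 1]) (gamma0 sigma t mu ^+ 2) <= 2 * gamma sigma mu ^+ 2.
Proof.
move=> sL.
have isq nu : leb.-integrable `[(0 : R), 1]
    (fun t => (cmod (expint sigma nu t) ^+ 2)%:E).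
  have bf := cbounded_expint nu sL.
  have := cintegrable_cmod (cintegrableM (cbounded_integrable bf) bf).
  by apply: eq_integrable => // t _; rewrite cmodM expr2.
have i8 := integrableZl m01 8 (integrableD m01 (isq (- mu)) (isq mu)).
apply: (@le_trans _ _ (\int[leb]_(t in `[0, 1])
    (8 * (cmod (expint sigma (- mu) t) ^+ 2 + cmod (expint sigma mu t) ^+ 2)))).
  apply: (le_Rintegral m01 (integrable_gamma0_sqr mu sL) i8) => t _.
  rewrite /gamma0; set u := cmod _; set v := cmod _.
  by have := sqr_ge0 (u - v); nra.
rewrite (RintegralZl 8 m01 (integrableD m01 (isq (- mu)) (isq mu))).
rewrite (RintegralD m01 (isq (- mu)) (isq mu)) -(L2norm_sqr (isq (- mu))).
rewrite -(L2norm_sqr (isq mu)) /gamma.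
have := L2norm_ge0 (expint sigma (- mu)); have := L2norm_ge0 (expint sigma mu).
by set u := L2norm _; set v := L2norm _ => u0 v0; have := mulr_ge0 u0 v0; nra.
Qed.

(** A form of the Cauchy-Schwarz inequality, from the inequality between the
    arithmetic and geometric means with a weight [lam] decreasing to [gamma]. *)
Lemma sigma_gamma0_int sigma mu : in_L2 sigma ->
  \int[leb]_(t in `[0, 1]) (cmod (sigma t) * gamma0 sigma t mu) <=
  (L2norm sigma ^+ 2 + 1) * gamma sigma mu.
Proof.
move=> sL; set S := L2norm sigma ^+ 2.
have S0 : 0 <= S by rewrite sqr_ge0.
have g0 := gamma_ge0 sigma mu; set g := gamma sigma mu in g0 *.
have is2 := in_L2_sqr sL; have ig2 := integrable_gamma0_sqr mu sL.
have isg := integrable_gamma0M mu sL (cintegrable_cmod (in_L2_integrable sL)).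
have key lam : g < lam ->
    \int[leb]_(t in `[0, 1]) (cmod (sigma t) * gamma0 sigma t mu) <= (S + 1) * lam.
  move=> glam; have lam0 : 0 < lam by exact: le_lt_trans glam.
  have j1 := integrableZl m01 (lam / 2) is2.
  have j2 := integrableZl m01 (lam^-1 / 2) ig2.
  apply: (@le_trans _ _ (\int[leb]_(t in `[0, 1]) (lam / 2 * cmod (sigma t) ^+ 2 +
      lam^-1 / 2 * gamma0 sigma t mu ^+ 2))).
    apply: (le_Rintegral m01 isg (integrableD m01 j1 j2)) => t _.
    set u := cmod _; set v := gamma0 _ _ _.
    have : 0 <= lam^-1 / 2 * (lam * u - v) ^+ 2.
      by rewrite mulr_ge0 ?sqr_ge0// divr_ge0// invr_ge0 ltW.
    have -> : lam^-1 / 2 * (lam * u - v) ^+ 2 =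
      lam / 2 * u ^+ 2 + lam^-1 / 2 * v ^+ 2 - u * v.
      by field; rewrite gt_eqF.
    by rewrite subr_ge0.
  rewrite (RintegralD m01 j1 j2) (RintegralZl _ m01 is2) (RintegralZl _ m01 ig2).
  rewrite -(L2norm_sqr is2) -/S.
  have h : lam^-1 / 2 * (2 * g ^+ 2) <= lam.
    have -> : lam^-1 / 2 * (2 * g ^+ 2) = g ^+ 2 / lam by field; rewrite gt_eqF.
    by rewrite ler_pdivrMr// -expr2 lerXn2r ?nnegrE ?(ltW lam0) ?(ltW glam).
  have h2 : lam^-1 / 2 * \int[leb]_(t in `[0, 1]) (gamma0 sigma t mu ^+ 2) <=
      lam^-1 / 2 * (2 * g ^+ 2).
    by rewrite ler_wpM2l ?gamma0_sqr_int// divr_ge0// invr_ge0 ltW.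
  have := mulr_ge0 S0 (ltW lam0); nra.
apply/ler_addgt0Pr => e e0.
have S1 : 0 < S + 1 by lra.
have := key (g + e / (S + 1)); rewrite ltrDl divr_gt0// => /(_ isT).
by rewrite mulrDr [X in _ + X]mulrC divfK// gt_eqF.
Qed.

Lemma sigma_gamma0_sqr_int sigma mu : in_L2 sigma ->
  leb.-integrable `[(0 : R), 1]
    (fun t => (cmod (sigma t) * gamma0 sigma t mu ^+ 2)%:E) /\
  \int[leb]_(t in `[0, 1]) (cmod (sigma t) * gamma0 sigma t mu ^+ 2) <=
  gamma1 sigma mu.
Proof.
move=> sL; split.
  have := integrable_gamma0M mu sL (integrable_gamma0M mu sL
    (cintegrable_cmod (in_L2_integrable sL))).
  by apply: eq_integrable => // t _; rewrite expr2 mulrA.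
rewrite /gamma1 ler_peMl ?ler1n//; apply: Rintegral_ge0 => t _.
by rewrite mulr_ge0 ?sqr_ge0 ?cmod_ge0.
Qed.

(** The arithmetic behind the bound of the defect by [rho]. *)
Lemma defect_arith (E c S2 del ga G1 kap : R) : 1 <= E -> 1 <= c ->
  0 <= S2 -> S2 <= c -> 0 <= del -> 0 <= ga -> 0 <= G1 -> 0 <= kap ->
  2 * E * del * S2 <= 1 ->
  (2 * E * (2 * E * (c * ga)) * (c * ga) + 2 * E * (2 * E * G1) * c) +
  2 * E * del * kap + 2 * E * (2 * E * del * S2) * (c * ga) +
  2 * E * del * kap + 2 * E * del * (2 * E * (c * ga)) * S2 +
  2 * E * del * (2 * E * (2 * E * (c * ga)) * c) * S2 +
  2 * E * del * (2 * E * del * S2) * S2 +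
  2 * E * del * (2 * E * del * S2) * kap <=
  12 * (E ^+ 3 * c ^+ 3) * (ga ^+ 2 + G1 + del * kap + del ^+ 2).
Proof.
move=> E1 c1 S0 Sc d0 g0 G0 k0 b1.
have E0 : 0 <= E by lra. have c0 : 0 <= c by lra.
pose X := E ^+ 3 * c ^+ 3.
have X1 : E ^+ 2 * c ^+ 2 <= X.
  by rewrite /X ler_pM ?exprn_ge0// ler_weXn2l.
have X2 : E <= X.
  rewrite /X -[leLHS]mulr1 ler_pM// ?exprn_ege1//.
  by rewrite -[leLHS]expr1 ler_weXn2l.
have X3 : E ^+ 2 * c <= X.
  by rewrite /X ler_pM ?exprn_ge0// ?ler_weXn2l// -[leLHS]expr1 ler_weXn2l.
have dg : 2 * (del * ga) <= ga ^+ 2 + del ^+ 2.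
  by have := sqr_ge0 (ga - del); nra.
have dg0 : 0 <= del * ga by rewrite mulr_ge0.
have dk0 : 0 <= del * kap by rewrite mulr_ge0.
have X0 : 0 <= X by rewrite (le_trans E0).
have cS : c * S2 <= c ^+ 2 by rewrite expr2 ler_wpM2l.
have t1 : 2 * E * (2 * E * (c * ga)) * (c * ga) <= 4 * X * ga ^+ 2.
  have -> : 2 * E * (2 * E * (c * ga)) * (c * ga) = 4 * (E ^+ 2 * c ^+ 2) * ga ^+ 2 by ring.
  by rewrite ler_wpM2r ?sqr_ge0// ler_wpM2l.
have t2 : 2 * E * (2 * E * G1) * c <= 4 * X * G1.
  have -> : 2 * E * (2 * E * G1) * c = 4 * (E ^+ 2 * c) * G1 by ring.
  by rewrite ler_wpM2r// ler_wpM2l.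
have t3 : 2 * E * del * kap <= 2 * X * (del * kap).
  by rewrite -mulrA ler_wpM2r// ler_wpM2l.
have ES : E ^+ 2 * (c * S2) <= X.
  by rewrite (le_trans _ X1)// ler_wpM2l// sqr_ge0.
have t4 : 2 * E * (2 * E * del * S2) * (c * ga) <= 2 * X * (ga ^+ 2 + del ^+ 2).
  have -> : 2 * E * (2 * E * del * S2) * (c * ga) =
    2 * (E ^+ 2 * (c * S2)) * (2 * (del * ga)) by ring.
  by rewrite ler_pM ?mulr_ge0 ?exprn_ge0// ler_wpM2l.
have t6 : 2 * E * del * (2 * E * (c * ga)) * S2 <= 2 * X * (ga ^+ 2 + del ^+ 2).
  by rewrite (_ : 2 * E * del * _ * _ = 2 * E * (2 * E * del * S2) * (c * ga)); last ring.
have ES3 : E ^+ 3 * (c ^+ 2 * S2) <= X.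
  by rewrite /X ler_wpM2l ?exprn_ge0// [in leRHS]exprSr ler_wpM2l ?exprn_ge0.
have t7 : 2 * E * del * (2 * E * (2 * E * (c * ga)) * c) * S2 <=
    4 * X * (ga ^+ 2 + del ^+ 2).
  have -> : 2 * E * del * (2 * E * (2 * E * (c * ga)) * c) * S2 =
    4 * (E ^+ 3 * (c ^+ 2 * S2)) * (2 * (del * ga)) by ring.
  by rewrite ler_pM ?mulr_ge0 ?exprn_ge0// ler_wpM2l.
have SS : S2 ^+ 2 <= c ^+ 2 by rewrite lerXn2r.
have t8 : 2 * E * del * (2 * E * del * S2) * S2 <= 4 * X * del ^+ 2.
  have -> : 2 * E * del * (2 * E * del * S2) * S2 =
    4 * (E ^+ 2 * S2 ^+ 2) * del ^+ 2 by ring.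
  rewrite ler_wpM2r ?sqr_ge0// ler_wpM2l// (le_trans _ X1)//.
  by rewrite ler_wpM2l ?sqr_ge0.
have t9 : 2 * E * del * (2 * E * del * S2) * kap <= 2 * X * (del * kap).
  apply: le_trans t3; rewrite mulrAC ler_piMr// !mulr_ge0//.
rewrite -/X.
have Xg : 0 <= X * ga ^+ 2 by rewrite mulr_ge0 ?sqr_ge0.
have XG : 0 <= X * G1 by rewrite mulr_ge0.
have Xk : 0 <= X * (del * kap) by rewrite mulr_ge0.
have Xd : 0 <= X * del ^+ 2 by rewrite mulr_ge0 ?sqr_ge0.
by lra.
Qed.

End SizeEstimates.

(** * The remainder *)

Section MainEstimate.
Context {R : realType}.
Local Notation leb := (@lebesgue_measure R).
Local Notation M2 := 'M[R[i]]_2.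
Implicit Types (sigma : R -> R[i]) (mu : R[i]).

Lemma nm_dirac_mx sigma mu (d t : R) : strip d mu -> 0 <= t <= 1 ->
  nm (dirac_mx sigma mu t) <= 2 * expR (2 * d) * cmod (sigma t).
Proof.
move=> mud t01; rewrite nm_mx2 cmod0 add0r addr0 !cmodN !cmodM -mulrDl.
rewrite ler_wpM2r ?cmod_ge0// mulrDl mul1r lerD ?(cmod_phase_le _ t01)//.
by case: (mu) mud => a b; rewrite /strip/= normrN.
Qed.

Lemma nm_pert_mx sigma mu (d t : R) : strip d mu -> 0 <= d -> 0 <= t <= 1 ->
  nm (pert_mx sigma mu t) <=
  2 * expR (2 * d) * (cmod mu)^-1 * cmod (sigma t) ^+ 2.
Proof.
move=> mud d0 t01.
have e1 : cmod (phase mu t) <= expR (2 * d) by exact: cmod_phase_le.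
have e2 : cmod (phase (- mu) t) <= expR (2 * d).
  by apply: cmod_phase_le => //; case: (mu) mud => a b; rewrite /strip/= normrN.
have e0 : 1 <= expR (2 * d) by rewrite -expR0 ler_expR mulr_ge0.
rewrite /pert_mx !nmZ nm_mx2 !cmodN cmod1 cmodM cmodV cmod_iu mul1r cmodM.
have -> : cmod (2 : R[i]) = 2.
  by rewrite -(rmorph_nat (real_complex R) 2) cmod_real ger0_norm.
rewrite invfM expr2 cmodM -expr2.
set E := expR _ in e0 e1 e2 *; set k := (cmod mu)^-1.
have -> : 2 * E * k * cmod (sigma t) ^+ 2 =
    2^-1 * k * (cmod (sigma t) ^+ 2 * (4 * E)) by field.
apply: ler_wpM2l; first by rewrite mulr_ge0// /k invr_ge0 cmod_ge0.
by apply: ler_wpM2l; rewrite ?sqr_ge0//; lra.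
Qed.

Lemma nm_fst_int sigma mu t : in_L2 sigma -> 0 <= t <= 1 ->
  nm (fst_int (dirac_mx sigma mu) t) <= gamma0 sigma t mu.
Proof.
move=> sL /andP[t0 t1].
have ip nu := cintegrable_phaseM nu (in_L2_integrable sL).
have -> : fst_int (dirac_mx sigma mu) t =
    mx2 0 (- osc1 sigma mu t) (- osc1 sigma (- mu) t) 0.
  exact: (mxcint_antidiag t1 (ip mu) (ip (- mu))).
rewrite nm_mx2 cmod0 add0r addr0 !cmodN /gamma0 !expint_osc opprK.
by apply: ler_peMl; rewrite ?addr_ge0 ?cmod_ge0// ler1n.
Qed.

Lemma cmod_cexp_frame mu (d x : R) : strip d mu -> 0 <= d -> 0 <= x <= 1 ->
  cmod (cexp (iu * mu * x%:C%C)) <= expR (2 * d) /\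
  cmod (cexp (- (iu * mu * x%:C%C))) <= expR (2 * d).
Proof.
move=> mud d0 /andP[x0 x1].
have : `|complex.Im mu * x| <= 2 * d.
  rewrite normrM (ger0_norm x0) (@le_trans _ _ d)//; last by lra.
  by rewrite (le_trans _ mud)// ler_piMr.
rewrite ler_norml => /andP[h1 h2]; rewrite !cmod_cexp !ler_expR cReN.
have -> : complex.Re (iu * mu * x%:C%C) = - (complex.Im mu * x).
  by rewrite cReM !cReM !cImM/=; ring.
by split; lra.
Qed.

Lemma nm_frame mu (d x : R) : strip d mu -> 0 <= d -> 0 <= x <= 1 ->
  nm (frame mu x) <= 4 * expR (2 * d).
Proof.
move=> mud d0 x01; have [h1 h2] := cmod_cexp_frame mud d0 x01.
by rewrite nm_mx2 cmodN; lra.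
Qed.

Lemma mintegrable_dirac_mx sigma mu : in_L2 sigma ->
  mintegrable (dirac_mx sigma mu).
Proof.
move=> sL; have ip nu := cintegrable_phaseM nu (in_L2_integrable sL).
apply: mintegrable_mx2; try exact: cintegrableN;
  exact: cbounded_integrable (cbounded_cst 0).
Qed.

Lemma mintegrable_pert_mx sigma mu : in_L2 sigma ->
  mintegrable (pert_mx sigma mu).
Proof.
move=> sL; apply: mintegrableZ; apply: mintegrable_scale.
  exact: in_L2_integrable_sqr.
apply: mbounded_mx2.
- exact: cbounded_cst.
- exact: cbounded_phase.
- exact: cboundedN (cbounded_phase _).
- exact: cbounded_cst.
Qed.

(** The constant of the estimate: 12 E ^ 3 c ^ 3 rho bounds the defect, the factor 8
    and the exponential come from [volterra_exists], 4 E bounds the frame, and 4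
    counts the entries; here E = exp (2 d) and c = s ^ 2 + 1. *)
Definition remainder_const (d s : R) : R :=
  4 * (4 * expR (2 * d) * (8 * (12 * (expR (2 * d) ^+ 3 * (s ^+ 2 + 1) ^+ 3)) *
  expR (2 * expR (2 * d) * (s ^+ 2 + 1) + 1))).

Lemma remainder_const_gt0 d s : 0 < remainder_const d s.
Proof.
have s0 : 0 < s ^+ 2 + 1 by have := sqr_ge0 s; lra.
have X0 : 0 < expR (2 * d) ^+ 3 * (s ^+ 2 + 1) ^+ 3.
  by apply: mulr_gt0; rewrite exprn_gt0// expR_gt0.
apply: mulr_gt0 => //; apply: mulr_gt0.
  by apply: mulr_gt0 => //; exact: expR_gt0.
by apply: mulr_gt0; rewrite ?expR_gt0//; do 2! apply: mulr_gt0 => //.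
Qed.

(** The only use of the lower bound on |mu|: mu is nonzero, and the integral of the
    quadratic part of the kernel is at most 1. *)
Lemma OmegaP d sigma mu : Omega d sigma mu -> in_L2 sigma ->
  [/\ strip d mu, 0 < cmod mu &
      2 * expR (2 * d) * (cmod mu)^-1 * L2norm sigma ^+ 2 <= 1].
Proof.
move=> [mud hb] sL.
have S0 := sqr_ge0 (L2norm sigma); set S := L2norm sigma ^+ 2 in S0 *.
have L10 : 0 <= L1norm sigma by rewrite fine_ge0// Lnorm_ge0.
have bS : S <= bconst sigma.
  rewrite /bconst -/S ler_peMr// exprn_ege1// -addrA lerDl.
  by rewrite addr_ge0// mulr_ge0// expR_ge0.
have E0 := expR_ge0 (2 * d).
have b0 : 0 <= 2 * bconst sigma * expR (2 * d).
  by rewrite mulr_ge0// mulr_ge0// (le_trans S0).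
have m0 : 0 < cmod mu by exact: le_lt_trans hb.
split => //; rewrite mulrAC ler_pdivrMr// mul1r (le_trans _ (ltW hb))//.
by rewrite mulrAC ler_wpM2r// ler_wpM2l.
Qed.

Lemma MC01norm_le (A : R -> M2) (b : R) :
  (forall x, 0 <= x <= 1 -> nm (A x) <= b) -> MC01norm A <= 4 * b.
Proof.
move=> Ab.
have L i j : sup [set cmod (A x i j) | x in `[(0 : R), 1]] <= b.
  apply: ge_sup.
    by exists (cmod (A 0 i j)), 0 => //; rewrite /= in_itv/= lexx ler01.
  move=> _ [x /in01P x01 <-]; exact: le_trans (cmod_le_nm _ _ _) (Ab x x01).
rewrite /MC01norm !big_ord_recl !big_ord0 !addr0.
rewrite (le_trans (lerD (lerD (L _ _) (L _ _)) (lerD (L _ _) (L _ _))))//; lra.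
Qed.

Lemma in_MC01D (F G : R -> M2) : in_MC01 F -> in_MC01 G ->
  in_MC01 (fun x => F x + G x).
Proof.
move=> cF cG i j; rewrite (_ : (fun x => _) = fun x => F x i j + G x i j).
  exact: cont01D.
by apply/funext => x; rewrite mxE.
Qed.

Lemma in_MC01N (F : R -> M2) : in_MC01 F -> in_MC01 (fun x => - F x).
Proof.
move=> cF i j; rewrite (_ : (fun x => _) = fun x => -1 * F x i j).
  by apply: cont01M => //; exact: cont01_cst.
by apply/funext => x; rewrite mxE mulN1r.
Qed.

Lemma in_MC01M (F G : R -> M2) : in_MC01 F -> in_MC01 G ->
  in_MC01 (fun x => F x *m G x).
Proof.
move=> cF cG i j; rewrite (_ : (fun x => _) = fun x =>
    F x i ord0 * G x ord0 j + F x i ord_max * G x ord_max j).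
  by apply: cont01D; exact: cont01M.
apply/funext => x; rewrite mxE !big_ord_recl big_ord0 addr0.
by rewrite (_ : lift ord0 ord0 = ord_max)//; exact/val_inj.
Qed.

Lemma in_MC01_mxcint (F : R -> M2) : mintegrable F -> in_MC01 (mxcint F).
Proof.
move=> iF i j; rewrite (_ : (fun x => _) = cint (fun t => F t i j)).
  exact: cont01_cint.
by apply/funext => x; rewrite mxcintE.
Qed.

Lemma in_MC01_frame mu : in_MC01 (frame mu).
Proof.
have c1 : cont01 (fun x : R => cexp (iu * mu * x%:C%C)) by exact: cont01_cexp.
have c2 : cont01 (fun x : R => cexp (- (iu * mu * x%:C%C))).
  rewrite (_ : (fun x => _) = fun x : R => cexp ((- (iu * mu)) * x%:C%C)).
    exact: cont01_cexp.
  by apply/funext => x; rewrite mulNr.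
have c3 : cont01 (fun x : R => - cexp (- (iu * mu * x%:C%C))).
  rewrite (_ : (fun x => _) = fun x : R => -1 * cexp (- (iu * mu * x%:C%C))).
    by apply: cont01M => //; exact: cont01_cst.
  by apply/funext => x; rewrite mulN1r.
move=> i j; rewrite (_ : (fun x => _) = fun x : R =>
  if i == ord0 then (if j == ord0 then cexp (iu * mu * x%:C%C)
                     else cexp (- (iu * mu * x%:C%C)))
  else (if j == ord0 then cexp (iu * mu * x%:C%C)
        else - cexp (- (iu * mu * x%:C%C)))).
  by case: (i == ord0); case: (j == ord0).
by apply/funext => x; rewrite mxE.
Qed.

Lemma in_MC01_forcing (A B : R -> M2) : mintegrable A -> mintegrable B ->
  in_MC01 (forcing A B).
Proof.
move=> iA iB.
have b1 : mbounded (fst_int A) by exact: mbounded_mxcint.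
have b2 : mbounded (snd_int A) by apply: mbounded_mxcint; exact: mintegrableM.
have b3 : mbounded (trd_int A) by apply: mbounded_mxcint; exact: mintegrableM.
have bp : mbounded (per_int B) by exact: mbounded_mxcint.
have b1p : mbounded (fun t => fst_int A t *m per_int B t) by exact: mboundedM.
have cint_ (F G : R -> M2) : mintegrable F -> mbounded G -> in_MC01 (mxcint (fun t => F t *m G t)).
  by move=> iF bG; apply: in_MC01_mxcint; exact: mintegrableM.
rewrite /forcing; do 6! [apply: in_MC01D; last exact: cint_].
apply: in_MC01D; first exact: cint_.
apply: (in_MC01N (F := mxcint (fun t => fst_int A t *m B t))).
by apply: in_MC01_mxcint; exact: mintegrableMl.
Qed.

(** The remainder for a fixed mu, obtained by solving the Volterra equation whose
    inhomogeneity is the defect of the truncated series. *)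
Lemma remainder_exists sigma (d : R) mu : in_L2 sigma -> 0 < d ->
  Omega d sigma mu -> exists W0 : R -> M2,
  [/\ forall (c1 c2 : R[i]) (y y1 : R -> R[i]),
        is_solution sigma mu y y1 -> y 0 = c1 -> y1 0 = c2 ->
        forall x : R, 0 <= x <= 1 ->
          cv2 (y x) ((iu * mu)^-1 * y1 x) =
          W sigma x mu *m c0vec c1 c2 mu + W0 x *m c0vec c1 c2 mu,
      in_MC01 W0 &
      MC01norm W0 <= remainder_const d (L2norm sigma) * rho sigma mu].
Proof.
move=> sL d0 Om; have [mud mu0 bS] := OmegaP Om sL.
set A := dirac_mx sigma mu; set B := pert_mx sigma mu.
have iA : mintegrable A by exact: mintegrable_dirac_mx.
have iB : mintegrable B by exact: mintegrable_pert_mx.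
set E := expR (2 * d) in bS; set S := L2norm sigma ^+ 2 in bS.
have E1 : 1 <= E by rewrite -expR0 ler_expR mulr_ge0// ltW.
have E0 : 0 <= E by lra.
have S0 : 0 <= S by rewrite sqr_ge0.
set del := (cmod mu)^-1 in bS; have del0 : 0 <= del by rewrite invr_ge0 ltW.
have c0 : 0 <= S + 1 by lra.
pose s t := cmod (sigma t); pose g t := gamma0 sigma t mu.
have A_le t : 0 <= t <= 1 -> nm (A t) <= 2 * E * s t by exact: nm_dirac_mx.
have B_le t : 0 <= t <= 1 -> nm (B t) <= 2 * E * del * s t ^+ 2.
  by apply: nm_pert_mx => //; exact: ltW.
have a_le t : 0 <= t <= 1 -> nm (fst_int A t) <= g t by exact: nm_fst_int.
have s_ge0 t : 0 <= t <= 1 -> 0 <= s t by rewrite cmod_ge0.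
have g_ge0 t : 0 <= t <= 1 -> 0 <= g t by rewrite gamma0_ge0.
have is1 := cintegrable_cmod (in_L2_integrable sL).
have is2 := in_L2_sqr sL.
have isg := integrable_gamma0M mu sL is1.
have is2g := integrable_gamma0M mu sL is2.
have [isg2 sg2] := sigma_gamma0_sqr_int mu sL.
have s_int : \int[leb]_(t in `[0, 1]) s t <= S + 1 by exact: cint_L1_le.
have s2_int : \int[leb]_(t in `[0, 1]) (s t ^+ 2) <= S by rewrite -(L2norm_sqr is2).
have sg_int := sigma_gamma0_int mu sL.
have k_int : \int[leb]_(t in `[0, 1]) (s t ^+ 2 * g t) <= ksigma2 sigma mu by [].
have G0 : 0 <= gamma1 sigma mu.
  rewrite mulr_ge0//; apply: Rintegral_ge0 => t _.
  by rewrite mulr_ge0 ?sqr_ge0 ?cmod_ge0.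
have k0 : 0 <= ksigma2 sigma mu.
  by apply: Rintegral_ge0 => t _; rewrite mulr_ge0 ?sqr_ge0 ?gamma0_ge0.
pose X := E ^+ 3 * (S + 1) ^+ 3; pose Phi := 12 * X * rho sigma mu.
have F_le t : 0 <= t <= 1 -> nm (forcing A B t) <= Phi.
  move=> t01; apply: (le_trans (forcing_le iA iB E0 del0 c0 A_le B_le s_ge0 g_ge0
    a_le is1 is2 isg isg2 is2g s_int s2_int sg_int sg2 k_int t01)).
  rewrite /Phi /X /rho -/del -exprVn -/del.
  apply: (@defect_arith R E (S + 1) S del (gamma sigma mu) (gamma1 sigma mu)
    (ksigma2 sigma mu)) => //; [by rewrite lerDr|by rewrite lerDl|exact: gamma_ge0].
have bF := mbounded_forcing iA iB.
pose K t := A t + B t; pose m t := 2 * E * s t + 2 * E * del * s t ^+ 2.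
have iK : mintegrable K by exact: mintegrableD.
have m01 : measurable (`[(0 : R), 1]%classic : set (measurableTypeR R)).
  exact: measurable_itv.
have j1 := integrableZl m01 (2 * E) is1.
have j2 := integrableZl m01 (2 * E * del) is2.
have im : leb.-integrable `[(0 : R), 1] (fun t => (m t)%:E).
  exact: (integrableD m01 j1 j2).
have Km t : 0 <= t <= 1 -> nm (K t) <= m t.
  by move=> t01; rewrite (le_trans (nmD _ _))// lerD ?A_le ?B_le.
have m_int : \int[leb]_(t in `[0, 1]) m t <= 2 * E * (S + 1) + 1.
  rewrite (RintegralD m01 j1 j2) (RintegralZl _ m01 is1) (RintegralZl _ m01 is2).
  have h1 : 2 * E * \int[leb]_(t in `[0, 1]) s t <= 2 * E * (S + 1).
    by rewrite ler_wpM2l// mulr_ge0.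
  have h2 : 2 * E * del * \int[leb]_(t in `[0, 1]) (s t ^+ 2) <= 1.
    by apply: le_trans bS; rewrite ler_wpM2l// !mulr_ge0.
  exact: lerD.
have [Z [bZ ZE Zle]] := volterra_exists iK im Km bF F_le.
(* V agrees with Z on [0, 1], and its expression shows its continuity. *)
pose V x := forcing A B x + mxcint (fun t => K t *m Z t) x.
have iKZ : mintegrable (fun t => K t *m Z t) by exact: mintegrableM.
have bapp := mbounded_approx iA iB.
exists (fun x => frame mu x *m V x); split.
- move=> c1 c2 y y1 sol <- <- x x01.
  have mun0 : mu != 0 by apply: contraTneq mu0 => ->; rewrite cmod0 ltxx.
  have [Y [bY YE Yfr]] := solution_Volterra sL mun0 sol.
  set Y0 := mx2 _ _ _ _ in YE.
  have uniq : Y x - (approx A B x + Z x) *m Y0 = 0.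
    apply: (volterra_unique iK im Km
      (D := fun t => Y t - (approx A B t + Z t) *m Y0) _ _ x01) => [|t t01].
      apply: mboundedB => //; apply: mboundedM; last exact: mbounded_cst.
      exact: mboundedD.
    have /andP[t0 t1] := t01.
    have iKY : mintegrable (fun t => K t *m Y t) by exact: mintegrableM.
    have iKa : mintegrable (fun t => K t *m approx A B t) by exact: mintegrableM.
    have iKaZ := mintegrableD iKa iKZ.
    have iKaZY : mintegrable (fun t => (K t *m approx A B t + K t *m Z t) *m Y0).
      by apply: mintegrableM => //; exact: mbounded_cst.
    transitivity (mxcint (fun t => K t *m Y t -
        (K t *m approx A B t + K t *m Z t) *m Y0) t); last first.
      by apply: eq_mxcint => u _; rewrite mulmxBr -mulmxDr -mulmxA.
    rewrite (mxcintB t1 iKY iKaZY) (mxcintMr Y0 t1 iKaZ) (mxcintD t1 iKa iKZ).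
    have eY : Y t = Y0 + mxcint (fun t => K t *m Y t) t := YE _ t01.
    have eZ : approx A B t + Z t = 1%:M +
        (mxcint (fun t => K t *m approx A B t) t + mxcint (fun t => K t *m Z t) t).
      by rewrite (ZE _ t01) addrA (approx_eq iA iB t01) -addrA.
    rewrite eZ [in LHS]eY mulmxDl mul1mx opprD addrACA subrr add0r.
    by [].
  have YZ : frame mu x *m Y x = (W sigma x mu + frame mu x *m V x) *m Y0.
    move/eqP: uniq; rewrite subr_eq0 => /eqP ->.
    by rewrite mulmxA mulmxDr (W_factor mu sL x01) (ZE _ x01).
  rewrite -mulmxDl; have := Yfr x; rewrite YZ.
  set Q := W sigma x mu + _ => QY.
  have c0E : c0vec (y 0) (y1 0) mu = col ord0 Y0.
    apply/matrixP => i j; rewrite !mxE/=; case: ifP => _; by rewrite mulrC (mulrC (y1 0)) mulrC.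
  have -> : Q *m c0vec (y 0) (y1 0) mu = col ord0 (Q *m Y0).
    by rewrite c0E !colE mulmxA.
  rewrite QY; apply/matrixP => i j; rewrite !mxE/=; by case: ifP.
- apply: in_MC01M; first exact: in_MC01_frame.
  apply: in_MC01D; last exact: in_MC01_mxcint.
  exact: in_MC01_forcing.
- have VZ x : 0 <= x <= 1 -> V x = Z x by move=> x01; rewrite (ZE _ x01).
  have bound x : 0 <= x <= 1 -> nm (frame mu x *m V x) <=
      4 * E * (8 * Phi * expR (2 * E * (S + 1) + 1)).
    move=> x01; rewrite (VZ _ x01) (le_trans (nmM _ _))//.
    apply: ler_pM; rewrite ?nm_ge0//; first exact: nm_frame (ltW d0) x01.
    rewrite (le_trans (Zle _ x01))// ler_wpM2l ?ler_expR//.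
    have Phi0 : 0 <= Phi by exact: (le_trans (nm_ge0 _) (F_le _ x01)).
    by rewrite mulr_ge0.
  rewrite (le_trans (MC01norm_le bound))// /Phi /X /remainder_const -/E -/S.
  by rewrite le_eqVlt; apply/orP; left; apply/eqP; ring.
Qed.

End MainEstimate.

Theorem theorem4p1 (R : realType) :
  exists C : R -> R -> R,
    (forall d s : R, 0 < C d s) /\
    forall (sigma : R -> R[i]) (d : R),
      in_L2 sigma -> 0 < d ->
      exists W0 : R -> R[i] -> 'M[R[i]]_2,
        forall mu : R[i], Omega d sigma mu ->
          (forall (c1 c2 : R[i]) (y y1 : R -> R[i]),
             is_solution sigma mu y y1 -> y 0 = c1 -> y1 0 = c2 ->
             forall x : R, 0 <= x <= 1 ->
               cv2 (y x) ((iu * mu)^-1 * y1 x) =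
               W sigma x mu *m c0vec c1 c2 mu
               + W0 x mu *m c0vec c1 c2 mu) /\
          in_MC01 (fun x => W0 x mu) /\
          MC01norm (fun x => W0 x mu) <= C d (L2norm sigma) * rho sigma mu.
Proof.
exists remainder_const; split => [d s|sigma d sL d0].
  exact: remainder_const_gt0.
(* W0 is chosen for each mu separately; outside Omega its value is irrelevant. *)
have ex mu : exists W0 : R -> 'M[R[i]]_2, Omega d sigma mu ->
  [/\ forall (c1 c2 : R[i]) (y y1 : R -> R[i]),
        is_solution sigma mu y y1 -> y 0 = c1 -> y1 0 = c2 ->
        forall x : R, 0 <= x <= 1 ->
          cv2 (y x) ((iu * mu)^-1 * y1 x) =
          W sigma x mu *m c0vec c1 c2 mu + W0 x *m c0vec c1 c2 mu,
      in_MC01 W0 &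
      MC01norm W0 <= remainder_const d (L2norm sigma) * rho sigma mu].
  have [Om|nOm] := pselect (Omega d sigma mu); last by exists (fun=> 0).
  by have [W0 HW0] := remainder_exists sL d0 Om; exists W0.
have [W0 HW0] := choice ex.
exists (fun x mu => W0 mu x) => mu Om.
by have [h1 h2 h3] := HW0 mu Om; split.
Qed.
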